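(* Let $L$ be a non-degenerate integral lattice of rank $n$ with $\mathbb{Z}$-basis $B$, let $R=\{\rho_1,\dots,\rho_r\}$ and $S=\{\sigma_1,\dots,\sigma_s\}$ be disjoint subsets of $B$, and let $\lambda\in L^\circ$. The following hold. (i) If $\delta\in L(S)$ and $k_1,\dots,k_r$ are non-negative integers, then the set $\mathcal{B}(\mathrm{S}(\widehat{\mathfrak h}(S)_-))\otimes\mathcal{B}(R;\lambda+\delta;k_1,\dots,k_r)$ is a $\mathbb{C}$-basis of the vector space $W(R,S;\lambda)^\tau$, where $\tau=k_1\rho_1+\cdots+k_r\rho_r+\delta$. (ii) The set $$\mathcal{B}(R,S;\lambda)=\mathcal{B}(\mathrm{S}(\widehat{\mathfrak h}(S)_-))\otimes\coprod_{\delta\in L(S),\,k_1,\dots,k_r\ge0}\mathcal{B}(R;\lambda+\delta;k_1,\dots,k_r)$$ is a $\mathbb{C}$-basis of the vector space $W(R,S;\lambda)$.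
   Context: $L$ has form $\langle\cdot,\cdot\rangle:L\times L\to\mathbb{Z}$ and dual lattice $L^\circ$. $\mathfrak h=\mathbb{C}\otimes_{\mathbb Z}L$; $\widehat{\mathfrak h}=\mathfrak h\otimes\mathbb{C}[t,t^{-1}]\oplus\mathbb{C}\mathbf{k}$ is the affine (Heisenberg) central extension; $M(1)\cong\mathrm{S}(\widehat{\mathfrak h}_-)$, $\widehat{\mathfrak h}_-=\mathfrak h\otimes t^{-1}\mathbb{C}[t^{-1}]$, is its module induced from the one-dimensional module on which $\mathfrak h\otimes\mathbb{C}[t]$ acts by $0$ and $\mathbf{k}$ by $1$; $h_j$ is the action of $h\otimes t^j$. $V_L=M(1)\otimes\mathbb{C}[L]$ is the lattice vertex operator (super)algebra, and $V_{L^\circ}=M(1)\otimes\mathbb{C}[L^\circ]$ is a $V_L$-module, with $Y(e^\alpha,x)=\sum_{m\in\mathbb{Z}}(e^\alpha)_mx^{-m-1}=\exp(-\sum_{j<0}\frac{x^{-j}}{j}\alpha_j)\exp(-\sum_{j>0}\frac{x^{-j}}{j}\alpha_j)\,e_\alpha x^\alpha$, where $e_\alpha(h\otimes e^\beta)=\epsilon(\alpha,\beta)h\otimes e^{\alpha+\beta}$, $\epsilon(\alpha,\beta)\in\mathbb{C}^\times$ the standard 2-cocycle, and $x^\alpha(h\otimes e^\beta)=x^{\langle\alpha,\beta\rangle}h\otimes e^\beta$. Write $e^\beta$ for $1\otimes e^\beta$. For $B'\subset B$: $L(B')=\bigoplus_{\beta\in B'}\mathbb{Z}\beta$, $\mathfrak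 h(B')=\mathbb{C}\otimes_{\mathbb Z}L(B')$, $\widehat{\mathfrak h}(B')_-=\mathfrak h(B')\otimes t^{-1}\mathbb{C}[t^{-1}]$; $\mathrm{S}(\widehat{\mathfrak h}(B')_-)$ acts on $V_{L^\circ}$ by multiplication on the factor $M(1)$. $W(R,S)\subset V_L$ is the smallest vertex subalgebra containing $e^\rho$ ($\rho\in R$), $e^{\pm\sigma}$ and $\sigma_{-1}\otimes1$ ($\sigma\in S$). $W(R,S;\lambda)=W(R,S)\cdot e^\lambda\subset V_{L^\circ}$ is the cyclic $W(R,S)$-submodule generated by $e^\lambda$, and $W(R,S;\lambda)^\tau=W(R,S;\lambda)\cap(M(1)\otimes e^{\tau+\lambda})$. For $\mu\in L^\circ$ and non-negative integers $k_1,\dots,k_r$, let $M_i(R;\mu;k_1,\dots,k_r)$ ($1\le i\le r$) be the set of $(m_{k_i},\dots,m_1)\in\mathbb{Z}^{k_i}$ with $m_1\le-1-\sum_{l=1}^{i-1}k_l\langle\rho_i,\rho_l\rangle-\langle\rho_i,\mu\rangle$ and $m_{j+1}\le m_j-\langle\rho_i,\rho_i\rangle$ for $1\le j\le k_i-1$. For a sequence $\nu=(m_k,\dots,m_1)$ of integers and $\beta\in B$ put $\varepsilon^\beta_\nu=(e^\beta)_{m_k}\cdots(e^\beta)_{m_1}$, and $$\mathcal{B}(R;\mu;k_1,\dots,k_r)=\{\varepsilon^{\rho_r}_{\nu_r}\cdots\varepsilon^{\rho_1}_{\nu_1}\cdot e^\mu\mid\nu_i\in M_i(R;\mu;k_1,\dots,k_r),\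 1\le i\le r\}.$$ $\mathcal{B}(\mathrm{S}(\widehat{\mathfrak h}(S)_-))$ is the set of monomials $(\sigma_1)_{i_1^1}\cdots(\sigma_1)_{i_1^{l_1}}\cdots(\sigma_s)_{i_s^1}\cdots(\sigma_s)_{i_s^{l_s}}$ with $l_1,\dots,l_s\ge0$ and $i_j^1\le\cdots\le i_j^{l_j}\le-1$ ($1\le j\le s$), a basis of $\mathrm{S}(\widehat{\mathfrak h}(S)_-)$. For sets $X,Y$ of vectors, $X\otimes Y=\{x\otimes y\mid x\in X,y\in Y\}$, where for $x\in\mathrm{S}(\widehat{\mathfrak h}(S)_-)$ and $y\in V_{L^\circ}$ the element $x\otimes y$ is identified with the product $x\cdot y\in V_{L^\circ}$. *)

(* Defs.v *)
From mathcomp Require Import all_boot all_order all_algebra finmap.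
From mathcomp Require Import boolp classical_sets functions fsbigop reals.
From mathcomp Require Import complex.
From mathcomp Require Import monalg.

Set Implicit Arguments.
Unset Strict Implicit.
Unset Printing Implicit Defensive.

Import Order.TTheory GRing.Theory Num.Theory.

Local Open Scope classical_set_scope.
Local Open Scope ring_scope.

Section LinearAlgebra.
Context {F : fieldType} {E : lmodType F}.
Implicit Types A W : set E.

Definition subspace W : Prop :=
  [/\ W 0, forall v w, W v -> W w -> W (v + w)
    & forall (c : F) v, W v -> W (c *: v)].

Definition lspan A : set E :=
  [set v | exists (s : seq E) (c : E -> F),
     (forall w, w \in s -> A w) /\ v = \sum_(w <- s) c w *: w].

Definition lin_indep A : Prop :=
  forall (s : seq E) (c : E -> F),
    uniq s -> (forall w, w \in s -> A w) ->
    \sum_(w <- s) c w *: w = 0 -> forall w, w \in s -> c w = 0.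

Definition is_basis A W : Prop := lin_indep A /\ lspan A = W.

(* [expcoef a k] is the coefficient of y^k in exp (\sum_(j >= 1) a_j y^j),
   for a family (a_j) of endomorphisms of E. *)
Definition expcoef (a : nat -> E -> E) (k : nat) (v : E) : E :=
  \sum_(l < k.+1) (l`!%:R : F)^-1 *:
    \sum_(t : l.-tuple 'I_k.+1 |
            all (fun j : 'I_k.+1 => 0 < j)%N t && (\sum_(j <- t) j == k)%N)
      foldr (fun (j : 'I_k.+1) w => a j w) v t.

End LinearAlgebra.

(* The lattice L is Z^n, its Z-basis B = {b_i | i : 'I_n} is the standard basis
   and the form is given by the Gram matrix G.  L and its dual are viewed inside
   Q (x) L = 'rV[rat]_n, and C (x) L is 'rV[F]_n with F the field C. *)
Section Lattice.
Context {n : nat} (G : 'M[int]_n).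

Definition gform {F : nzRingType} (x y : 'rV[F]_n) : F :=
  (x *m map_mx intr G *m y^T) ord0 ord0.

Definition symmetric_gram : Prop := forall x y : 'rV[int]_n, gform x y = gform y x.

Definition nondegenerate_gram : Prop :=
  forall x : 'rV[int]_n, (forall y : 'rV[int]_n, gform x y = 0) -> x = 0.

Definition bvec {F : nzRingType} (i : 'I_n) : 'rV[F]_n := delta_mx ord0 i.

(* L(B'), where a subset of B is given by its set of indices *)
Definition sublattice (B' : {pred 'I_n}) : set 'rV[rat]_n :=
  [set x | exists c : 'I_n -> int, x = \sum_(i in B') (c i)%:~R *: bvec i].

Definition lattice : set 'rV[rat]_n := sublattice predT.

Definition dual_lattice : set 'rV[rat]_n :=
  [set x | forall y, lattice y -> gform x y \is a Num.int].

(* A normalized 2-cocycle L x L^o -> C^* whose restriction to L x L has the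
   commutator map (-1)^(<a,b> + <a,a><b,b>) of the lattice vertex superalgebra;
   its values outside L x L^o are irrelevant. *)
Definition standard_cocycle {F : fieldType}
    (eps : 'rV[rat]_n -> 'rV[rat]_n -> F) : Prop :=
  [/\ forall a b, lattice a -> dual_lattice b -> eps a b != 0,
      forall b, dual_lattice b -> eps 0 b = 1,
      forall a, lattice a -> eps a 0 = 1,
      forall a b c, lattice a -> lattice b -> dual_lattice c ->
        eps a b * eps (a + b) c = eps b c * eps a (b + c)
    & forall a b : 'rV[int]_n,
        eps (map_mx intr a) (map_mx intr b) =
        (-1) ^ (gform a b + gform a a * gform b b)
          * eps (map_mx intr b) (map_mx intr a)].

End Lattice.

Section LatticeVOA.
Context {F : fieldType} {n : nat} (G : 'M[int]_n).
Context (eps : 'rV[rat]_n -> 'rV[rat]_n -> F).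

(* The variable (i, k) stands for b_i (x) t^(-k-1). *)
Definition fockvar (m : nat) : choiceType := ('I_m * nat)%type.

(* M(1) = S(h^_-), a polynomial algebra in infinitely many variables *)
Local Notation M1 := {malg F[{cmonom fockvar n}]}.

(* M(1) (x) C[Q (x) L], with basis the pairs (monomial, lattice point);
   V_L and V_{L^o} are the subspaces [VL] and [VLdual] below. *)
Local Notation monom := ({cmonom fockvar n} * 'rV[rat]_n)%type.
Local Notation V := {malg F[monom]}.

Definition linext {I : choiceType} (f : I -> V) (v : {malg F[I]}) : V :=
  \sum_(b <- msupp v) v@_b *: f b.

Definition tens (u : M1) (beta : 'rV[rat]_n) : V :=
  linext (fun m : {cmonom fockvar n} => << (m, beta) >>) u.

Definition expv (beta : 'rV[rat]_n) : V := tens 1 beta.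

(* multiplication on the tensor factor M(1) *)
Definition actM (x : M1) (v : V) : V :=
  linext (fun m : {cmonom fockvar n} => linext (fun b : monom => << (mmul m b.1, b.2) >>) v) x.

Definition supported (D : set 'rV[rat]_n) : set V :=
  [set v | forall b, b \in msupp v -> D b.2].

Definition VL : set V := supported lattice.
Definition VLdual : set V := supported (dual_lattice G).

(* 1 (x) x, for x in Q (x) L *)
Definition cplx (x : 'rV[rat]_n) : 'rV[F]_n := map_mx ratr x.

(* h (x) t^j for j <= -1 *)
Definition creator (h : 'rV[F]_n) (j : int) : M1 :=
  \sum_(i < n) h ord0 i *: << ucm (i, `|j|%N.-1) >>.

(* The action h_j of h (x) t^j: for j > 0 it is the derivation of M(1) that
   sends h' (x) t^(-l) to j <h, h'> if l = j and to 0 otherwise. *)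
Definition heis (h : 'rV[F]_n) (j : int) : V -> V :=
  match j with
  | Negz _ => actM (creator h j)
  | Posz 0 => linext (fun b : monom => gform G h (cplx b.2) *: << b >>)
  | Posz k.+1 => linext (fun b : monom => \sum_(i < n)
      (k.+1%:R * gform G h (bvec i) * (b.1 (i, k))%:R)
        *: << (divcm b.1 (ucm (i, k)), b.2) >>)
  end.

(* coefficients of x^p and of x^(-q) in the two exponentials of Y(e^alpha, x) *)
Definition Eminus (alpha : 'rV[rat]_n) (p : nat) : V -> V :=
  expcoef (fun j w => - ((- j%:Z)%:~R^-1 *: heis (cplx alpha) (- j%:Z) w)) p.

Definition Eplus (alpha : 'rV[rat]_n) (q : nat) : V -> V :=
  expcoef (fun j w => - (j%:R^-1 *: heis (cplx alpha) j%:Z w)) q.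

Definition eshift (alpha : 'rV[rat]_n) : V -> V :=
  linext (fun b : monom => eps alpha b.2 *: << (b.1, alpha + b.2) >>).

(* (e^alpha)_m, the coefficient of x^(-m-1) in Y(e^alpha, x).  The sum is over
   the exponents p of the first exponential and -q of the second one, such that
   p - q + <alpha, beta> = -m-1; it has finite support, since [Eplus alpha q]
   kills a given vector for large q. *)
Definition emode (alpha : 'rV[rat]_n) (m : int) : V -> V :=
  linext (fun b : monom =>
    \sum_(pq \in [set pq : nat * nat |
                  pq.1%:R - pq.2%:R + gform G alpha b.2 = - m%:~R - 1])
      Eminus alpha pq.1 (Eplus alpha pq.2 (eshift alpha << b >>))).

(* The coefficient of x^(-m-1) in
     Y(b_{i_1} (x) t^(-k_1-1) ... b_{i_l} (x) t^(-k_l-1) (x) e^alpha, x)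
     = : (d/dx)^{k_1} b_{i_1}(x) / k_1! ... (d/dx)^{k_l} b_{i_l}(x) / k_l!
         Y(e^alpha, x) :
   with h(x) = \sum_j h_j x^(-j-1) and : a(x) b(x) : = a(x)_- b(x) + b(x) a(x)_+,
   where a(x)_- collects the h_j with j < 0 (here j = -p-1) and a(x)_+ those with
   j >= 0 (here j = p).  Both sums have finite support. *)
Fixpoint mode_seq (s : seq (fockvar n)) (alpha : 'rV[rat]_n) (m : int) (w : V)
    : V :=
  match s with
  | [::] => emode alpha m w
  | (i, k) :: s' =>
      \sum_(p \in [set: nat])
        'C(p, k)%:R *: heis (bvec i) (Negz p)
                         (mode_seq s' alpha (m + p%:Z - k%:Z) w)
    + \sum_(p \in [set: nat])
        ((-1) ^+ k * 'C(p + k, k)%:R) *: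
          mode_seq s' alpha (m - p%:Z - k%:Z - 1) (heis (bvec i) p%:Z w)
  end.

(* The factors of a monomial, with multiplicity; the normally ordered product
   above does not depend on their order. *)
Definition factors (m : {cmonom fockvar n}) : seq (fockvar n) :=
  flatten [seq nseq (m x) x | x <- enum_fset (finsupp m)].

(* v_m w, where Y(v, x) w = \sum_m v_m w x^(-m-1) *)
Definition vmode (v : V) (m : int) (w : V) : V :=
  linext (fun b : monom => mode_seq (factors b.1) b.2 m w) v.

(* Closure under the translation operator v |-> v_{-2} 1 is automatic. *)
Definition vertex_subalgebra (U : set V) : Prop :=
  [/\ subspace U, U `<=` VL, U (expv 0)
    & forall u v (m : int), U u -> U v -> U (vmode u m v)].

Definition submodule (A M : set V) : Prop :=
  [/\ subspace M, M `<=` VLdual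
    & forall u v (m : int), A u -> M v -> M (vmode u m v)].

Section PrincipalSubspace.
Context {r s : nat} (rho : 'I_r -> 'I_n) (sigma : 'I_s -> 'I_n).

Definition generators : set V :=
  [set v | (exists i, v = expv (bvec (rho i)))
        \/ (exists j, [\/ v = expv (bvec (sigma j)),
                          v = expv (- bvec (sigma j))
                        | v = tens (creator (bvec (sigma j)) (-1)) 0])].

Definition WRS : set V := smallest vertex_subalgebra generators.

Definition WRSmod (lambda : 'rV[rat]_n) : set V :=
  smallest (submodule WRS) [set expv lambda].

Definition WRSgr (lambda tau : 'rV[rat]_n) : set V :=
  WRSmod lambda `&` [set v | exists u, v = tens u (tau + lambda)].

(* A sequence nu = [:: m_k; ...; m_1] is written as in the composition
   (e^beta)_{m_k} ... (e^beta)_{m_1}, so [entry nu j] is m_j for 1 <= j <= k. *)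
Definition entry (nu : seq int) (j : nat) : int := nth 0 (rev nu) j.-1.

Definition Mset (mu : 'rV[rat]_n) (k : 'I_r -> nat) (i : 'I_r)
    : set (seq int) :=
  [set nu | [/\ size nu = k i,
     (0 < k i)%N ->
       (entry nu 1)%:~R <= - 1
         - \sum_(l < r | (l < i)%N)
             (k l)%:R * gform G (bvec (rho i)) (bvec (rho l))
         - gform G (bvec (rho i)) mu :> rat
   & forall j : nat, (1 <= j <= k i - 1)%N ->
       (entry nu j.+1)%:~R <=
         (entry nu j)%:~R - gform G (bvec (rho i)) (bvec (rho i)) :> rat]].

Definition epsmon (beta : 'rV[rat]_n) (nu : seq int) (v : V) : V :=
  foldr (fun m w => emode beta m w) v nu.

Definition Rbasis (mu : 'rV[rat]_n) (k : 'I_r -> nat) : set V :=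
  [set v | exists nu : 'I_r -> seq int,
     (forall i, Mset mu k i (nu i)) /\
     v = foldl (fun w i => epsmon (bvec (rho i)) (nu i) w)
               (expv mu) (enum 'I_r)].

Definition Sbasis : set M1 :=
  [set x | exists I : 'I_s -> seq int,
     (forall j, sorted <=%R (I j) /\ (forall z, z \in I j -> z <= - 1)) /\
     x = \prod_(j < s) \prod_(z <- I j) creator (bvec (sigma j)) z].

Definition tensor_set (X : set M1) (Y : set V) : set V :=
  [set actM x y | x in X & y in Y].

End PrincipalSubspace.
End LatticeVOA.

(* Main.v *)
Require Import Defs.
From mathcomp Require Import all_boot all_order all_algebra finmap.
From mathcomp Require Import boolp classical_sets functions fsbigop reals.
From mathcomp Require Import complex.
From mathcomp Require Import monalg zify ring lra.

Set Implicit Arguments.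
Unset Strict Implicit.
Unset Printing Implicit Defensive.

Import Order.TTheory GRing.Theory Num.Theory.

Local Open Scope classical_set_scope.
Local Open Scope ring_scope.

(* M(1) is the polynomial algebra in the variables [X (i, k)] = b_i (x) t^(-k-1),
   and h_d(rho) denotes the coefficient of x^d in exp (- \sum_(j < 0) rho_j x^(-j) / j).

   Upper bound: let F_k be the span of the products of a monomial in the sigma's and
   of factors h_d(rho_i), k_i of them for each i.  The sum of all
   F_k (x) e^(lambda + delta + \sum_i k_i rho_i) with delta in L(S) contains e^lambda
   and is stable under the modes of W(R,S): positive modes of the Heisenberg algebra
   act by constant coefficient derivations, which preserve F_k, and the state-field
   correspondence on M(1) e^alpha involves the divided powers of T + alpha_{-1}, T the
   translation derivation, which preserve F_k when alpha = delta + \sum_i k_i rho_i.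

   Lower bound and basis: (e^rho_i)_m applied to q (x) e^mu multiplies q by a
   leading h_d(rho_i), with d = -m - 1 - <rho_i, mu>, up to terms with larger d.  The
   conditions defining M_i say that d >= 0 and that d weakly increases along the
   successive modes of each e^rho_i, so an element of the basis is a nonzero multiple
   of \prod h_d(rho_i) plus products of higher rank; this triangularity transfers
   spanning and independence from the products of the h_d(rho_i) to the proposed basis.
   Those products are independent together with the monomials in the sigma's because
   the lowest degree part of h_d(rho) is rho_{-d} / d. *)

(** W(R,S) and its module are closed under the modes of all their elements, so stability of the
    upper bound needs a formula for the modes of f (x) e^alpha with f an arbitrary polynomial. It is
    organised by the number l of factors of f that annihilate: these are removed from f by partial
    derivatives and act on the argument, while the creating factors and the first exponential
    assemble into e^(x (T + alpha_{-1})) f.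

    The sums in the definition of a mode run over infinite sets, and such a sum is 0 by convention
    when its support is infinite. Hence every formula carries a cutoff, justified by the weight of
    the argument, and even linearity of the modes rests on truncation.

    Most of the algebra takes place in a commutative algebra A known only through generators X and
    derivations with prescribed values on them; M(1) is the instance.

    A factor h_0 = 1 leaves no trace in a polynomial, so products of the h_d(rho_i) can be
    independent only for fixed k; different k are separated by their lattice points. An additive
    numerical rank replaces the lexicographic order, so that triangularity becomes induction on
    natural numbers. *)

Section Spans.
Context {F : fieldType} {E : lmodType F}.
Implicit Types A W : set E.

Lemma subspace0 W : subspace W -> W 0. Proof. by case. Qed.

Lemma subspaceD W u v : subspace W -> W u -> W v -> W (u + v).
Proof. by case=> _ + _; apply. Qed.

Lemma subspaceZ W c v : subspace W -> W v -> W (c *: v).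
Proof. by case=> _ _; apply. Qed.

Lemma subspaceB W u v : subspace W -> W u -> W v -> W (u - v).
Proof.
by move=> sW Wu Wv; rewrite -scaleN1r; apply: subspaceD => //; apply: subspaceZ.
Qed.

Lemma subspace_sum W I (r : seq I) (P : pred I) (f : I -> E) :
  subspace W -> (forall i, P i -> W (f i)) -> W (\sum_(i <- r | P i) f i).
Proof.
by move=> sW Wf; elim/big_ind: _ => //; [apply: subspace0 | move=> *; apply: subspaceD].
Qed.

Lemma subspace_sum_seq W (I : eqType) (r : seq I) (f : I -> E) :
  subspace W -> (forall i, i \in r -> W (f i)) -> W (\sum_(i <- r) f i).
Proof. by move=> sW Wf; rewrite big_seq; apply: subspace_sum. Qed.

(** In [lspan] the coefficient is a function of the vector, whereas a list of pairs may repeat a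
    vector with different coefficients; these are added up. *)
Lemma lspan_pairs A (s : seq (F * E)) :
  (forall p, p \in s -> A p.2) -> lspan A (\sum_(p <- s) p.1 *: p.2).
Proof.
move=> As; exists (undup (map snd s)), (fun w => \sum_(p <- s | p.2 == w) p.1).
split=> [w|]; first by rewrite mem_undup => /mapP[p ps ->]; apply: As.
under [RHS]eq_bigr => w _ do rewrite scaler_suml big_mkcond.
rewrite exchange_big /= big_seq [RHS]big_seq; apply: eq_bigr => p ps.
rewrite (bigD1_seq p.2) ?undup_uniq ?mem_undup ?map_f //= eqxx big1 ?addr0 //.
by move=> w /negPf; rewrite eq_sym => ->.
Qed.

Lemma subspace_lspan A : subspace (lspan A).
Proof.
split.
- by exists [::], (fun=> 0); rewrite big_nil.
- move=> _ _ [s [c [As ->]]] [t [d [At ->]]].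
  have := @lspan_pairs A ([seq (c w, w) | w <- s] ++ [seq (d w, w) | w <- t]).
  rewrite big_cat !big_map; apply=> p.
  by rewrite mem_cat => /orP[] /mapP[w ws ->]; [apply: As | apply: At].
- move=> a _ [s [c [As ->]]]; exists s, (fun w => a * c w); split=> //.
  by rewrite scaler_sumr; apply: eq_bigr => w _; rewrite scalerA.
Qed.

Lemma mem_lspan A v : A v -> lspan A v.
Proof.
move=> Av; have := @lspan_pairs A [:: (1, v)]; rewrite big_seq1 scale1r; apply.
by move=> p; rewrite inE => /eqP ->.
Qed.

Lemma lspan_min A W : subspace W -> A `<=` W -> lspan A `<=` W.
Proof.
move=> sW AW _ [s [c [As ->]]]; apply: subspace_sum_seq => // w ws.
by apply: subspaceZ => //; apply/AW/As.
Qed.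

Lemma lspanS A A' : A `<=` A' -> lspan A `<=` lspan A'.
Proof.
by move=> AA; apply: lspan_min (subspace_lspan _) _ => v /AA; apply: mem_lspan.
Qed.

End Spans.

Section LinearMaps.
Context {F : fieldType} {E E' : lmodType F}.
Implicit Types (f : E -> E').

Lemma lin0 f : linear f -> f 0 = 0.
Proof. by move=> lf; have := lf (-1) 0 0; rewrite scaler0 addr0 scaleN1r addNr. Qed.

Lemma linZ f : linear f -> forall c u, f (c *: u) = c *: f u.
Proof. by move=> lf c u; have := lf c u 0; rewrite !addr0 lin0 // addr0. Qed.

Lemma linD f : linear f -> forall u v, f (u + v) = f u + f v.
Proof. by move=> lf u v; have := lf 1 u v; rewrite !scale1r. Qed.

Lemma linN f : linear f -> forall u, f (- u) = - f u.
Proof. by move=> lf u; rewrite -scaleN1r linZ // scaleN1r. Qed.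

Lemma lin_sum f I (r : seq I) (P : pred I) (g : I -> E) : linear f ->
  f (\sum_(i <- r | P i) g i) = \sum_(i <- r | P i) f (g i).
Proof. by move=> lf; apply: big_morph; [apply: linD | apply: lin0]. Qed.

Lemma linear_scale f a : linear f -> linear (fun u => a *: f u).
Proof. by move=> lf c u v; rewrite lf scalerDr !scalerA mulrC. Qed.

Lemma subspace_eqfun f g : linear f -> linear g -> subspace [set u | f u = g u].
Proof.
move=> lf lg; split=> /= [|u v fu fv|c v fv]; first by rewrite !lin0.
  by rewrite (linD lf) (linD lg) fu fv.
by rewrite (linZ lf) (linZ lg) fv.
Qed.

Lemma subspace_preim f (W : set E') : linear f -> subspace W -> subspace (f @^-1` W).
Proof.
move=> lf sW; split=> /= [|u v|c v]; first by rewrite lin0 //; apply: subspace0.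
  by rewrite linD //; apply: subspaceD.
by rewrite linZ //; apply: subspaceZ.
Qed.

Lemma lspan_lin f (A : set E) (W : set E') : linear f -> subspace W ->
  (forall v, A v -> W (f v)) -> forall v, lspan A v -> W (f v).
Proof. by move=> lf sW AW; apply: lspan_min => //; apply: subspace_preim. Qed.

End LinearMaps.

Lemma linear_bigsum {F : fieldType} {E E' : lmodType F} (I : Type) (r : seq I)
    (f : I -> E -> E') :
  (forall i, linear (f i)) -> linear (fun u => \sum_(i <- r) f i u).
Proof.
by move=> lf c u v; rewrite scaler_sumr -big_split; apply: eq_bigr => i _; apply: lf.
Qed.

Lemma sum_ord_trunc {E : zmodType} (g : nat -> E) S L : (S <= L)%N ->
  (forall l, (S <= l)%N -> (l < L)%N -> g l = 0) -> \sum_(l < L) g l = \sum_(l < S) g l.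
Proof.
move=> SL g0; rewrite -!(big_mkord xpredT g) (big_cat_nat (n := S)) //=.
rewrite [X in _ + X]big1_seq ?addr0 // => l /andP[_].
by rewrite mem_index_iota => /andP[]; apply: g0.
Qed.

Lemma scaler_swap {F : fieldType} {E : lmodType F} (a e : F) (x x' y' : E) :
  x' = e *: x -> y' = a *: x -> a *: x' = e *: y'.
Proof. by move=> -> ->; rewrite !scalerA mulrC. Qed.

Lemma linear_comp {F : fieldType} {E E' E'' : lmodType F} (f : E -> E') (g : E' -> E'') :
  linear f -> linear g -> linear (fun u => g (f u)).
Proof. by move=> lf lg c u v; rewrite lf lg. Qed.

(** * Exponentials of commuting families of operators *)

Section ExpCoef.
Context {F : numFieldType} {E : lmodType F}.

(** The coefficient of y^k in the l-th power of \sum_(j >= 1) a_j y^j, computed by peeling off the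
    outermost factor. *)
Fixpoint powcoef (a : nat -> E -> E) (l k : nat) (v : E) : E :=
  if l is l'.+1 then \sum_(j < k) a j.+1 (powcoef a l' (k - j.+1) v)
  else if k == 0%N then v else 0.

Lemma powcoef_eq0 (a : nat -> E -> E) l k v :
  (forall j, linear (a j)) -> (k < l)%N -> powcoef a l k v = 0.
Proof.
move=> la; elim: l k => //= l IH k kl; apply: big1 => j _.
by rewrite IH ?lin0 //; have := ltn_ord j; lia.
Qed.

(** The bound N on the parts is kept apart from k: k decreases along the induction while the type of
    the parts must stay fixed. *)
Lemma powcoef_tuple (a : nat -> E -> E) N l k v :
  (forall j, linear (a j)) -> (k < N)%N ->
  \sum_(t : l.-tuple 'I_N | all (fun j : 'I_N => 0 < j)%N t && (\sum_(j <- t) j == k)%N)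
     foldr (fun (j : 'I_N) w => a j w) v t = powcoef a l k v.
Proof.
move=> la; elim: l k => [|l IH] k kN /=.
  case: (eqVneq k 0%N) => [->|k0].
    rewrite (big_pred1 [tuple]) // => t; rewrite tuple0 /= big_nil.
    by apply/esym/eqP.
  by apply: big_pred0 => t; rewrite tuple0 /= big_nil eq_sym; apply: negbTE.
rewrite (reindex (fun p : 'I_N * l.-tuple 'I_N => cons_tuple p.1 p.2)) /=; last first.
  exists (fun t : l.+1.-tuple 'I_N => (thead t, behead_tuple t)) => [[x t] _|t _].
    by rewrite theadE; congr pair; apply: val_inj.
  by rewrite [RHS]tuple_eta; apply: val_inj.
have eqP0 (p : 'I_N * l.-tuple 'I_N) :
    [&& (0 < p.1)%N, all (fun j : 'I_N => 0 < j)%N p.2 & (\sum_(j <- p.1 :: p.2) j == k)%N]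
  = ((0 < p.1)%N && (p.1 <= k)%N) &&
    (all (fun j : 'I_N => 0 < j)%N p.2 && (\sum_(j <- p.2) j == k - p.1)%N).
  by rewrite big_cons; lia.
under eq_bigl => p do rewrite -andbA eqP0.
rewrite -(pair_big_dep (fun j : 'I_N => (0 < j)%N && (j <= k)%N)
  (fun j (t : l.-tuple 'I_N) => all (fun j : 'I_N => 0 < j)%N t && (\sum_(i <- t) i == k - j)%N)
  (fun j t => a j (foldr (fun (j : 'I_N) w => a j w) v t))) /=.
under eq_bigr => j jk.
  rewrite -lin_sum // IH; last by have := ltn_ord j; lia.
  over.
pose G j := if (0 < j)%N && (j <= k)%N then a j (powcoef a l (k - j) v) else 0.
rewrite big_mkcond /= -/(G _) (eq_bigr (fun j : 'I_N => G j)) //.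
rewrite -(big_mkord xpredT G) (big_cat_nat (n := k.+1)) //=.
rewrite [X in _ + X]big1_seq ?addr0; last first.
  by move=> j; rewrite mem_index_iota /G => /= jk; case: ifP => //; lia.
rewrite big_nat_recl // {1}/G /= add0r big_mkord.
by apply: eq_bigr => j _; rewrite /G /= ltn_ord.
Qed.

(** Powers with l > k contribute nothing, so L is free and coefficients of several degrees can share
    one range of summation. *)
Lemma expcoefE (a : nat -> E -> E) L k v : (forall j, linear (a j)) -> (k < L)%N ->
  expcoef a k v = \sum_(l < L) (l`!%:R : F)^-1 *: powcoef a l k v.
Proof.
move=> la kL; rewrite /expcoef.
under eq_bigr => l _ do rewrite powcoef_tuple //.
rewrite -(big_mkord xpredT (fun l => (l`!%:R : F)^-1 *: powcoef a l k v)).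
rewrite -(big_mkord xpredT (fun l => (l`!%:R : F)^-1 *: powcoef a l k v)).
rewrite [RHS](big_cat_nat (n := k.+1)) //= [X in _ = _ + X]big1_seq ?addr0 //.
by move=> l /=; rewrite mem_index_iota => kl; rewrite powcoef_eq0 ?scaler0 //; lia.
Qed.

Lemma expcoef0 (a : nat -> E -> E) v : (forall j, linear (a j)) -> expcoef a 0 v = v.
Proof.
by move=> la; rewrite (@expcoefE _ 1) // big_ord1 /= fact0 invr1 scale1r.
Qed.

(** This is y (A^(l+1))' = (l+1) y A' A^l for A = \sum_j a_j y^j. Commutation brings the
    differentiated factor to the front. *)
Lemma powcoef_rec (a : nat -> E -> E) l k v :
  (forall j, linear (a j)) -> (forall i j w, a i (a j w) = a j (a i w)) ->
  k%:R *: powcoef a l.+1 k v =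
  l.+1%:R *: \sum_(j < k) j.+1%:R *: a j.+1 (powcoef a l (k - j.+1) v).
Proof.
move=> la ca; elim: l k => [|l IH] k.
  rewrite scale1r /= scaler_sumr; apply: eq_bigr => j _.
  case: (posnP (k - j.+1)) => [kj|]; last by case: (k - j.+1)%N => // m _; rewrite lin0 // !scaler0.
  by congr (_%:R *: _); have := ltn_ord j; lia.
(* Leibniz rule: k is the degree of the outermost factor plus the degree of the remaining ones. *)
have splitk (j : 'I_k) : k%:R = j.+1%:R + (k - j.+1)%:R :> F.
  by rewrite -natrD subnKC.
rewrite [in LHS]/= scaler_sumr.
under eq_bigr => j _ do rewrite (splitk j) scalerDl -[X in _ + X](linZ (la _)) IH.
rewrite big_split /= -[in RHS](addn1 l.+1) natrD scalerDl scale1r addrC.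
congr (_ + _); rewrite scaler_sumr.
(* Both double sums are brought to a triangle symmetric in the two indices, so that they can be
   exchanged. *)
have tri (f : nat -> nat -> E) : \sum_(j < k) \sum_(i < k - j.+1) f j i
    = \sum_(j < k) \sum_(i < k | (j.+1 + i < k)%N) f j i.
  apply: eq_bigr => j _.
  rewrite -(big_mkord xpredT (f j)) -(big_mkord (fun i => (j.+1 + i < k)%N) (f j)).
  rewrite [RHS](big_cat_nat (n := (k - j.+1)%N)) ?leq_subr //=.
  rewrite [X in _ = _ + X]big1_seq ?addr0; last first.
    by move=> i; rewrite mem_index_iota; lia.
  rewrite big_nat_cond [RHS]big_nat_cond; apply: eq_bigl => i; lia.
transitivity (\sum_(j < k) \sum_(i < k - j.+1) l.+1%:R *: (i.+1%:R *:
    a j.+1 (a i.+1 (powcoef a l (k - j.+1 - i.+1) v)))).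
  apply: eq_bigr => j _; rewrite (linZ (la _)) (lin_sum _ _ _ (la _)) scaler_sumr.
  by apply: eq_bigr => i _; rewrite (linZ (la _)).
rewrite (tri (fun j i => l.+1%:R *: (i.+1%:R *:
    a j.+1 (a i.+1 (powcoef a l (k - j.+1 - i.+1) v))))).
under [RHS]eq_bigr => i _ do rewrite /= lin_sum // scaler_sumr scaler_sumr.
rewrite (tri (fun i j => l.+1%:R *: (i.+1%:R *:
    a i.+1 (a j.+1 (powcoef a l (k - i.+1 - j.+1) v))))).
rewrite (exchange_big_dep xpredT) //=; apply: eq_bigr => i _.
apply: eq_big => [j|j _]; first by rewrite addSn addnC addSn addnC.
by rewrite ca; congr (_ *: (_ *: a _ (a _ (powcoef _ _ _ _)))); lia.
Qed.

(** This is y (exp A)' = y A' exp A. In characteristic 0 it determines the coefficients, and it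
    drives the inductions on [hc] and [ep]. *)
Lemma expcoef_rec (a : nat -> E -> E) k v :
  (forall j, linear (a j)) -> (forall i j w, a i (a j w) = a j (a i w)) ->
  k%:R *: expcoef a k v = \sum_(j < k) j.+1%:R *: a j.+1 (expcoef a (k - j.+1) v).
Proof.
move=> la ca; case: k => [|k]; first by rewrite scale0r big_ord0.
rewrite (@expcoefE _ k.+2) // big_ord_recl /= scaler0 add0r scaler_sumr.
under [RHS]eq_bigr => j _.
  rewrite (@expcoefE _ k.+1) //; last lia.
  rewrite lin_sum // scaler_sumr; over.
rewrite exchange_big /=; apply: eq_bigr => l _.
rewrite scalerA mulrC -scalerA powcoef_rec // scalerA factS natrM invfM mulrAC.
rewrite mulVf ?pnatr_eq0 // mul1r scaler_sumr; apply: eq_bigr => j _.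
by rewrite (linZ (la _)) !scalerA mulrC.
Qed.

Lemma linear_powcoef (a : nat -> E -> E) l k :
  (forall j, linear (a j)) -> linear (powcoef a l k).
Proof.
move=> la c u v; elim: l k => [|l IH] k /=.
  by case: eqP; rewrite ?scaler0 ?addr0.
by rewrite scaler_sumr -big_split /=; apply: eq_bigr => j _; rewrite IH (la _).
Qed.

Lemma linear_expcoef (a : nat -> E -> E) k :
  (forall j, linear (a j)) -> linear (expcoef a k).
Proof.
move=> la c u v; rewrite !(@expcoefE _ k.+1) // scaler_sumr -big_split /=.
by apply: eq_bigr => l _; rewrite linear_powcoef // scalerDr !scalerA mulrC.
Qed.

End ExpCoef.

Section ExpCoefMap.
Context {F : numFieldType} {E E' : lmodType F}.

(** Exponentials are transported along intertwiners; the instances are multiplication by a fixed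
    element and u |-> u (x) e^beta. *)
Lemma expcoef_map (phi : E -> E') (a : nat -> E -> E) (a' : nat -> E' -> E') k v :
  linear phi -> (forall j, linear (a j)) -> (forall j, linear (a' j)) ->
  (forall j w, a' j (phi w) = phi (a j w)) ->
  expcoef a' k (phi v) = phi (expcoef a k v).
Proof.
move=> lphi la la' aphi; rewrite !(@expcoefE _ _ _ k.+1) // (lin_sum _ _ _ lphi).
apply: eq_bigr => l _; rewrite (linZ lphi); congr (_ *: _).
elim: (nat_of_ord l) {2 4}k => [|{}l' IH] m /=.
  by case: eqP => // _; rewrite lin0.
by rewrite (lin_sum _ _ _ lphi); apply: eq_bigr => j _; rewrite IH aphi.
Qed.

End ExpCoefMap.

(** * Linear extension from a basis, and derivations of the polynomial algebra M(1) *)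

Section MalgExtension.
Context {F : fieldType} {I : choiceType} {E : lmodType F}.

(** The same expression as [linext] with values in any vector space, so that its lemmas hold for
    [linext] by conversion. *)
Definition mext (f : I -> E) (v : {malg F[I]}) : E := \sum_(b <- msupp v) v@_b *: f b.

Lemma mextw (f : I -> E) (d : {fset I}) v : (msupp v `<=` d)%fset ->
  mext f v = \sum_(b <- d) v@_b *: f b.
Proof.
move=> vd; apply: big_fset_incl => // b _ bv.
by rewrite mcoeff_outdom ?scale0r.
Qed.

Lemma linear_mext (f : I -> E) : linear (mext f).
Proof.
move=> c u v; have sub : (msupp (c *: u + v) `<=` msupp u `|` msupp v)%fset.
  apply: fsubset_trans (msuppD_le _ _) _; apply: fsetSU; exact: msuppZ_le.
rewrite (mextw _ sub) (mextw f (fsubsetUl (msupp u) (msupp v))).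
rewrite (mextw f (fsubsetUr (msupp u) (msupp v))) scaler_sumr -big_split /=.
by apply: eq_bigr => b _; rewrite mcoeffD mcoeffZ scalerDl scalerA.
Qed.

Lemma mextU (f : I -> E) b : mext f << b >> = f b.
Proof. by rewrite /mext msuppU oner_eq0 big_seq_fset1 mcoeffUU scale1r. Qed.

Lemma malg_sum (v : {malg F[I]}) : v = \sum_(b <- msupp v) v@_b *: << b >>.
Proof.
rewrite [LHS]monalgE; apply: eq_bigr => b _; apply/malgP => k.
by rewrite mcoeffZ !mcoeffU mulrnAr mulr1.
Qed.

Lemma eq_linear (f g : {malg F[I]} -> E) : linear f -> linear g ->
  (forall b, f << b >> = g << b >>) -> f =1 g.
Proof.
move=> lf lg fg v; rewrite (malg_sum v) (lin_sum _ _ _ lf) (lin_sum _ _ _ lg).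
by apply: eq_bigr => b _; rewrite (linZ lf) (linZ lg) fg.
Qed.

End MalgExtension.

Definition derivation {F : fieldType} {A : algType F} (D : A -> A) : Prop :=
  linear D /\ forall u v, D (u * v) = D u * v + u * D v.

Section AlgLinear.
Context {F : fieldType} {A : algType F} {E : lmodType F}.
Implicit Types (D : A -> A) (phi : A -> E) (u v w : A).

Lemma linear_mull w phi : linear phi -> linear (fun u => phi (w * u)).
Proof. by move=> lphi c u v; rewrite mulrDr -scalerAr lphi. Qed.

Lemma linear_mulr w phi : linear phi -> linear (fun u => phi (u * w)).
Proof. by move=> lphi c u v; rewrite mulrDl -scalerAl lphi. Qed.

Lemma linear_leibl w D : linear D -> linear (fun u => D u * w + u * D w).
Proof.
move=> lD c u v; rewrite lD !mulrDl scalerDr -!scalerAl -!addrA.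
by congr (_ + _); rewrite addrCA.
Qed.

Lemma linear_leibr w D : linear D -> linear (fun u => D w * u + w * D u).
Proof.
move=> lD c u v; rewrite lD !mulrDr scalerDr -!scalerAr -!addrA.
by congr (_ + _); rewrite addrCA.
Qed.

End AlgLinear.

Lemma scale_mulA {F : fieldType} {A : comAlgType F} (k : F) (a b u v : A) :
  v * b = u -> k *: (a * b) * v = k *: (a * u).
Proof. by move=> <-; rewrite -scalerAl -mulrA (mulrC b). Qed.

Section Fock.
Context {F : numFieldType} {n : nat}.
Local Notation M1 := {malg F[{cmonom fockvar n}]}.
Implicit Types (c : 'rV[F]_n) (u v : M1) (x : fockvar n).

Lemma malgUM (k1 k2 : {cmonom fockvar n}) :
  << k1 >> * << k2 >> = << mmul k1 k2 >> :> M1.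
Proof. by rewrite malgM_def fgmulUU mul1r. Qed.

Definition X x : M1 := << ucm x >>.

Definition Xprod (s : seq (fockvar n)) : M1 := \prod_(x <- s) X x.

Lemma Xprod_nil : Xprod [::] = 1. Proof. exact: big_nil. Qed.

Lemma Xprod_cons x s : Xprod (x :: s) = X x * Xprod s.
Proof. exact: big_cons. Qed.

Lemma XprodU (s : seq (fockvar n)) : Xprod s = << \big[mmul/mone]_(x <- s) ucm x >>.
Proof.
elim: s => [|x s IH]; first by rewrite Xprod_nil big_nil.
by rewrite Xprod_cons IH big_cons -malgUM.
Qed.

Lemma big_ucm (s : seq (fockvar n)) x :
  (\big[mmul/mone]_(y <- s) ucm y) x = count_mem x s.
Proof.
elim: s => [|y s IH]; first by rewrite big_nil cm1.
by rewrite big_cons cmM cmU IH.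
Qed.

Lemma Xprod_factors (m : {cmonom fockvar n}) : << m >> = Xprod (factors m).
Proof.
rewrite XprodU; congr << _ >>; apply/eqP/cmP => x.
rewrite big_ucm /factors count_flatten -map_comp sumnE big_map.
under eq_bigr => y _ do rewrite /= count_nseq.
have [xm|xm] := boolP (x \in finsupp m).
  rewrite (bigD1_seq x) //= eqxx mul1n big1 ?addn0 // => y /negPf.
  by rewrite /= eq_sym => ->; rewrite mul0n.
rewrite big1_seq; first by apply/eqP; rewrite cmE_eq0.
move=> y /= ym; case: eqVneq => [yx|]; last by rewrite mul0n.
by rewrite -yx ym in xm.
Qed.

Definition dmon (g : fockvar n -> M1) (m : {cmonom fockvar n}) : M1 :=
  \sum_(x <- finsupp m) (m x)%:R *: (g x * << divcm m (ucm x) >>).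

(** Translation, positive Heisenberg modes and partial derivatives are all of this form, for
    suitable values g on the variables. *)
Definition der (g : fockvar n -> M1) : M1 -> M1 := mext (dmon g).

Lemma derU g (m : {cmonom fockvar n}) : der g << m >> = dmon g m.
Proof. exact: mextU. Qed.

Lemma dmonw g (d : {fset fockvar n}) (m : {cmonom fockvar n}) :
  (finsupp m `<=` d)%fset ->
  dmon g m = \sum_(x <- d) (m x)%:R *: (g x * << divcm m (ucm x) >>).
Proof.
move=> md; apply: big_fset_incl => // x _; rewrite -cmE_eq0 => /eqP ->.
by rewrite scale0r.
Qed.

Lemma derivation_der g : derivation (der g).
Proof.
split; first exact: linear_mext.
have ld : linear (der g) := linear_mext (dmon g).
move=> u v; move: u; apply: (eq_linear (linear_mulr v ld) (linear_leibl v ld)) => m1.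
move: v; apply: (eq_linear (linear_mull _ ld) (linear_leibr _ ld)) => m2.
suff H : dmon g (mmul m1 m2) = dmon g m1 * << m2 >> + << m1 >> * dmon g m2.
  exact: etrans (congr1 (der g) (malgUM m1 m2)) (etrans (derU g _) (etrans H
    (esym (congr2 (fun a b => a * << m2 >> + << m1 >> * b) (derU g m1) (derU g m2))))).
have sub : (finsupp (mmul m1 m2) `<=` finsupp m1 `|` finsupp m2)%fset by rewrite mdomD.
rewrite (dmonw g sub) (dmonw g (fsubsetUl (finsupp m1) (finsupp m2))).
rewrite (dmonw g (fsubsetUr (finsupp m1) (finsupp m2))).
rewrite mulr_suml mulr_sumr -big_split /=; apply: eq_bigr => x _.
(* [divcm] truncates, so cancelling x commutes with multiplication only when x divides m; otherwise
   the coefficient m x is 0. *)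
have div0 (m : {cmonom fockvar n}) : m x != 0%N ->
    forall m', mmul m' (divcm m (ucm x)) = divcm (mmul m' m) (ucm x).
  move=> mx m'; apply/eqP/cmP => y; rewrite cmM !divcmE cmM cmU.
  by case: eqVneq => [<-|_]; lia.
have termM (m m' : {cmonom fockvar n}) :
    (m x)%:R *: (g x * << divcm m (ucm x) >>) * << m' >> =
    (m x)%:R *: (g x * << divcm (mmul m' m) (ucm x) >>).
  have [mx|mx] := eqVneq (m x) 0%N.
    by rewrite mx; apply: etrans (esym (scale0r _)); apply: etrans (mul0r _);
      congr (_ * _); apply: scale0r.
  apply: scale_mulA; rewrite -(div0 _ mx); exact: malgUM.
rewrite cmM natrD scalerDl; congr (_ + _).
  by rewrite termM (mulmC m1).
by apply/esym; apply: etrans (mulrC _ _) (termM _ _).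
Qed.

Lemma derX g x : der g (X x) = g x.
Proof.
rewrite derU /dmon mdomU big_seq_fset1 cmUU scale1r.
rewrite (_ : divcm _ _ = mone) ?mulr1 //.
by apply/eqP/cmP => y; rewrite divcmE subnn cm1.
Qed.

Lemma lspan_Xprod u : lspan [set v | exists s, v = Xprod s] u.
Proof.
rewrite (malg_sum u); apply: subspace_sum (subspace_lspan _) _ => m _.
apply: subspaceZ (subspace_lspan _) _; apply: mem_lspan.
by exists (factors m); apply: Xprod_factors.
Qed.

End Fock.

(** * Exponentials and translation operators on M(1) *)

Section Free.
Context {F : numFieldType} {n : nat} {A : comAlgType F}.
Context (X : 'I_n * nat -> A) (der : ('I_n * nat -> A) -> A -> A).
Hypothesis derP : forall g, derivation (der g).
Hypothesis derX : forall g x, der g (X x) = g x.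
Implicit Types (c : 'rV[F]_n) (u v : A) (x : 'I_n * nat).

Lemma derivation1 (D : A -> A) : derivation D -> D 1 = 0.
Proof.
case=> _ /(_ 1 1); rewrite !mulr1 mul1r => /eqP.
by rewrite -subr_eq subrr eq_sym => /eqP.
Qed.

Definition Xc c (k : nat) : A := \sum_(i < n) c ord0 i *: X (i, k).

(** If the c_{-j} are read as power sums, these are the complete homogeneous symmetric functions:
    \sum_d h_d x^d = exp (\sum_(j >= 1) c_{-j} x^j / j). *)
Definition hc c (d : nat) : A :=
  expcoef (fun j w => j%:R^-1 *: (Xc c j.-1 * w)) d 1.

(** Extension by 0 to negative degrees, so that shifts of the degree need no side condition. *)
Definition hcz c (z : int) : A := if z is Posz d then hc c d else 0.

Lemma linear_mulZ (a : F) (w : A) : linear (fun v => a *: (w * v)).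
Proof.
by move=> b u v; rewrite mulrDr scalerDr -scalerAr !scalerA mulrC.
Qed.

Lemma expcoef_Xc c d u :
  expcoef (fun j w => j%:R^-1 *: (Xc c j.-1 * w)) d u = hc c d * u.
Proof.
have lu : linear (fun v => v * u) by move=> a v w; rewrite mulrDl scalerAl.
rewrite -[in LHS](mul1r u); apply: (expcoef_map _ _ lu) => [j|j|j w].
- exact: linear_mulZ.
- exact: linear_mulZ.
- by rewrite -scalerAl mulrA.
Qed.

Lemma hc0 c : hc c 0 = 1.
Proof. by apply: expcoef0 => j; apply: linear_mulZ. Qed.

(** Newton's identity between complete symmetric functions and power sums. *)
Lemma hc_rec c d : d%:R *: hc c d = \sum_(j < d) Xc c j * hc c (d - j.+1).
Proof.
rewrite expcoef_rec.
- apply: eq_bigr => j _.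
  by rewrite scalerA divff ?scale1r ?pnatr_eq0.
- by move=> j; apply: linear_mulZ.
- by move=> i j w; rewrite -!scalerAr !scalerA [in RHS]mulrC mulrCA.
Qed.

Lemma hcz_rec c (z : int) N : z <= N%:Z ->
  z%:~R *: hcz c z = \sum_(j < N) Xc c j * hcz c (z - j.+1%:Z).
Proof.
case: z => [d|d] dN; last by rewrite scaler0 big1 // => j _; rewrite mulr0.
have dN' : (d <= N)%N by lia.
rewrite /= hc_rec -(big_mkord xpredT (fun j => Xc c j * hcz c (d%:Z - j.+1%:Z))).
rewrite (big_cat_nat (n := d)) ?big_mkord //= [X in _ + X]big1_seq ?addr0.
  apply: eq_bigr => j _; congr (_ * _); have := ltn_ord j => jd.
  by rewrite subzn.
move=> j /=; rewrite mem_index_iota => /andP[dj _].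
have -> : (d%:Z - j.+1%:Z) = Negz (j - d) by lia.
by rewrite mulr0.
Qed.

(** D multiplies the generating series of the h_d by a x^(k+1) / (k+1), hence only shifts the
    degree. *)
Lemma derivation_hc (D : A -> A) c (k : nat) (a : F) : derivation D ->
  (forall j, D (Xc c j) = a *+ (j == k) *: 1) ->
  forall d : nat, D (hc c d) = (a / k.+1%:R) *: hcz c (d%:Z - k.+1%:Z).
Proof.
move=> dD DX; elim/ltn_ind => -[|d] IH.
  by rewrite hc0 derivation1 // sub0r /= scaler0.
apply: (scalerI (a := d.+1%:R)); first by rewrite pnatr_eq0.
have lD := dD.1.
rewrite -(linZ lD) hc_rec (lin_sum _ _ _ lD).
under eq_bigr => j _.
  rewrite dD.2 DX -scalerAl mul1r IH; last by have := ltn_ord j; lia.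
  rewrite -scalerAr; over.
rewrite big_split /= -scaler_sumr.
have -> : \sum_(j < d.+1) Xc c j * hcz c ((d.+1 - j.+1)%N%:Z - k.+1%:Z) =
   (d.+1%:Z - k.+1%:Z)%:~R *: hcz c (d.+1%:Z - k.+1%:Z).
  rewrite (@hcz_rec _ _ d.+1); last lia.
  by apply: eq_bigr => j _; congr (_ * hcz _ _); have := ltn_ord j; lia.
have -> : \sum_(i < d.+1) (a *+ (nat_of_ord i == k)) *: hc c (d.+1 - i.+1) =
    a *: hcz c (d.+1%:Z - k.+1%:Z).
  have [kd|dk] := ltnP k d.+1.
    rewrite (bigD1 (Ordinal kd)) //= eqxx mulr1n big1 ?addr0.
      by rewrite subzn.
    by move=> j /negPf; rewrite -val_eqE /= => ->; rewrite scale0r.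
  have -> : d.+1%:Z - k.+1%:Z = Negz (k - d.+1) by lia.
  rewrite scaler0 big1 // => j _; have := ltn_ord j.
  by case: eqVneq => [->|]; [lia | rewrite scale0r].
(* What remains is (a / (k+1)) (d - k) + a = (a / (k+1)) (d + 1). *)
rewrite !scalerA -scalerDl; congr (_ *: _).
have k0 : k.+1%:R != 0 :> F by rewrite pnatr_eq0.
by rewrite intrB -!pmulrn; field; rewrite addrC natr1.
Qed.

(* In M(1) e^alpha the translation operator is [Tw (cplx alpha)]. *)
Definition Tr : A -> A := der (fun x => x.2.+1%:R *: X (x.1, x.2.+1)).
Definition Tw c u : A := Tr u + Xc c 0 * u.

Lemma derivation_Tr : derivation Tr. Proof. exact: derP. Qed.

Lemma linear_Tw c : linear (Tw c).
Proof.
move=> a u v; rewrite /Tw derivation_Tr.1 mulrDr scalerDr scalerAr.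
by rewrite -!addrA; congr (_ + _); rewrite addrCA.
Qed.

(** Twists add under multiplication, as lattice points do; a twist can therefore be distributed over
    the factors of a product. *)
Lemma Tw_mul c c' u v : Tw (c + c') (u * v) = Tw c u * v + u * Tw c' v.
Proof.
have XcD : Xc (c + c') 0 = Xc c 0 + Xc c' 0.
  by rewrite -big_split; apply: eq_bigr => i _; rewrite mxE scalerDl.
rewrite /Tw derivation_Tr.2 XcD mulrDl mulrDl mulrDr.
have -> : u * (Xc c' 0 * v) = Xc c' 0 * (u * v) by rewrite mulrCA.
rewrite -(mulrA (Xc c 0)) -!addrA; congr (_ + _).
by rewrite addrCA.
Qed.

Lemma Tr_Xc c k : Tr (Xc c k) = k.+1%:R *: Xc c k.+1.
Proof.
have lT := (derP (fun x => x.2.+1%:R *: X (x.1, x.2.+1))).1.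
rewrite /Tr /Xc (lin_sum _ _ _ lT) scaler_sumr.
by apply: eq_bigr => i _; rewrite (linZ lT) derX scalerA mulrC -scalerA.
Qed.

(** The generating series E(x) of the h_d satisfies (T + c_{-1}) E(x) = E'(x), because T sends
    c_{-j} / j to c_{-j-1}. *)
Lemma Tw_hc c d : Tw c (hc c d) = d.+1%:R *: hc c d.+1.
Proof.
elim/ltn_ind: d => -[|d] IH.
  rewrite /Tw hc0 (derivation1 derivation_Tr).
  by rewrite hc_rec big_ord1 subnn hc0 add0r.
apply: (scalerI (a := d.+1%:R)); first by rewrite pnatr_eq0.
rewrite -(linZ (linear_Tw c)) [in LHS]hc_rec (lin_sum _ _ _ (linear_Tw c)).
have Tterm (j : 'I_d.+1) : Tw c (Xc c j * hc c (d.+1 - j.+1)) =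
   j.+1%:R *: (Xc c j.+1 * hc c (d.+2 - j.+2)) +
   (d.+2 - j.+1)%:R *: (Xc c j * hc c (d.+2 - j.+1)).
  have := ltn_ord j => jd.
  (* The whole twist is put on the factor h, so that T acts untwisted on the linear factor. *)
  rewrite -{1}[c]add0r Tw_mul IH; last lia.
  rewrite /Tw (_ : Xc 0 0 = 0); last first.
    by apply: big1 => i _; rewrite mxE scale0r.
  rewrite mul0r addr0 Tr_Xc !subSS -scalerAl -scalerAr; congr (_ + _ *: _).
    by congr (_%:R); lia.
  by congr (_ * hc _ _); lia.
under eq_bigr => j _ do rewrite Tterm.
rewrite big_split /=.
rewrite hc_rec scaler_sumr.
pose f j := Xc c j * hc c (d.+2 - j.+1).
have -> : \sum_(i < d.+1) i.+1%:R *: (Xc c i.+1 * hc c (d.+2 - i.+2)) =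
   \sum_(i < d.+2) i%:R *: f i.
  by rewrite [RHS]big_ord_recl scale0r add0r.
have -> : \sum_(i < d.+1) (d.+2 - i.+1)%:R *: (Xc c i * hc c (d.+2 - i.+1)) =
   \sum_(i < d.+2) (d.+2 - i.+1)%:R *: f i.
  by rewrite [RHS]big_ord_recr /= subnn scale0r addr0.
rewrite -big_split; apply: eq_bigr => i _ /=.
rewrite -scalerDl -natrD; congr (_%:R *: _); have := ltn_ord i; lia.
Qed.

(** The coefficient of x^q in e^(x (T + c_{-1})) u: since Y(v, x) 1 = e^(xT) v, this is the creating
    part of the vertex operator of u (x) e^c. *)
Definition cq c (q : nat) u : A := (q`!%:R)^-1 *: iter q (Tw c) u.

Definition cz c (z : int) u : A := if z is Posz q then cq c q u else 0.

Lemma linear_cq c q : linear (cq c q).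
Proof.
move=> a u v; rewrite /cq.
have -> : iter q (Tw c) (a *: u + v) = a *: iter q (Tw c) u + iter q (Tw c) v.
  by elim: q => //= q ->; rewrite linear_Tw.
by rewrite scalerDr !scalerA mulrC.
Qed.

Lemma linear_cz c z : linear (cz c z).
Proof.
by case: z => q a u v /=; rewrite ?linear_cq // scaler0 addr0.
Qed.

Lemma cqS c q u : q.+1%:R *: cq c q.+1 u = Tw c (cq c q u).
Proof.
rewrite /cq iterS (linZ (linear_Tw c)) scalerA factS natrM invfM mulrA.
by rewrite divff ?mul1r // pnatr_eq0.
Qed.

Lemma cq1 c q : cq c q 1 = hc c q.
Proof.
elim: q => [|q IH]; first by rewrite hc0 /cq fact0 invr1 scale1r.
apply: (scalerI (a := q.+1%:R)); first by rewrite pnatr_eq0.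
by rewrite cqS IH Tw_hc.
Qed.

Lemma cz1 c z : cz c z 1 = hcz c z.
Proof. by case: z => //= q; rewrite cq1. Qed.

(** The exponential of x (T + c_{-1}) is multiplicative up to the twist, and e^(xT) maps b_i (x)
    t^(-k-1) to the k-th divided derivative of the creating half of b_i(x). *)
Lemma cq_mulX c q (i : 'I_n) k u :
  cq c q (X (i, k) * u) =
  \sum_(t < q.+1) 'C(k + t, k)%:R *: (X (i, (k + t)%N) * cq c (q - t) u).
Proof.
elim: q => [|q IH].
  by rewrite big_ord1 /cq /= addn0 binn fact0 invr1 !scale1r.
apply: (scalerI (a := q.+1%:R)); first by rewrite pnatr_eq0.
rewrite cqS IH (lin_sum _ _ _ (linear_Tw c)).
pose f t := X (i, (k + t)%N) * cq c (q.+1 - t) u.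
have Tterm (t : 'I_q.+1) :
    Tw c ('C(k + t, k)%:R *: (X (i, (k + t)%N) * cq c (q - t) u)) =
    ('C(k + t, k) * (k + t).+1)%:R *: f t.+1 + ('C(k + t, k) * (q.+1 - t))%:R *: f t.
  have tq := ltn_ord t.
  rewrite (linZ (linear_Tw c)) -{1}[c]add0r Tw_mul /Tw (_ : Xc 0 0 = 0); last first.
    by apply: big1 => l _; rewrite mxE scale0r.
  rewrite mul0r addr0 /Tr derX -/(Tr _) -/(Tw c _) -cqS [(_, _).1]/= [(_, _).2]/=.
  rewrite /f subSS addnS subSn //.
  move: (cq c (q - t) u) (cq c (q - t).+1 u) => v w.
  by rewrite -scalerAl -scalerAr scalerDr !scalerA -!natrM.
under eq_bigr => t _ do rewrite Tterm.
rewrite big_split /= scaler_sumr.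
(* Here 'C(k + t, k) (k + t + 1) = 'C(k + t + 1, k) (t + 1), and the term t = 0 that is added
   vanishes. *)
have -> : \sum_(t < q.+1) ('C(k + t, k) * (k + t).+1)%:R *: f t.+1 =
    \sum_(t < q.+2) ('C(k + t, k) * t)%:R *: f t.
  rewrite [RHS]big_ord_recl muln0 scale0r add0r; apply: eq_bigr => t _.
  rewrite /bump /= ?add1n addnS; congr (_%:R *: _).
  by have := mul_bin_down (k + t.+1) k; rewrite addKn addnS mulnC => ->; rewrite mulnC.
have -> : \sum_(t < q.+1) ('C(k + t, k) * (q.+1 - t))%:R *: f t =
    \sum_(t < q.+2) ('C(k + t, k) * (q.+1 - t))%:R *: f t.
  by rewrite [RHS]big_ord_recr /= subnn muln0 scale0r addr0.
rewrite -big_split; apply: eq_bigr => t _ /=; have := ltn_ord t => tq.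
by rewrite -scalerDl -natrD -mulnDr scalerA -natrM subnKC // mulnC.
Qed.

End Free.

(** * Weight filtration and the annihilating half of the fields *)

Section Weights.
Context {F : numFieldType} {n : nat} {A : comAlgType F}.
Context (X : 'I_n * nat -> A) (der : ('I_n * nat -> A) -> A -> A).
Hypothesis derP : forall g, derivation (der g).
Hypothesis derX : forall g x, der g (X x) = g x.
Hypothesis genA : forall u, lspan [set v | exists s, v = \prod_(x <- s) X x] u.
Implicit Types (c h : 'rV[F]_n) (u v : A) (x : 'I_n * nat) (s : seq ('I_n * nat)).
Local Notation Xp s := (\prod_(x <- s) X x).

Lemma eq_derivation (D D' : A -> A) : derivation D -> derivation D' ->
  (forall x, D (X x) = D' (X x)) -> D =1 D'.
Proof.
move=> dD dD' DD' u; apply/eqP; rewrite -subr_eq0; apply/eqP.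
have lDD : linear (fun u => D u - D' u).
  by move=> a v w; rewrite dD.1 dD'.1 scalerBr opprD addrACA.
have sW : subspace [set w : A | w = 0].
  split=> [//|v w -> ->|a v ->]; by rewrite /= ?addr0 ?scaler0.
apply: (lspan_lin lDD sW _ (genA u)) => _ [s ->] /=; elim: s => [|x s IH].
  by rewrite big_nil !derivation1 ?subrr.
rewrite big_cons dD.2 dD'.2 DD' opprD addrACA subrr add0r -mulrBr.
by rewrite IH mulr0.
Qed.

(** The commutator is again a derivation, and it kills the generators because both maps send them to
    constants. *)
Lemma derivation_comm (D D' : A -> A) (f f' : 'I_n * nat -> F) :
  derivation D -> derivation D' ->
  (forall x, D (X x) = f x *: 1) -> (forall x, D' (X x) = f' x *: 1) ->
  forall u, D (D' u) = D' (D u).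
Proof.
move=> dD dD' DX DX' u; apply/eqP; rewrite -subr_eq0; apply/eqP.
have d0 : derivation (fun _ : A => 0 : A).
  by split=> [a v w|v w]; rewrite ?scaler0 ?addr0 // mul0r mulr0 addr0.
apply: (@eq_derivation (fun u => D (D' u) - D' (D u)) (fun=> 0)) => //.
  split=> [a v w|v w].
    by rewrite dD'.1 !dD.1 dD'.1 scalerBr opprD addrACA.
  rewrite dD'.2 dD.2 (linD dD.1) (linD dD'.1) !dD.2 !dD'.2.
  ring.
move=> x; rewrite DX DX' (linZ dD.1) (linZ dD'.1) !derivation1 //.
by rewrite !scaler0 subrr.
Qed.

Definition wts s : nat := \sum_(x <- s) x.2.+1.

(** The conformal weight, in which b_i (x) t^(-k-1) counts k + 1. The bound is an integer because a
    negative one leaves only 0, which is what truncates the sums over annihilating modes. *)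
Definition Wt (B : int) : set A :=
  lspan [set v | exists s, v = Xp s /\ (wts s)%:Z <= B].

Lemma subspace_Wt B : subspace (Wt B). Proof. exact: subspace_lspan. Qed.

Lemma Wt_Xp s : Wt (wts s)%:Z (Xp s).
Proof. by apply: mem_lspan; exists s. Qed.

Lemma Wt_mono B B' u : B <= B' -> Wt B u -> Wt B' u.
Proof.
move=> BB; apply: lspanS => _ [s [-> sB]]; exists s; split=> //.
exact: le_trans BB.
Qed.

Lemma Wt_neg B u : B < 0 -> Wt B u -> u = 0.
Proof.
move=> B0; have sW : subspace [set w : A | w = 0].
  split=> [//|v w -> ->|a v ->]; by rewrite /= ?addr0 ?scaler0.
by apply: (lspan_min sW) => _ [s [-> sB]]; lia.
Qed.

Lemma Wt_mulX B x u : Wt B u -> Wt (B + x.2.+1%:Z) (X x * u).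
Proof.
have lX : linear (fun u => X x * u) by move=> a v w; rewrite mulrDr scalerAr.
apply: (lspan_lin lX (subspace_Wt _)) => _ [s [-> sB]].
apply: mem_lspan; exists (x :: s); rewrite big_cons /wts big_cons -/(wts s); split=> //.
lia.
Qed.

Lemma ex_Wt u : exists B : nat, Wt B%:Z u.
Proof.
have sW : subspace [set u | exists B : nat, Wt B%:Z u].
  split=> [|v w [B vB] [B' wB]|a v [B vB]].
  - by exists 0%N; apply: subspace0 (subspace_Wt _).
  - exists (maxn B B'); apply: (subspaceD (subspace_Wt _)).
      by apply: Wt_mono vB; lia.
    by apply: Wt_mono wB; lia.
  - by exists B; apply: (subspaceZ _ (subspace_Wt _)).
by apply: (lspan_min sW _ (genA u)) => _ [s ->]; exists (wts s); apply: Wt_Xp.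
Qed.

Context (G : 'M[int]_n).

(* The action of h (x) t^(k+1) on M(1). *)
Definition ann h (k : nat) : A -> A :=
  der (fun x => ((k.+1%:R * gform G h (bvec x.1)) *+ (x.2 == k)) *: 1).

(* The action of h (x) t^p on M(1) (x) e^beta, where a = <h, beta>. *)
Definition annz h (a : F) (p : nat) : A -> A :=
  if p is k.+1 then ann h k else fun u => a *: u.

Lemma linear_annz h a p : linear (annz h a p).
Proof.
case: p => [|k] /=; last exact: (derP _).1.
by move=> b u v; rewrite scalerDr !scalerA mulrC.
Qed.

Lemma annz_comm h a p h' a' p' u :
  annz h a p (annz h' a' p' u) = annz h' a' p' (annz h a p u).
Proof.
case: p p' => [|k] [|k'] /=.
- by rewrite !scalerA mulrC.
- by rewrite /ann (linZ (derP _).1).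
- by rewrite /ann (linZ (derP _).1).
- apply: (@derivation_comm _ _
    (fun x => (k.+1%:R * gform G h (bvec x.1)) *+ (x.2 == k))
    (fun x => (k'.+1%:R * gform G h' (bvec x.1)) *+ (x.2 == k'))
    (derP _) (derP _)) => x; by rewrite /ann derX.
Qed.

Lemma ann_Wt h k B u : Wt B u -> Wt (B - k.+1%:Z) (ann h k u).
Proof.
have dD : derivation (ann h k) := derP _.
apply: (lspan_lin dD.1 (subspace_Wt _)) => _ [s [-> sB]].
suff : Wt ((wts s)%:Z - k.+1%:Z) (ann h k (Xp s)) by apply: Wt_mono; lia.
elim: s {sB} => [|x s IH].
  by rewrite big_nil derivation1 //; apply: subspace0 (subspace_Wt _).
rewrite big_cons dD.2 /wts big_cons -/(wts s); apply: (subspaceD (subspace_Wt _)).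
  rewrite /ann derX; case: eqVneq => [->|_].
    rewrite -scalerAl mul1r; apply: (subspaceZ _ (subspace_Wt _)).
    by apply: Wt_mono (Wt_Xp s); lia.
  by rewrite scale0r mul0r; apply: subspace0 (subspace_Wt _).
by apply: Wt_mono (Wt_mulX x IH); lia.
Qed.

Lemma annz_Wt h a p B u : Wt B u -> Wt (B - p%:Z) (annz h a p u).
Proof.
case: p => [|k] /=; last exact: ann_Wt.
by rewrite subr0; apply: (subspaceZ _ (subspace_Wt _)).
Qed.

(* The coefficient of x^(-q) in the second exponential of Y(e^alpha, x). *)
Definition ep h (q : nat) : A -> A :=
  expcoef (fun j w => - (j%:R^-1 *: annz h 0 j w)) q.

Lemma linear_ep_arg h a j : linear (fun w => - (j%:R^-1 *: annz h a j w)).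
Proof.
by move=> b u v; rewrite linear_annz scalerDr opprD scalerN !scalerA mulrC.
Qed.

Lemma linear_ep h q : linear (ep h q).
Proof. by apply: linear_expcoef => j; apply: linear_ep_arg. Qed.

Lemma ep0 h u : ep h 0 u = u.
Proof. by apply: expcoef0 => j; apply: linear_ep_arg. Qed.

Lemma ep_rec h q u :
  q%:R *: ep h q u = - \sum_(j < q) ann h j (ep h (q - j.+1) u).
Proof.
rewrite /ep expcoef_rec; first 1 last.
- by move=> j; apply: linear_ep_arg.
- move=> i j w; have la := linear_annz h 0.
  by rewrite !(linN (la _)) !(linZ (la _)) annz_comm !scalerN !scalerA mulrC.
rewrite -sumrN; apply: eq_bigr => j _.
by rewrite scalerN scalerA divff ?scale1r // pnatr_eq0.
Qed.

Lemma ep_closed (W : set A) h q u : subspace W ->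
  (forall k v, W v -> W (ann h k v)) -> W u -> W (ep h q u).
Proof.
move=> sW Wa Wu; elim/ltn_ind: q => -[|q] IH; first by rewrite ep0.
have -> : ep h q.+1 u = q.+1%:R^-1 *: (q.+1%:R *: ep h q.+1 u).
  by rewrite scalerA mulVf ?scale1r // pnatr_eq0.
rewrite ep_rec scalerN -scaleNr; apply: subspaceZ => //.
by apply: subspace_sum => // j _; apply/Wa/IH; have := ltn_ord j; lia.
Qed.

Lemma ep_Wt h q B u : Wt B u -> Wt (B - q%:Z) (ep h q u).
Proof.
move=> uB; elim/ltn_ind: q => -[|q] IH; first by rewrite ep0 subr0.
have -> : ep h q.+1 u = q.+1%:R^-1 *: (q.+1%:R *: ep h q.+1 u).
  by rewrite scalerA mulVf ?scale1r // pnatr_eq0.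
rewrite ep_rec scalerN -scaleNr; apply: (subspaceZ _ (subspace_Wt _)).
apply: (subspace_sum _ (subspace_Wt _)) => j _; have jq := ltn_ord j.
have jS : (q.+1 - j.+1 < q.+1)%N by lia.
by have := ann_Wt h j (IH _ jS); apply: Wt_mono; lia.
Qed.

End Weights.

(** * Normally ordered products as operators on M(1), with cutoffs *)

Section Theta.
Context {F : numFieldType} {n : nat} {A : comAlgType F}.
Context (X : 'I_n * nat -> A) (der : ('I_n * nat -> A) -> A -> A).
Hypothesis derP : forall g, derivation (der g).
Hypothesis derX : forall g x, der g (X x) = g x.
Hypothesis genA : forall u, lspan [set v | exists s, v = \prod_(x <- s) X x] u.
Implicit Types (f u v : A) (x : 'I_n * nat) (s : seq ('I_n * nat)).
Local Notation Xp s := (\prod_(x <- s) X x).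
Context (G : 'M[int]_n) (c : 'rV[F]_n) (b : 'I_n -> F) (N : int) (K : nat).
Local Notation cz := (cz X der c).
Local Notation ep := (ep der G c).
Local Notation av i := (annz der G (bvec i) (b i)).

Definition pder x : A -> A := der (fun y => (x == y)%:R *: 1).

Lemma derivation_pder x : derivation (pder x). Proof. exact: derP. Qed.

(** This is [cq_mulX] with p = k + t. Terms with p < k vanish through 'C(p, k) and those with p > z
    + k through [cz], which gives the range of summation of [mode_seq]. *)
Lemma cz_mulX (z : int) (i : 'I_n) k f P : z + k%:Z + 1 <= P%:Z ->
  cz z (X (i, k) * f) =
  \sum_(p < P) 'C(p, k)%:R *: (X (i, nat_of_ord p) * cz (z - (p%:Z - k%:Z)) f).
Proof.
pose g p := 'C(p, k)%:R *: (X (i, p) * cz (z - (p%:Z - k%:Z)) f).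
rewrite -(big_mkord xpredT g).
have g0 p : (p < k)%N -> g p = 0 by move=> pk; rewrite /g bin_small // scale0r.
case: z @g g0 => [q|q] g g0 zP; last first.
  rewrite big1 // => p _; have [/g0//|kp] := ltnP p k.
  rewrite /g (_ : Negz q - _ = Negz (q + (p - k))) /= ?mulr0 ?scaler0 //; lia.
rewrite [LHS](cq_mulX derP derX).
have -> : \sum_(0 <= p < P) g p = \sum_(t < q.+1) g (k + t)%N.
  rewrite (big_cat_nat (n := k)) /=; [|lia|lia].
  rewrite [X in X + _]big1_seq ?add0r; last first.
    by move=> p /andP[_]; rewrite mem_index_iota => /andP[_ /g0].
  rewrite (big_cat_nat (n := (k + q.+1)%N)) /=; [|lia|lia].
  rewrite [X in _ + X]big1_seq ?addr0.
    rewrite -{1}[k]add0n big_addn addKn big_mkord.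
    by apply: eq_bigr => t _; rewrite addnC.
  move=> p /andP[_]; rewrite mem_index_iota => /andP[pk _].
  rewrite /g (_ : Posz q - _ = Negz (p - k - q.+1)) /= ?mul0r ?mulr0 ?scaler0 //; lia.
apply: eq_bigr => t _; rewrite /g; congr (_ *: (_ * _)); have tq := ltn_ord t.
by rewrite (_ : Posz q - _ = (q - t)%N) //; lia.
Qed.

(** In the application c is alpha, b i is <b_i, beta>, N is <alpha, beta>, and K exceeds the weight
    of u and the indices of the variables in f. Solving p - j + N = -m - 1 for the exponent p of the
    first exponential gives the argument of [cz]. *)
Definition psi f u (m : int) : A :=
  \sum_(j < K) cz (j%:Z - N - m - 1) f * ep j u.

Lemma psi1 u m : psi 1 u m = \sum_(j < K) hcz X c (j%:Z - N - m - 1) * ep j u.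
Proof. by apply: eq_bigr => j _; rewrite (cz1 derP derX). Qed.

Lemma psi_zero u m : c = 0 -> N = 0 -> (0 < K)%N -> psi 1 u m = (m == -1)%:R *: u.
Proof.
move=> c0 N0 K0; have Xc0 d : Xc X c d = 0 by apply: big1 => i _; rewrite c0 mxE scale0r.
have hS d : hc X c d.+1 = 0.
  apply: (scalerI (a := d.+1%:R)); first by rewrite pnatr_eq0.
  by rewrite hc_rec scaler0; apply: big1 => j _; rewrite Xc0 mul0r.
have annc d v : ann der G c d v = 0.
  have d0 : derivation (fun _ : A => 0 : A).
    by split=> [a v' w|v' w]; rewrite ?scaler0 ?addr0 // mul0r mulr0 addr0.
  apply: (eq_derivation genA (derP _) d0) => x.
  by rewrite derX c0 /gform !mul0mx mxE mulr0 mul0rn scale0r.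
have epS d v : ep d.+1 v = 0.
  apply: (scalerI (a := d.+1%:R)); first by rewrite pnatr_eq0.
  by rewrite (ep_rec derP derX genA) scaler0 big1 ?oppr0.
rewrite psi1; case: K K0 => // K' _; rewrite big_ord_recl (ep0 derP) big1 ?addr0; last first.
  by move=> j _; rewrite epS mulr0.
rewrite N0 (_ : _ - 1 = - m - 1); last by rewrite /=; lia.
case: eqVneq => [->|m1]; first by rewrite /= hc0 mul1r scale1r.
rewrite scale0r; case E : (- m - 1) => [[|d]|d] /=; last by rewrite mul0r.
  by exfalso; move/eqP: m1; lia.
by rewrite hS mul0r.
Qed.

(* The part of : Y(f e^alpha, x) : in which exactly l factors of f annihilate;
   the recursion on l is the l-th Taylor coefficient of the coproduct of f. *)
Fixpoint theta (l : nat) f u (m : int) : A :=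
  if l is l'.+1 then
    l%:R^-1 *: \sum_(y : 'I_n * 'I_K) \sum_(p < K)
      ((-1) ^+ y.2 * 'C(p + y.2, y.2)%:R) *:
        theta l' (pder (y.1, nat_of_ord y.2) f) (av y.1 p u) (m - p%:Z - y.2%:Z - 1)
  else psi f u m.

Lemma linear_psi u m : linear (fun f => psi f u m).
Proof.
move=> a f g; rewrite /psi scaler_sumr -big_split; apply: eq_bigr => j _ /=.
by rewrite linear_cz // mulrDl scalerAl.
Qed.

Lemma linear_theta l u m : linear (fun f => theta l f u m).
Proof.
elim: l u m => [|l IH] u m; first exact: linear_psi.
move=> a f g /=; rewrite scalerA mulrC -scalerA -scalerDr; congr (_ *: _).
rewrite scaler_sumr -big_split; apply: eq_bigr => y _ /=.
rewrite scaler_sumr -big_split; apply: eq_bigr => p _ /=.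
by rewrite (derivation_pder _).1 IH scalerDr !scalerA mulrC.
Qed.

Lemma theta_rec l f u m :
  l.+1%:R *: theta l.+1 f u m = \sum_(y : 'I_n * 'I_K) \sum_(p < K)
      ((-1) ^+ y.2 * 'C(p + y.2, y.2)%:R) *:
        theta l (pder (y.1, nat_of_ord y.2) f) (av y.1 p u) (m - p%:Z - y.2%:Z - 1).
Proof. by rewrite /= scalerA divff ?scale1r // pnatr_eq0. Qed.

(** The factor X (i, k) either creates, leaving l annihilating factors in f, or annihilates, leaving
    l - 1. The bound on P reflects that each annihilating factor lowers m by p + k + 1 < 2K. *)
Lemma theta_mulX l (i : 'I_n) k f u m P : (k < K)%N ->
  K%:Z - N + (l * (2 * K))%:Z + k%:Z - m <= P%:Z ->
  theta l (X (i, k) * f) u m =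
    \sum_(p < P) 'C(p, k)%:R *: (X (i, nat_of_ord p) * theta l f u (m + p%:Z - k%:Z))
    + (if l is l'.+1 then
         \sum_(p < K) ((-1) ^+ k * 'C(p + k, k)%:R) *:
            theta l' f (av i p u) (m - p%:Z - k%:Z - 1)
       else 0).
Proof.
move=> kK; elim: l f u m => [|l IH] f u m mP.
  rewrite addr0 /= /psi.
  under [RHS]eq_bigr => p _ do rewrite mulr_sumr scaler_sumr.
  rewrite exchange_big /=; apply: eq_bigr => j _; have jK := ltn_ord j.
  rewrite (@cz_mulX _ _ _ _ P); last lia.
  rewrite mulr_suml; apply: eq_bigr => p _; rewrite -scalerAl mulrA.
  by congr (_ *: (_ * cz _ _ * _)); lia.
apply: (scalerI (a := l.+1%:R)); first by rewrite pnatr_eq0.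
rewrite theta_rec.
have dX (y : 'I_n * 'I_K) : pder (y.1, nat_of_ord y.2) (X (i, k) * f) =
    ((y.1, nat_of_ord y.2) == (i, k))%:R *: f + X (i, k) * pder (y.1, nat_of_ord y.2) f.
  by rewrite (derivation_pder _).2 /pder derX -scalerAl mul1r.
pose co (q : nat) (p : 'I_K) : F := (-1) ^+ q * 'C(p + q, q)%:R.
have step (y : 'I_n * 'I_K) (p : 'I_K) :
  co y.2 p *: theta l (pder (y.1, nat_of_ord y.2) (X (i, k) * f)) (av y.1 p u)
     (m - p%:Z - y.2%:Z - 1) =
  ((y.1, nat_of_ord y.2) == (i, k))%:R *:
    (co y.2 p *: theta l f (av y.1 p u) (m - p%:Z - y.2%:Z - 1)) +
  (\sum_(p' < P) 'C(p', k)%:R *: (X (i, nat_of_ord p') *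
    (co y.2 p *: theta l (pder (y.1, nat_of_ord y.2) f) (av y.1 p u)
       (m + p'%:Z - k%:Z - p%:Z - y.2%:Z - 1)))
   + (if l is l'.+1 then
        \sum_(p' < K) co k p' *: (co y.2 p *:
          theta l' (pder (y.1, nat_of_ord y.2) f) (av y.1 p (av i p' u))
             (m - p'%:Z - k%:Z - 1 - p%:Z - y.2%:Z - 1))
      else 0)).
  rewrite dX (linear_theta l _ _ _) scalerDr; congr (_ + _).
    by rewrite !scalerA mulrC.
  have pK := ltn_ord p; have yK := ltn_ord y.2.
  rewrite IH; last by rewrite mulSn in mP; lia.
  rewrite scalerDr scaler_sumr; congr (_ + _).
    apply: eq_bigr => p' _; rewrite scalerA mulrC -scalerA scalerAr.
    by congr (_ *: (_ * (_ *: theta _ _ _ _))); lia.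
  case: l {IH mP} => [|l]; first by rewrite scaler0.
  rewrite scaler_sumr; apply: eq_bigr => p' _; rewrite !scalerA.
  by rewrite (annz_comm derP derX genA); congr (_ *: theta _ _ _ _); [rewrite mulrC | lia].
under eq_bigr => y _ do under eq_bigr => p _ do rewrite -/(co y.2 p) step.
under eq_bigr => y _ do rewrite 2!big_split -scaler_sumr /=.
rewrite 2!big_split /= scalerDr addrCA; congr (_ + _).
  rewrite scaler_sumr; under eq_bigr => y _ do rewrite exchange_big /=.
  rewrite exchange_big /=; apply: eq_bigr => p' _.
  rewrite scalerA mulrC -scalerA scalerAr theta_rec mulr_sumr scaler_sumr.
  by apply: eq_bigr => y _; rewrite mulr_sumr scaler_sumr.
(* The derivative that hits X (i, k) itself gives one copy of the annihilating sum and the induction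
   hypothesis gives l more, as the factor l + 1 requires. *)
rewrite (bigD1 (i, Ordinal kK)) //= eqxx scale1r [X in (_ + X) + _ = _]big1 ?addr0; last first.
  move=> y yik; have [yE|_] := @eqP _ (y.1, nat_of_ord y.2) (i, k); last by rewrite scale0r.
  case/negP: yik; apply/eqP; case: y yE => [i' k'] [/= -> kk].
  by congr pair; apply: val_inj.
rewrite -(addn1 l) natrD scalerDl scale1r addrC; congr (_ + _).
case: l {IH mP step} => [|l].
  by rewrite scale0r big1 // => y _; rewrite big1.
rewrite scaler_sumr; under eq_bigr => y _ do rewrite exchange_big /=.
rewrite exchange_big /=; apply: eq_bigr => p' _.
rewrite scalerA mulrC -scalerA theta_rec scaler_sumr.
by apply: eq_bigr => y _; rewrite scaler_sumr.
Qed.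

Lemma theta_Xp_eq0 l s u m : all (fun x => x.2 < K)%N s -> (size s < l)%N ->
  theta l (Xp s) u m = 0.
Proof.
elim: s l u m => [|[i k] s IH] [|l] u m //=.
  move=> _ _; rewrite big1 ?scaler0 // => y _; rewrite big1 // => p _.
  rewrite big_nil derivation1; last exact: derivation_pder.
  by rewrite (lin0 (linear_theta l _ _)) scaler0.
move=> /andP[kK sK] sl; rewrite big_cons -/(theta l.+1 _ u m).
pose P := absz (K%:Z - N + (l.+1 * (2 * K))%:Z + k%:Z - m)%R.
rewrite (@theta_mulX l.+1 _ _ _ _ _ P) //; last by rewrite /P; lia.
rewrite big1 ?add0r => [|p _]; last by rewrite IH ?mulr0 ?scaler0 //; lia.
by rewrite big1 // => p _; rewrite IH ?scaler0.
Qed.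

Lemma theta_large l f u m : K%:Z - N + (l * (2 * K))%:Z <= m -> theta l f u m = 0.
Proof.
elim: l f u m => [|l IH] f u m mK /=.
  rewrite /psi big1 // => j _; have jK := ltn_ord j.
  by rewrite (_ : _ - 1 = Negz (absz (j%:Z - N - m)%R)) /= ?mul0r //; lia.
rewrite big1 ?scaler0 // => y _; rewrite big1 // => p _.
have pK := ltn_ord p; have yK := ltn_ord y.2.
by rewrite IH ?scaler0 //; rewrite mulSn in mK; lia.
Qed.

Lemma theta0r l f m : theta l f 0 m = 0.
Proof.
elim: l f m => [|l IH] f m /=.
  by apply: big1 => j _; rewrite (lin0 (linear_ep derP _ _ _)) mulr0.
rewrite big1 ?scaler0 // => y _; apply: big1 => p _.
by rewrite (lin0 (linear_annz derP _ _ _ _)) IH scaler0.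
Qed.

Lemma sum_theta_mulX L (i : 'I_n) k f u m P : (k < K)%N ->
  K%:Z - N + (L * (2 * K))%:Z + k%:Z - m <= P%:Z ->
  (forall u m, theta L f u m = 0) ->
  \sum_(l < L.+1) theta l (X (i, k) * f) u m =
    \sum_(p < P) 'C(p, k)%:R *:
      (X (i, nat_of_ord p) * \sum_(l < L) theta l f u (m + p%:Z - k%:Z))
  + \sum_(p < K) ((-1) ^+ k * 'C(p + k, k)%:R) *:
      \sum_(l < L) theta l f (av i p u) (m - p%:Z - k%:Z - 1).
Proof.
move=> kK mP fL.
under eq_bigr => l _.
  rewrite (@theta_mulX l _ _ _ _ _ P) //; last by have := ltn_ord l; nia.
  over.
rewrite big_split /=; congr (_ + _).
  rewrite big_ord_recr /= [X in _ + X]big1 ?addr0; last first.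
    by move=> p _; rewrite fL mulr0 scaler0.
  by rewrite exchange_big; apply: eq_bigr => p _; rewrite mulr_sumr scaler_sumr.
rewrite big_ord_recl add0r /= exchange_big; apply: eq_bigr => p _.
by rewrite scaler_sumr.
Qed.

(** Stability in the form used for the upper bound: only partial derivatives and twisted divided
    powers ever touch f, and only nonnegative modes touch u. *)
Lemma theta_closed (Sf Su W : set A) l f u m : subspace W -> subspace Sf -> subspace Su ->
  (forall x g, Sf g -> Sf (pder x g)) -> (forall z g, Sf g -> Sf (cz z g)) ->
  (forall h a p v, Su v -> Su (annz der G h a p v)) ->
  (forall g v, Sf g -> Su v -> W (g * v)) ->
  Sf f -> Su u -> W (theta l f u m).
Proof.
move=> sW sSf sSu Sfd Sfz Sua WSS; elim: l f u m => [|l IH] f u m ff uu /=.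
  apply: subspace_sum => // j _; apply: WSS; first exact: Sfz.
  by apply: ep_closed => // k v vu; apply: (Sua _ 0 k.+1).
apply: subspaceZ => //; apply: subspace_sum => // y _; apply: subspace_sum => // p _.
by apply: subspaceZ => //; apply: IH; [apply: Sfd | apply: Sua].
Qed.

End Theta.

(** * Modes of the lattice vertex algebra *)

Section Modes.
Context {F : numFieldType} {n : nat} (G : 'M[int]_n).
Context (eps : 'rV[rat]_n -> 'rV[rat]_n -> F).
Local Notation M1 := {malg F[{cmonom fockvar n}]}.
Local Notation monom := ({cmonom fockvar n} * 'rV[rat]_n)%type.
Local Notation V := {malg F[monom]}.
Local Notation X := (@X F n).
Local Notation der := (@der F n).
Local Notation cplx := (@cplx F n).
Implicit Types (u : M1) (h : 'rV[F]_n) (alpha beta : 'rV[rat]_n) (w : V).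

Lemma gen_X u : lspan [set v | exists s, v = \prod_(x <- s) X x] u.
Proof. exact: lspan_Xprod. Qed.

Lemma linear_linext {I : choiceType} (f : I -> V) : linear (linext f).
Proof. exact: linear_mext. Qed.

Lemma linextU {I : choiceType} (f : I -> V) b : linext f << b >> = f b.
Proof. exact: mextU. Qed.

Lemma linear_tens beta : linear (fun u => tens u beta).
Proof. exact: linear_linext. Qed.

Lemma tensU (m : {cmonom fockvar n}) beta : tens << m >> beta = << (m, beta) >> :> V.
Proof. exact: linextU. Qed.

Lemma V_sum w : w = \sum_(b <- msupp w) w@_b *: tens << b.1 >> b.2.
Proof.
rewrite [LHS]malg_sum; apply: eq_bigr => -[m b] _; congr (_ *: _).
by rewrite tensU.
Qed.

Lemma linear_actMl w : linear (fun x => actM x w).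
Proof. exact: linear_linext. Qed.

Lemma linear_actM (x : M1) : linear (actM x : V -> V).
Proof.
move=> a v w; rewrite /actM /linext.
rewrite scaler_sumr -big_split; apply: eq_bigr => m _ /=.
rewrite -/(linext (fun b : monom => << (mmul m b.1, b.2) >>) (a *: v + w)).
rewrite -/(linext (fun b : monom => << (mmul m b.1, b.2) >>) v).
rewrite -/(linext (fun b : monom => << (mmul m b.1, b.2) >>) w).
by rewrite (linear_linext _ a v w) scalerDr !scalerA mulrC.
Qed.

Lemma actM_tens (x u : M1) beta : actM x (tens u beta) = tens (x * u) beta :> V.
Proof.
move: x; apply: (eq_linear (linear_actMl _) (linear_mulr u (linear_tens beta))) => m.
rewrite /actM linextU; move: u.
apply: (eq_linear (f := fun u => linext _ (tens u beta)) _
  (linear_mull << m >> (linear_tens beta))) => [|m'].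
  by move=> a v w; rewrite (linear_tens beta a v w) (linear_linext _ a).
rewrite [X in linext _ X]tensU linextU; apply: etrans (esym (tensU _ _)) _.
by congr (tens _ beta); apply/esym/malgUM.
Qed.

Lemma heis_neg h p u beta : heis G h (Negz p) (tens u beta) = tens (Xc X h p * u) beta.
Proof. exact: actM_tens. Qed.

Lemma linear_heis h j : linear (heis G h j : V -> V).
Proof.
by case: j => [[|k]|p]; [apply: linear_linext | apply: linear_linext | apply: linear_actM].
Qed.

(** Reconciles the derivation, a sum over the support of m, with [heis], which sums over the lattice
    basis. *)
Lemma ann_mon h k (m : {cmonom fockvar n}) : ann der G h k << m >> =
  \sum_(i < n) (k.+1%:R * gform G h (bvec i) * (m (i, k))%:R) *: << divcm m (ucm (i, k)) >>.
Proof.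
rewrite /ann derU /dmon.
pose g (x : fockvar n) : F := k.+1%:R * gform G h (bvec x.1) * (m x)%:R.
pose T (x : fockvar n) : M1 := g x *: << divcm m (ucm x) >>.
transitivity (\sum_(x <- finsupp m) \sum_(i < n) if x == (i, k) then T x else 0).
  apply: eq_bigr => -[i0 k0] _; rewrite (bigD1 i0) //= big1 ?addr0; last first.
    move=> i /negPf ii; case: eqP => // -[i0i _]; by rewrite i0i eqxx in ii.
  rewrite xpair_eqE eqxx /=; case: eqVneq => _.
    by rewrite mulr1n -scalerAl mul1r scalerA mulrC.
  by rewrite mulr0n scale0r mul0r scaler0.
rewrite exchange_big; apply: eq_bigr => i _ /=.
rewrite -big_mkcond /=; have [ik|ik] := boolP ((i, k) \in finsupp m).
  rewrite (big_rem (i, k)) //= eqxx big1_seq ?addr0 // => x.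
  by move=> /andP[/eqP ->]; rewrite mem_rem_uniq ?fset_uniq // !inE eqxx.
rewrite big1_seq; first by move: ik; rewrite -cmE_eq0 => /eqP ->; rewrite mulr0 scale0r.
by move=> x /andP[/eqP ->]; rewrite (negPf ik).
Qed.

Lemma heis_pos h k u beta : heis G h (Posz k.+1) (tens u beta) = tens (ann der G h k u) beta.
Proof.
have la : linear (ann der G h k) := (derivation_der _).1.
have lt := linear_tens beta.
move: u; apply: (eq_linear (linear_comp lt (linear_heis h k.+1)) (linear_comp la lt)) => m.
rewrite [X in heis _ _ _ X]tensU [LHS]linextU ann_mon.
rewrite (lin_sum _ _ _ lt); apply: eq_bigr => i _.
by rewrite (linZ lt) tensU.
Qed.

Lemma heis_zero h u beta :
  heis G h 0 (tens u beta) = gform G h (cplx beta) *: tens u beta.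
Proof.
have lt := linear_tens beta.
move: u; apply: (eq_linear (linear_comp lt (linear_heis h 0)) (linear_scale _ lt)) => m.
by rewrite [X in heis _ _ _ X]tensU [LHS]linextU -tensU.
Qed.

Lemma heis_nneg h p u beta : heis G h (Posz p) (tens u beta) =
  tens (annz der G h (gform G h (cplx beta)) p u) beta.
Proof.
case: p => [|k]; last exact: heis_pos.
by rewrite heis_zero (linZ (linear_tens beta)).
Qed.

Lemma Eminus_tens alpha p u beta :
  Eminus G alpha p (tens u beta) = tens (hc X (cplx alpha) p * u) beta.
Proof.
have lt := linear_tens beta; rewrite -expcoef_Xc.
apply: (expcoef_map _ _ lt) => [j|j|j v].
- exact: linear_mulZ.
- move=> a v w; rewrite (linear_heis _ _ a) scalerDr opprD.
  by rewrite scalerN !scalerA mulrC.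
case: j => [|j]; first by rewrite !invr0 !scale0r oppr0 (lin0 lt).
rewrite (_ : - j.+1%:Z = Negz j) // heis_neg (linZ lt) NegzE mulrNz invrN scaleNr.
by rewrite opprK.
Qed.

Lemma Eplus_tens alpha q u beta :
  Eplus G alpha q (tens u beta) = tens (ep der G (cplx alpha) q u) beta.
Proof.
have lt := linear_tens beta.
apply: (expcoef_map _ _ lt) => [j|j|j v].
- exact: (linear_ep_arg (@derivation_der F n)).
- move=> a v w; rewrite (linear_heis _ _ a) scalerDr opprD.
  by rewrite scalerN !scalerA mulrC.
case: j => [|j]; first by rewrite !invr0 !scale0r !oppr0 (lin0 lt).
by rewrite heis_pos (linN lt) (linZ lt).
Qed.

Lemma eshift_tens alpha u beta :
  eshift eps alpha (tens u beta) = eps alpha beta *: tens u (alpha + beta).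
Proof.
have lt := linear_tens beta; have lt' := linear_tens (alpha + beta).
move: u; apply: (eq_linear (linear_comp lt (linear_linext _)) (linear_scale _ lt')) => m.
by rewrite [X in linext _ X]tensU linextU -tensU.
Qed.

Lemma linear_emode alpha m : linear (emode G eps alpha m).
Proof. exact: linear_linext. Qed.

(** The exponent p is determined by q, so one index remains; those q for which p would be negative
    contribute 0. *)
Lemma fsum_pq {E : lmodType F} (f : nat -> nat -> E) (N m : int) K :
  (forall p q, (K <= q)%N -> f p q = 0) ->
  \sum_(pq \in [set pq : nat * nat | pq.1%:R - pq.2%:R + N%:~R = - m%:~R - 1 :> rat])
     f pq.1 pq.2 =
  \sum_(j < K) (if j%:Z - N - m - 1 is Posz p then f p j else 0).
Proof.
move=> fK.
have SE (p q : nat) : (p%:R - q%:R + N%:~R = - m%:~R - 1 :> rat) <->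
    p%:Z = q%:Z - N - m - 1.
  have -> : (p%:R - q%:R + N%:~R = - m%:~R - 1 :> rat) =
      ((p%:Z - q%:Z + N)%:~R = (- m - 1)%:~R :> rat).
    by rewrite !intrD !mulrNz.
  by split=> [/intr_inj|e]; [lia | congr _%:~R; lia].
pose g j := if (j%:Z - N - m - 1)%R is Posz p then f p j else 0.
pose r := [seq (absz (j%:Z - N - m - 1)%R, j) | j <- iota 0 K & 0 <= j%:Z - N - m - 1].
rewrite (fsbigE r).
- rewrite big_map big_filter_cond -(big_mkord xpredT g) /index_iota subn0 big_mkcond /=.
  apply: eq_big_seq => j _; rewrite /g.
  have [j0|j0] := boolP (0 <= _).
    rewrite mem_set; last by apply/SE => /=; lia.
    by case: (j%:Z - N - m - 1) j0.
  by case: (j%:Z - N - m - 1) j0.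
- rewrite map_inj_uniq ?filter_uniq ?iota_uniq // => i j [] //.
- move=> pq /= /mapP[j]; rewrite mem_filter => /andP[j0 _] -> /=.
  by apply/SE; lia.
- move=> [p q] /= /SE pqE; have [/fK-> //|qK] := leqP K q => /mapP[].
  exists q; last by congr pair; lia.
  by rewrite mem_filter mem_iota; lia.
Qed.

Lemma linear_Eminus alpha p : linear (Eminus G alpha p : V -> V).
Proof.
apply: linear_expcoef => j a v w; rewrite (linear_heis _ _ a) scalerDr opprD.
by rewrite scalerN !scalerA mulrC.
Qed.

Lemma linear_Eplus alpha q : linear (Eplus G alpha q : V -> V).
Proof.
apply: linear_expcoef => j a v w; rewrite (linear_heis _ _ a) scalerDr opprD.
by rewrite scalerN !scalerA mulrC.
Qed.

Lemma emode_mon alpha m (mm : {cmonom fockvar n}) beta :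
  emode G eps alpha m (tens << mm >> beta) =
  \sum_(pq \in [set pq : nat * nat |
      pq.1%:R - pq.2%:R + gform G alpha beta = - m%:~R - 1])
    eps alpha beta *: tens (hc X (cplx alpha) pq.1 * ep der G (cplx alpha) pq.2 << mm >>)
      (alpha + beta).
Proof.
rewrite tensU [LHS]linextU; apply: eq_fsbigr => -[p q] _ /=.
by rewrite -tensU eshift_tens (linZ (linear_Eplus _ _)) (linZ (linear_Eminus _ _))
  Eplus_tens Eminus_tens.
Qed.

Lemma mode_seq_cons i k s alpha m w :
  mode_seq G eps ((i, k) :: s) alpha m w =
    \sum_(p \in [set: nat])
        'C(p, k)%:R *: heis G (bvec i) (Negz p)
                         (mode_seq G eps s alpha (m + p%:Z - k%:Z) w)
    + \sum_(p \in [set: nat])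
        ((-1) ^+ k * 'C(p + k, k)%:R) *:
          mode_seq G eps s alpha (m - p%:Z - k%:Z - 1) (heis G (bvec i) p%:Z w).
Proof. by []. Qed.

Section Fixed.
Context (alpha beta : 'rV[rat]_n) (N : int).
Hypothesis abN : gform G alpha beta = N%:~R.
Local Notation th := (theta X der G (cplx alpha) (fun i => gform G (bvec i) (cplx beta)) N).
Local Notation ps := (psi X der G (cplx alpha) N).

(** As u has weight below K, the coefficients of index at least K of the second exponential kill
    it. *)
Lemma emode_tens (K : nat) m u : Wt X (K%:Z - 1) u ->
  emode G eps alpha m (tens u beta) = tens (eps alpha beta *: ps K 1 u m) (alpha + beta).
Proof.
have lt := linear_tens beta; have lt' := linear_tens (alpha + beta).
have dP := @derivation_der F n; have dX := @derX F n.
pose rhs u := eps alpha beta *: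
  \sum_(j < K) tens (hcz X (cplx alpha) (j%:Z - N - m - 1) * ep der G (cplx alpha) j u)
     (alpha + beta).
have lep j : linear (ep der G (cplx alpha) j) := linear_ep dP G _ j.
have lr : linear rhs.
  apply: linear_scale => a v w; rewrite scaler_sumr -big_split; apply: eq_bigr => j _.
  exact: (linear_comp (lep j) (linear_mull _ lt')).
have rhsE v : tens (eps alpha beta *: ps K 1 v m) (alpha + beta) = rhs v.
  apply: etrans (linZ lt' _ _) _; congr (_ *: _).
  by rewrite (psi1 dP dX); apply: lin_sum.
rewrite rhsE; apply: (lspan_min (subspace_eqfun (linear_comp lt (linear_emode alpha m)) lr)).
move=> _ [s [-> sK]] /=; rewrite -/(Xprod s) XprodU.
set mm := \big[_/_]_(_ <- s) _; rewrite emode_mon abN.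
pose f p q := eps alpha beta *:
  tens (hc X (cplx alpha) p * ep der G (cplx alpha) q << mm >>) (alpha + beta).
rewrite (@fsum_pq _ f N m K); last first.
  move=> p q Kq; rewrite /f (_ : ep _ _ _ _ _ = 0) ?mulr0 ?(lin0 lt') ?scaler0 //.
  apply: (@Wt_neg _ _ _ X (K%:Z - 1 - q%:Z)); first lia.
  apply: (ep_Wt dP dX gen_X); rewrite /mm -XprodU.
  exact: (Wt_mono sK (Wt_Xp X s)).
rewrite /rhs scaler_sumr; apply: eq_bigr => j _; rewrite /f.
by case: (j%:Z - N - m - 1) => //= z; rewrite mul0r (lin0 lt') scaler0.
Qed.

Lemma fsum_nat {E : lmodType F} (f : nat -> E) P :
  (forall p, (P <= p)%N -> f p = 0) -> \sum_(p \in [set: nat]) f p = \sum_(p < P) f p.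
Proof.
move=> fP; rewrite fsbig_ord; apply/esym/fsbig_widen => // p [_ /negP].
by rewrite -leqNgt => /fP.
Qed.

Lemma Xc_bvec i k : Xc X (bvec i) k = X (i, k).
Proof.
rewrite /Xc (bigD1 i) //= big1 ?addr0 => [|j /negPf ji].
  by rewrite mxE !eqxx scale1r.
by rewrite mxE eqxx ji scale0r.
Qed.

(** The right-hand side obeys the recursion that defines [mode_seq], by [sum_theta_mulX].
    Nonnegative modes do not raise the weight, so K remains valid for the new arguments. *)
Lemma mode_seq_tens (K : nat) s m u : all (fun x => x.2 < K)%N s -> Wt X (K%:Z - 1) u ->
  mode_seq G eps s alpha m (tens u beta) =
  tens (eps alpha beta *: \sum_(l < (size s).+1) th K l (Xprod s) u m) (alpha + beta).
Proof.
have lt' := linear_tens (alpha + beta).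
have dP := @derivation_der F n; have dX := @derX F n.
elim: s m u => [|[i k] s IH] m u.
  by move=> _ uK; rewrite Xprod_nil big_ord1; apply: emode_tens.
rewrite [all _ _]/= => /andP[kK sK] uK; rewrite mode_seq_cons [size (_ :: _)]/=.
pose P := absz (K%:Z - N + ((size s).+1 * (2 * K))%:Z + k%:Z - m)%R.
have tE v m' : th K (size s).+1 (Xprod s) v m' = 0.
  exact: (theta_Xp_eq0 dP dX gen_X).
have mP : K%:Z - N + ((size s).+1 * (2 * K))%:Z + k%:Z - m <= P%:Z by rewrite /P; lia.
rewrite Xprod_cons (sum_theta_mulX dP dX gen_X i u kK mP tE).
rewrite scalerDr (linD lt'); congr (_ + _).
  rewrite (@fsum_nat _ _ P) => [|p Pp].
    rewrite (linZ lt') (lin_sum _ _ _ lt') scaler_sumr; apply: eq_bigr => p _.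
    apply: (scaler_swap _ (linZ lt' _ _)); rewrite IH // heis_neg Xc_bvec.
    exact: (linZ (linear_mull _ lt')).
  rewrite IH // big1 ?scaler0 ?(lin0 lt') ?(lin0 (linear_heis _ _)) ?scaler0 //.
  move=> l _; apply: theta_large; have := ltn_ord l; move: Pp; rewrite /P; nia.
rewrite (@fsum_nat _ _ K) => [|p Kp].
  rewrite (linZ lt') (lin_sum _ _ _ lt') scaler_sumr; apply: eq_bigr => p _.
  apply: (scaler_swap _ (linZ lt' _ _)); rewrite heis_nneg IH // ?(linZ lt') //.
  by apply: Wt_mono (annz_Wt dP dX _ _ _ _ uK); lia.
rewrite heis_nneg (_ : annz _ _ _ _ _ _ = 0); last first.
  by apply: Wt_neg (annz_Wt dP dX _ _ _ _ uK); lia.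
rewrite IH //; last exact: subspace0 (subspace_Wt _ _).
have t0 l m' : th K l (Xprod s) 0 m' = 0 by exact: (@theta0r F n _ X der dP).
rewrite (eq_bigr (fun=> 0)) => [|l _]; last exact: t0.
by rewrite big1 // scaler0 (lin0 lt') scaler0.
Qed.

End Fixed.

Lemma V_ind (W : set V) : subspace W ->
  (forall m beta, W (tens << m >> beta)) -> forall w, W w.
Proof.
move=> sW Wm w; rewrite (V_sum w); apply: subspace_sum => // b _.
exact: subspaceZ.
Qed.

Lemma heis_large h w : exists P : nat, forall p : nat, (P <= p)%N -> heis G h p%:Z w = 0.
Proof.
have lh p := linear_heis h p.
apply: (V_ind (W := [set w | exists P : nat, forall p : nat, (P <= p)%N ->
   heis G h p%:Z w = 0])) => [|m beta].
  split=> [|u v [P uP] [Q vQ]|a v [P vP]].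
  - by exists 0%N => p _; rewrite (lin0 (lh _)).
  - exists (maxn P Q) => p; rewrite geq_max => /andP[Pp Qp].
    by rewrite (linD (lh _)) uP // vQ // addr0.
  - by exists P => p /vP; rewrite (linZ (lh _)) => ->; rewrite scaler0.
have [B mB] := ex_Wt gen_X << m >>.
exists B.+1 => p Bp; rewrite heis_nneg (_ : annz _ _ _ _ _ _ = 0) ?(lin0 (linear_tens _)) //.
by apply: Wt_neg (annz_Wt (@derivation_der F n) (@derX F n) _ _ _ _ mB); lia.
Qed.

Lemma emode_large alpha w : exists M : int, forall m, M <= m -> emode G eps alpha m w = 0.
Proof.
have le m := linear_emode alpha m.
apply: (V_ind (W := [set w | exists M : int, forall m, M <= m ->
   emode G eps alpha m w = 0])) => [|mm beta].
  split=> [|u v [P uP] [Q vQ]|a v [P vP]].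
  - by exists 0 => p _; rewrite (lin0 (le _)).
  - exists (Num.max P Q) => p; rewrite ge_max => /andP[Pp Qp].
    by rewrite (linD (le _)) uP // vQ // addr0.
  - by exists P => p /vP; rewrite (linZ (le _)) => ->; rewrite scaler0.
have [B mB] := ex_Wt gen_X << mm >>.
pose x := gform G alpha beta.
(* From p - q + x = -m - 1 and p >= 0 follows q >= m + 1 + x, which exceeds the weight B. Here x can
   be any rational number, since alpha and beta are arbitrary. *)
exists (B%:Z + (Num.bound `|x|)%:Z) => m Mm; rewrite emode_mon fsbig1 // => -[p q] /= pqE.
rewrite (_ : ep _ _ _ _ _ = 0) ?mulr0 ?(lin0 (linear_tens _)) ?scaler0 //.
apply: Wt_neg (ep_Wt (@derivation_der F n) (@derX F n) gen_X _ _ _ mB).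
suff : (B < q)%N by lia.
have := archi_boundP (normr_ge0 x); have := ler_norm (- x); rewrite normrN.
have : (B%:Z + (Num.bound `|x|)%:Z)%:~R <= m%:~R :> rat by rewrite ler_int.
rewrite intrD -/x in pqE *; rewrite -(ltr_nat rat) => h1 h2 h3.
have p0 : 0 <= p%:R :> rat by [].
by move: h1 pqE; rewrite -!pmulrn; lra.
Qed.

Lemma fsum_linear {E : lmodType F} (f g : nat -> E) a :
  (exists P, forall p, (P <= p)%N -> f p = 0) ->
  (exists P, forall p, (P <= p)%N -> g p = 0) ->
  \sum_(p \in [set: nat]) (a *: f p + g p) =
  a *: (\sum_(p \in [set: nat]) f p) + \sum_(p \in [set: nat]) g p.
Proof.
move=> [P fP] [Q gQ]; have fM p : (maxn P Q <= p)%N -> f p = 0.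
  by rewrite geq_max => /andP[/fP].
have gM p : (maxn P Q <= p)%N -> g p = 0 by rewrite geq_max => /andP[_ /gQ].
rewrite (fsum_nat fM) (fsum_nat gM) (@fsum_nat _ _ (maxn P Q)) => [|p pM].
  by rewrite big_split scaler_sumr.
by rewrite fM // gM // scaler0 addr0.
Qed.

(** The two claims are proved together: a sum over all p is additive only when its supports are
    finite, so linearity of a product needs the truncation of the shorter one. *)
Lemma mode_seq_field s alpha : (forall m, linear (mode_seq G eps s alpha m)) /\
  (forall w, exists M : int, forall m, M <= m -> mode_seq G eps s alpha m w = 0).
Proof.
elim: s => [|[i k] s [lS tS]].
  by split; [exact: linear_emode | exact: emode_large].
have lh p := linear_heis (bvec i) p.
have t1 m w : exists P, forall p, (P <= p)%N -> 'C(p, k)%:R *: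
    heis G (bvec i) (Negz p) (mode_seq G eps s alpha (m + p%:Z - k%:Z) w) = 0.
  have [M tM] := tS w; exists (absz (M - m + k%:Z)%R) => p Pp.
  by rewrite tM ?(lin0 (lh _)) ?scaler0 //; lia.
have t2 m w : exists P, forall p, (P <= p)%N -> ((-1) ^+ k * 'C(p + k, k)%:R) *:
    mode_seq G eps s alpha (m - p%:Z - k%:Z - 1) (heis G (bvec i) p%:Z w) = 0.
  have [P hP] := heis_large (bvec i) w; exists P => p /hP ->.
  by rewrite (lin0 (lS _)) scaler0.
split=> [m a u v|w].
  rewrite !mode_seq_cons scalerDr addrACA; congr (_ + _).
    apply: etrans _ (fsum_linear a (t1 m u) (t1 m v)); apply: eq_fsbigr => p _.
    exact: (linear_scale _ (linear_comp (lS _) (lh _))).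
  apply: etrans _ (fsum_linear a (t2 m u) (t2 m v)); apply: eq_fsbigr => p _.
  exact: (linear_scale _ (linear_comp (lh _) (lS _))).
have [M tM] := tS w; have [P hP] := heis_large (bvec i) w.
(* Only finitely many vectors (b_i)_p w are nonzero, so their truncation bounds have a maximum. *)
have [M' tM'] : exists M', forall m (p : nat), M' <= m -> (p < P)%N ->
    mode_seq G eps s alpha m (heis G (bvec i) p%:Z w) = 0.
  elim: P {hP} => [|P [M' tM']]; first by exists 0.
  have [M2 tM2] := tS (heis G (bvec i) P%:Z w); exists (Num.max M' M2) => m p.
  rewrite ge_max ltnS leq_eqVlt => /andP[m1 m2] /orP[/eqP->|]; first exact: tM2.
  exact: tM'.
exists (Num.max (M + k%:Z) (M' + P%:Z + k%:Z + 1)) => m; rewrite ge_max => /andP[m1 m2].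
rewrite mode_seq_cons; apply: etrans (addr0 0); congr (_ + _); apply: fsbig1 => p _.
  by rewrite tM ?(lin0 (lh _)) ?scaler0 //; lia.
have [pP|/hP ->] := ltnP p P; last by rewrite (lin0 (lS _)) scaler0.
by rewrite tM' ?scaler0 //; lia.
Qed.

Lemma linear_vmode m w : linear (fun v => vmode G eps v m w).
Proof. exact: linear_linext. Qed.

Lemma linear_vmoder v m : linear (vmode G eps v m).
Proof.
move=> a u w; rewrite /vmode /linext scaler_sumr -big_split; apply: eq_bigr => b _.
by rewrite (mode_seq_field _ _).1 scalerDr !scalerA mulrC.
Qed.

Lemma vmode_tens alpha beta (N : int) (f u : M1) m : gform G alpha beta = N%:~R ->
  exists K L, vmode G eps (tens f alpha) m (tens u beta) =
    tens (eps alpha beta *: \sum_(l < L) theta X der G (cplx alpha)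
       (fun i => gform G (bvec i) (cplx beta)) N K l f u m) (alpha + beta).
Proof.
move=> abN; have lt := linear_tens (alpha + beta).
pose th K l f := theta X der G (cplx alpha)
  (fun i => gform G (bvec i) (cplx beta)) N K l f u m.
pose rhs K L f := tens (eps alpha beta *: \sum_(l < L) th K l f) (alpha + beta).
pose lhs f := vmode G eps (tens f alpha) m (tens u beta).
have llhs : linear lhs := linear_comp (linear_tens alpha) (linear_vmode m _).
have lrhs K L : linear (rhs K L).
  apply: linear_comp lt; apply: linear_scale.
  apply: linear_bigsum => l.
  exact: (@linear_theta F n _ X der (@derivation_der F n)).
(* Different monomials of f need different cutoffs. Asking for the formula at all large K and L
   defines a subspace, so monomials suffice. *)
suff [K0 [L0 KL]] : exists K0 L0, forall K L, (K0 <= K)%N -> (L0 <= L)%N -> lhs f = rhs K L f.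
  by exists K0, L0; apply: KL.
apply: (lspan_min (A := [set v | exists mm, v = << mm >>]) (W := [set f | exists K0 L0,
   forall K L, (K0 <= K)%N -> (L0 <= L)%N -> lhs f = rhs K L f])) => [|_ [mm ->]|].
- split=> [|v w [P [P' vP]] [Q [Q' wQ]]|a v [P [P' vP]]].
  + by exists 0%N, 0%N => K L _ _; rewrite (lin0 llhs) (lin0 (lrhs _ _)).
  + exists (maxn P Q), (maxn P' Q') => K L.
    rewrite !geq_max => /andP[PK QK] /andP[PL QL].
    by rewrite (linD llhs) (linD (lrhs _ _)) -vP // -wQ.
  + by exists P, P' => K L PK PL; rewrite (linZ llhs) (linZ (lrhs _ _)) -vP.
- have [B uB] := ex_Wt gen_X u.
  exists (maxn B.+1 (\max_(x <- factors mm) x.2.+1)), (size (factors mm)).+1 => K L.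
  rewrite geq_max => /andP[BK fK] sL.
  have fKa : all (fun x => x.2 < K)%N (factors mm).
    apply/allP => x xf; apply: leq_trans fK.
    exact: (leq_bigmax_seq (F := fun x : fockvar n => x.2.+1)).
  have uK : Wt X (K%:Z - 1) u by apply: Wt_mono uB; lia.
  rewrite /lhs /rhs tensU [LHS]linextU (mode_seq_tens abN _ fKa uK).
  have e : \sum_(l < (size (factors mm)).+1) th K l (Xprod (factors mm)) =
      \sum_(l < L) th K l << mm >>.
    apply: etrans _ (congr1 (fun f => \sum_(l < L) th K l f) (esym (Xprod_factors mm))).
    apply/esym/(@sum_ord_trunc M1 (fun l => th K l (Xprod (factors mm)))) => // l sl _.
    exact: (@theta_Xp_eq0 F n _ X der (@derivation_der F n) (@derX F n) gen_X).
  exact: (congr1 (fun z : M1 => tens (eps alpha beta *: z) (alpha + beta)) e).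
- rewrite (malg_sum f); apply: subspace_sum (subspace_lspan _) _ => mm _.
  by apply: subspaceZ (subspace_lspan _) _; apply: mem_lspan; exists mm.
Qed.

End Modes.

(** * The upper bound *)

Section Spaces.
Context {F : numFieldType} {n : nat} {A : comAlgType F}.
Context (X : 'I_n * nat -> A) (der : ('I_n * nat -> A) -> A -> A).
Hypothesis derP : forall g, derivation (der g).
Hypothesis derX : forall g x, der g (X x) = g x.
Context (G : 'M[int]_n) {r s : nat} (rho : 'I_r -> 'I_n) (sigma : 'I_s -> 'I_n).
Implicit Types (c h : 'rV[F]_n) (u v : A) (l : seq ('I_r * nat)) (t : seq ('I_s * nat)).
Implicit Types (k : 'I_r -> nat).

Definition hr (x : 'I_r * nat) : A := hc X (bvec (rho x.1)) x.2.
Definition Hp l : A := \prod_(x <- l) hr x.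
Definition Sx t : A := \prod_(x <- t) X (sigma x.1, x.2).
Definition cnt l (i : 'I_r) : nat := count (fun x => x.1 == i) l.
Definition tot l : nat := \sum_(x <- l) x.2.

Definition Hsp (i : 'I_r) : set A := lspan [set v | exists d, v = hr (i, d)].
Definition Salg : set A := lspan [set v | exists t, v = Sx t].
(** Factors h_0 = 1 are counted, so this space grows with k; it is meant to sit over the lattice
    point with rho-coordinates k. *)
Definition Fsp k : set A :=
  lspan [set v | exists t l, v = Sx t * Hp l /\ cnt l =1 k].
(** The part without sigma's, graded by total degree. The grading makes high annihilating
    coefficients vanish and keeps the total fixed in the triangularity argument. *)
Definition Gsp k (z : int) : set A :=
  lspan [set v | exists l, [/\ v = Hp l, cnt l =1 k & (tot l)%:Z = z]].

Lemma linear_mulA (w : A) : linear (fun v => w * v).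
Proof. by move=> a u v; rewrite mulrDr scalerAr. Qed.

Lemma linear_mulAr (w : A) : linear (fun v => v * w).
Proof. by move=> a u v; rewrite mulrDl scalerAl. Qed.

Lemma lspan_mul (S1 S2 W : set A) u v : subspace W ->
  (forall u v, S1 u -> S2 v -> W (u * v)) -> lspan S1 u -> lspan S2 v -> W (u * v).
Proof.
move=> sW SW Su Sv; apply: (lspan_lin (linear_mulA u) sW _ Sv) => {Sv} w S2w.
by apply: (lspan_lin (linear_mulAr w) sW _ Su) => {Su}u' /SW; apply.
Qed.

Lemma Hp_cons x l : Hp (x :: l) = hr x * Hp l. Proof. exact: big_cons. Qed.

Lemma Sx_cat t t' : Sx (t ++ t') = Sx t * Sx t'. Proof. exact: big_cat. Qed.

Lemma Hp_cat l l' : Hp (l ++ l') = Hp l * Hp l'. Proof. exact: big_cat. Qed.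

Lemma Fsp_mem t l : Fsp (cnt l) (Sx t * Hp l).
Proof. by apply: mem_lspan; exists t, l. Qed.

Lemma Fsp_mul k k' k'' u v : (forall i, k'' i = (k i + k' i)%N) ->
  Fsp k u -> Fsp k' v -> Fsp k'' (u * v).
Proof.
move=> kk; apply: lspan_mul (subspace_lspan _) _ => _ _ [t [l [-> lk]]] [t' [l' [-> lk']]].
apply: mem_lspan; exists (t ++ t'), (l ++ l'); rewrite Sx_cat Hp_cat mulrACA; split=> // i.
by rewrite kk -lk -lk' /cnt count_cat.
Qed.

Lemma Fsp_mulH k k' i u v : (forall j, k' j = ((i == j) + k j)%N) ->
  Hsp i u -> Fsp k v -> Fsp k' (u * v).
Proof.
move=> kk; apply: lspan_mul (subspace_lspan _) _ => _ _ [d ->] [t [l [-> lk]]].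
apply: mem_lspan; exists t, ((i, d) :: l); rewrite Hp_cons mulrCA; split=> // j.
by rewrite kk -lk.
Qed.

Lemma Salg_mul u v : Salg u -> Salg v -> Salg (u * v).
Proof.
apply: lspan_mul (subspace_lspan _) _ => _ _ [t ->] [t' ->].
by apply: mem_lspan; exists (t ++ t'); rewrite Sx_cat.
Qed.

Lemma Salg1 : Salg 1.
Proof. by apply: mem_lspan; exists [::]; rewrite /Sx big_nil. Qed.

Lemma Salg_X j d : Salg (X (sigma j, d)).
Proof. by apply: mem_lspan; exists [:: (j, d)]; rewrite /Sx big_seq1. Qed.

Lemma Fsp_eq k k' : k =1 k' -> Fsp k `<=` Fsp k'.
Proof.
move=> kk; apply: lspanS => _ [t [l [-> lk]]]; exists t, l; split=> // i.
by rewrite lk.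
Qed.

Lemma Salg_Fsp0 u : Salg u -> Fsp (fun=> 0%N) u.
Proof.
apply: lspanS => _ [t ->]; exists t, [::]; split=> //.
by rewrite /Hp big_nil mulr1.
Qed.

(* [Tw c] is a derivation between twisted copies of A; an ordinary derivation is
   the case in which the twists do not matter. *)
Lemma twisted_Fsp (D : 'rV[F]_n -> A -> A) (d0 : 'rV[F]_n) k u :
  (forall c, linear (D c)) ->
  (forall c c' u v, D (c + c') (u * v) = D c u * v + u * D c' v) ->
  (forall x, Hsp x.1 (D (bvec (rho x.1)) (hr x))) ->
  (forall t, Salg (D d0 (Sx t))) ->
  Fsp k u -> Fsp k (D (d0 + \sum_i (k i)%:R *: bvec (rho i)) u).
Proof.
move=> lD DM DH DS.
have key t l : Fsp (cnt l) (D (d0 + \sum_(x <- l) bvec (rho x.1)) (Sx t * Hp l)).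
  elim: l => [|x l IH].
    rewrite big_nil addr0 /Hp big_nil mulr1.
    by apply: Fsp_eq (Salg_Fsp0 (DS t)).
  rewrite Hp_cons mulrCA big_cons addrCA DM; apply: subspaceD (subspace_lspan _) _ _.
    by apply: Fsp_mulH (DH x) (Fsp_mem t l).
  apply: Fsp_mulH IH => [//|]; apply: mem_lspan; exists x.2; by case: (x).
apply: lspan_lin (lD _) (subspace_lspan _) _ _ => _ [t [l [-> lk]]].
have -> : \sum_i (k i)%:R *: bvec (rho i) = \sum_(x <- l) bvec (rho x.1) :> 'rV[F]_n.
  under eq_bigr => i _ do rewrite -lk /cnt -sum1_count natr_sum scaler_suml big_mkcond.
  rewrite exchange_big /=; apply: eq_bigr => x _.
  rewrite (bigD1 x.1) //= eqxx scale1r big1 ?addr0 // => i /negPf.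
  by rewrite eq_sym => ->.
exact: Fsp_eq (key t l).
Qed.

Lemma derivation_Fsp (D : A -> A) k u : derivation D ->
  (forall x, Hsp x.1 (D (hr x))) -> (forall x, Salg (D (X (sigma x.1, x.2)))) ->
  Fsp k u -> Fsp k (D u).
Proof.
move=> dD DH DS; apply: (@twisted_Fsp (fun=> D) 0) => //.
- by move=> _; exact: dD.1.
- by move=> _ _; exact: dD.2.
elim=> [|x t IH].
  by rewrite /Sx big_nil derivation1 //; apply: subspace0 (subspace_lspan _).
rewrite /Sx big_cons -/(Sx t) dD.2; apply: subspaceD (subspace_lspan _) _ _.
  by apply: Salg_mul (DS x) _; apply: mem_lspan; exists t.
exact: Salg_mul (Salg_X _ _) IH.
Qed.

Lemma Xc_bvecA i d : Xc X (bvec i) d = X (i, d).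
Proof.
rewrite /Xc (bigD1 i) //= big1 ?addr0 => [|j /negPf ji].
  by rewrite mxE !eqxx scale1r.
by rewrite mxE eqxx ji scale0r.
Qed.

Lemma hcz_Hsp i z a : Hsp i (a *: hcz X (bvec (rho i)) z).
Proof.
apply: (subspaceZ _ (subspace_lspan _)); case: z => d /=.
  by apply: mem_lspan; exists d.
exact: subspace0 (subspace_lspan _).
Qed.

Lemma scale1_Salg a : Salg (a *: 1).
Proof. exact: subspaceZ (subspace_lspan _) Salg1. Qed.

Lemma pder_Fsp k x u : Fsp k u -> Fsp k (pder der x u).
Proof.
apply: derivation_Fsp => [|y|y]; first exact: derP; last first.
  by rewrite /pder derX; apply: scale1_Salg.
rewrite /hr (@derivation_hc _ _ _ X (pder der x) _ x.2 (x.1 == rho y.1)%:R).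
- exact: hcz_Hsp.
- exact: derP.
move=> d; rewrite Xc_bvecA /pder derX; congr (_ *: _); case: x => i e /=.
rewrite xpair_eqE eq_sym; case: (_ == i) => /=; last by rewrite mul0rn.
by rewrite eq_sym; case: eqP.
Qed.

(** The factor d + 1 in the commutator of h_{d+1} with rho_{-d-1} cancels the denominator in
    [derivation_hc]. *)
Lemma ann_hr h d x :
  ann der G h d (hr x) = gform G h (bvec (rho x.1)) *: hcz X (bvec (rho x.1)) (x.2%:Z - d.+1%:Z).
Proof.
rewrite /hr (@derivation_hc _ _ _ X (ann der G h d) _ d
  (d.+1%:R * gform G h (bvec (rho x.1)))).
- by rewrite mulrAC divff ?mul1r // pnatr_eq0.
- exact: derP.
by move=> e; rewrite Xc_bvecA /ann derX.
Qed.

Lemma annz_Fsp k h a p u : Fsp k u -> Fsp k (annz der G h a p u).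
Proof.
case: p => [|d] /=; first exact: (subspaceZ _ (subspace_lspan _)).
apply: derivation_Fsp => [|y|y]; first exact: derP.
  by rewrite ann_hr; apply: hcz_Hsp.
by rewrite /ann derX; apply: scale1_Salg.
Qed.

(** One rho_i of the twist is spent on each factor h_d(rho_i), which becomes (d + 1) h_{d+1}(rho_i);
    what is left, d0, multiplies by a polynomial in the sigma's. Hence k has to match the lattice
    point. *)
Lemma Tw_Fsp k d0 u : Salg (Xc X d0 0) -> Fsp k u ->
  Fsp k (Tw X der (d0 + \sum_i (k i)%:R *: bvec (rho i)) u).
Proof.
move=> S0; apply: twisted_Fsp => [c|c c' v w|x|t].
- exact: linear_Tw.
- exact: Tw_mul.
- rewrite /hr (Tw_hc derP derX); apply: subspaceZ (subspace_lspan _) _.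
  by apply: mem_lspan; exists x.2.+1.
- have St t' : Salg (Sx t') by apply: mem_lspan; exists t'.
  apply: subspaceD (subspace_lspan _) _ _; last exact: Salg_mul S0 (St t).
  elim: t => [|x t IH].
    rewrite /Sx big_nil (derivation1 (derivation_Tr X derP)).
    exact: subspace0 (subspace_lspan _).
  rewrite /Sx big_cons -/(Sx t) (derivation_Tr X derP).2.
  apply: subspaceD (subspace_lspan _) _ _; last exact: Salg_mul (Salg_X _ _) IH.
  apply: Salg_mul (St t); rewrite /Tr derX.
  exact: subspaceZ (subspace_lspan _) (Salg_X _ _).
Qed.

Lemma cz_Fsp k d0 z u : Salg (Xc X d0 0) -> Fsp k u ->
  Fsp k (cz X der (d0 + \sum_i (k i)%:R *: bvec (rho i)) z u).
Proof.
move=> S0 uF; case: z => q /=; last exact: subspace0 (subspace_lspan _).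
apply: subspaceZ (subspace_lspan _) _; elim: q => //= q IH.
exact: Tw_Fsp.
Qed.

Lemma Gsp_mem l : Gsp (cnt l) (tot l)%:Z (Hp l).
Proof. by apply: mem_lspan; exists l. Qed.

Lemma Gsp_mulh k k' i z z' w v : (forall j, k' j = ((i == j) + k j)%N) ->
  Gsp k z v -> z' = z + w -> Gsp k' z' (hcz X (bvec (rho i)) w * v).
Proof.
move=> kk Gv z'E; case: w z'E => d z'E /=; last first.
  by rewrite mul0r; apply: subspace0 (subspace_lspan _).
apply: lspan_lin (linear_mulA _) (subspace_lspan _) _ _ Gv => _ [l [-> lk lz]].
apply: mem_lspan; exists ((i, d) :: l); split; first by rewrite Hp_cons.
  by move=> j; rewrite kk -lk.
by rewrite /tot big_cons z'E -lz PoszD addrC.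
Qed.

Lemma ann_Gsp k z h d u : Gsp k z u -> Gsp k (z - d.+1%:Z) (ann der G h d u).
Proof.
have dD : derivation (ann der G h d) := derP _.
apply: lspan_lin dD.1 (subspace_lspan _) _ _ => _ [l [-> lk <-]].
suff : Gsp (cnt l) ((tot l)%:Z - d.+1%:Z) (ann der G h d (Hp l)).
  by apply: lspanS => _ [l' [-> lk' lz]]; exists l'; split=> // i; rewrite lk'.
elim: l {lk} => [|x l IH].
  by rewrite /Hp big_nil derivation1 //; apply: subspace0 (subspace_lspan _).
rewrite Hp_cons dD.2 ann_hr; apply: subspaceD (subspace_lspan _) _ _.
  rewrite -scalerAl; apply: subspaceZ (subspace_lspan _) _.
  by apply: Gsp_mulh (Gsp_mem l) _ => //; rewrite /tot big_cons; lia.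
rewrite /hr -[hc _ _ _]/(hcz X (bvec (rho x.1)) x.2).
by apply: Gsp_mulh IH _ => //; rewrite /tot big_cons; lia.
Qed.

Hypothesis genA : forall u, lspan [set v | exists y, v = \prod_(x <- y) X x] u.

Lemma ep_Gsp k z h q u : Gsp k z u -> Gsp k (z - q%:Z) (ep der G h q u).
Proof.
move=> uG; elim/ltn_ind: q => -[|q] IH; first by rewrite ep0 ?subr0.
have -> : ep der G h q.+1 u = q.+1%:R^-1 *: (q.+1%:R *: ep der G h q.+1 u).
  by rewrite scalerA mulVf ?scale1r // pnatr_eq0.
rewrite (ep_rec derP derX genA); apply: subspaceZ (subspace_lspan _) _.
rewrite -scaleN1r; apply: subspaceZ (subspace_lspan _) _.
apply: subspace_sum (subspace_lspan _) _ => j _; have jq := ltn_ord j.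
have jS : (q.+1 - j.+1 < q.+1)%N by lia.
rewrite (_ : z - _ = z - (q.+1 - j.+1)%N%:Z - j.+1%:Z); last lia.
exact: ann_Gsp (IH _ jS).
Qed.

Lemma Gsp_neg k z u : z < 0 -> Gsp k z u -> u = 0.
Proof.
move=> z0; have sW : subspace [set w : A | w = 0].
  split=> [//|v w -> ->|a v ->]; by rewrite /= ?addr0 ?scaler0.
by apply: (lspan_min sW) => v [l [_ _ lz]]; exfalso; lia.
Qed.

End Spaces.

(** * The form, sublattices and the dual lattice *)

Section GramForm.
Context {n : nat} (G : 'M[int]_n).

Section Ring.
Context {R : comNzRingType}.
Implicit Types x y z : 'rV[R]_n.

Lemma gformDl x y z : gform G (x + y) z = gform G x z + gform G y z.
Proof. by rewrite /gform !mulmxDl mxE. Qed.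

Lemma gformDr x y z : gform G z (x + y) = gform G z x + gform G z y.
Proof. by rewrite /gform linearD mulmxDr mxE. Qed.

Lemma gformZr (a : R) x z : gform G z (a *: x) = a * gform G z x.
Proof. by rewrite /gform linearZ -scalemxAr mxE. Qed.

Lemma gformZl (a : R) x z : gform G (a *: x) z = a * gform G x z.
Proof. by rewrite /gform -!scalemxAl mxE. Qed.

Lemma gform0r z : gform G z 0 = 0.
Proof. by rewrite -(scale0r 0) gformZr mul0r. Qed.

Lemma gform0l z : gform G 0 z = 0.
Proof. by rewrite -(scale0r 0) gformZl mul0r. Qed.

Lemma gform_sumr I (e : seq I) (P : pred I) (f : I -> 'rV[R]_n) z :
  gform G z (\sum_(i <- e | P i) f i) = \sum_(i <- e | P i) gform G z (f i).
Proof.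
by apply: (big_morph (gform G z)) => [x y|]; [apply: gformDr | apply: gform0r].
Qed.

Lemma gform_suml I (e : seq I) (P : pred I) (f : I -> 'rV[R]_n) z :
  gform G (\sum_(i <- e | P i) f i) z = \sum_(i <- e | P i) gform G (f i) z.
Proof.
by apply: (big_morph (fun x => gform G x z)) => [x y|]; [apply: gformDl | apply: gform0l].
Qed.

Lemma gform_bvec i j : gform G (bvec i) (bvec j : 'rV[R]_n) = (G i j)%:~R.
Proof. by rewrite /gform -rowE trmx_delta -colE !mxE. Qed.

Lemma gform_sym x y : symmetric_gram G -> gform G x y = gform G y x.
Proof.
(* Symmetry is assumed over the integers; it gives G^T = G, which passes to every ring of
   scalars. *)
move=> symG; have GT : G^T = G.
  apply/matrixP => i j; have := symG (bvec j) (bvec i).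
  have gf a b : gform G (bvec a) (bvec b : 'rV[int]_n) = G a b.
    by rewrite /gform -rowE trmx_delta -colE !mxE intz.
  by rewrite !gf mxE.
rewrite /gform; have -> : x *m map_mx intr G *m y^T = (y *m map_mx intr G *m x^T)^T.
  by rewrite !trmx_mul trmxK map_trmx GT mulmxA.
by rewrite mxE.
Qed.

End Ring.

Implicit Types (x y : 'rV[rat]_n) (S : {pred 'I_n}).

Lemma sublattice0 S : sublattice S 0.
Proof. by exists (fun=> 0); rewrite big1 // => i _; rewrite scale0r. Qed.

Lemma sublatticeD S x y : sublattice S x -> sublattice S y -> sublattice S (x + y).
Proof.
move=> [c ->] [d ->]; exists (fun i => c i + d i); rewrite -big_split.
by apply: eq_bigr => i _; rewrite intrD scalerDl.
Qed.

Lemma sublatticeN S x : sublattice S x -> sublattice S (- x).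
Proof.
move=> [c ->]; exists (fun i => - c i); rewrite -sumrN.
by apply: eq_bigr => i _; rewrite mulrNz scaleNr.
Qed.

Lemma sublatticeZ S (i : 'I_n) (z : int) : i \in S -> sublattice S (z%:~R *: bvec i).
Proof.
move=> iB; exists (fun j => if j == i then z else 0); rewrite (bigD1 i) //= eqxx.
by rewrite big1 ?addr0 // => j /andP[_ /negPf ->]; rewrite scale0r.
Qed.

Lemma sublattice_bvec S (i : 'I_n) : i \in S -> sublattice S (bvec i).
Proof. by move=> /(sublatticeZ 1); rewrite scale1r. Qed.

Lemma sublattice_sum S I (e : seq I) (f : I -> 'rV[rat]_n) :
  (forall i, sublattice S (f i)) -> sublattice S (\sum_(i <- e) f i).
Proof.
by move=> Lf; elim/big_ind: _ => //; [apply: sublattice0 | move=> *; apply: sublatticeD].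
Qed.

Lemma sublatticeS S x : sublattice S x -> lattice x.
Proof.
move=> [c ->]; exists (fun i => if i \in S then c i else 0).
rewrite big_mkcond [RHS]big_mkcond; apply: eq_bigr => i _ /=.
by case: ifP; rewrite ?scale0r.
Qed.

Lemma dual_latticeD x y : dual_lattice G x -> dual_lattice G y -> dual_lattice G (x + y).
Proof. by move=> dx dy z Lz; rewrite gformDl rpredD ?dx ?dy. Qed.

Lemma lattice_dual x : lattice x -> dual_lattice G x.
Proof.
move=> [c ->] _ [d ->]; rewrite gform_sumr rpred_sum // => i _.
rewrite gformZr gform_suml rpredM ?intr_int // rpred_sum // => j _.
by rewrite gformZl gform_bvec rpredM ?intr_int.
Qed.

Lemma gform_int x y : symmetric_gram G -> lattice x -> dual_lattice G y ->
  exists N : int, gform G x y = N%:~R.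
Proof.
by move=> sG Lx /(_ _ Lx); rewrite gform_sym // => /intrP[N ->]; exists N.
Qed.

End GramForm.

Section UpperBound.
Context {F : numFieldType} {n : nat} (G : 'M[int]_n).
Context (eps : 'rV[rat]_n -> 'rV[rat]_n -> F).
Context {r s : nat} (rho : 'I_r -> 'I_n) (sigma : 'I_s -> 'I_n).
Local Notation M1 := {malg F[{cmonom fockvar n}]}.
Local Notation monom := ({cmonom fockvar n} * 'rV[rat]_n)%type.
Local Notation V := {malg F[monom]}.
Local Notation X := (@X F n).
Local Notation der := (@der F n).
Local Notation cplx := (@cplx F n).
Local Notation LS := (sublattice (mem (codom sigma))).
Local Notation Fs := (Fsp X rho sigma : ('I_r -> nat) -> set M1).
Implicit Types (k : 'I_r -> nat) (alpha beta delta lambda : 'rV[rat]_n).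
Hypothesis symG : symmetric_gram G.

Definition pt k delta : 'rV[rat]_n := delta + \sum_i (k i)%:R *: bvec (rho i).

Lemma ptD k k' delta delta' :
  pt (fun i => k i + k' i)%N (delta + delta') = pt k delta + pt k' delta'.
Proof.
rewrite /pt addrACA -big_split; congr (_ + _); apply: eq_bigr => i _.
by rewrite natrD scalerDl.
Qed.

Lemma pt0 delta : pt (fun=> 0%N) delta = delta.
Proof. by rewrite /pt big1 ?addr0 // => i _; rewrite scale0r. Qed.

Lemma lattice_pt k delta : LS delta -> lattice (pt k delta).
Proof.
move=> /sublatticeS Ld; apply: sublatticeD => //; apply: sublattice_sum => i.
by rewrite pmulrn; apply: sublatticeZ.
Qed.

Lemma cplx_pt k delta : cplx (pt k delta) =
  cplx delta + \sum_i (k i)%:R *: bvec (rho i).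
Proof.
apply/rowP => j; rewrite !mxE !summxE rmorphD rmorph_sum; congr (_ + _).
by apply: eq_bigr => i _; rewrite !mxE rmorphM !rmorph_nat.
Qed.

Lemma Salg_delta delta : LS delta -> Salg X sigma (Xc X (cplx delta) 0).
Proof.
move=> [c ->]; apply: subspace_sum (subspace_lspan _) _ => i _.
have [/codomP[j ->]|iS] := boolP (i \in codom sigma).
  by apply: subspaceZ (subspace_lspan _) _; apply: Salg_X.
rewrite (_ : cplx _ ord0 i = 0); first by rewrite scale0r; apply: subspace0 (subspace_lspan _).
rewrite mxE summxE big1 ?rmorph0 // => j jS; rewrite !mxE eqxx /=.
case: eqVneq => [ij|]; last by rewrite mulr0.
by move: iS; rewrite ij; case/negP.
Qed.

(** The upper bound for the module, and at lambda = 0 also for W(R,S) itself. *)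
Definition Usp lambda : set V :=
  lspan [set v | exists k delta (f : M1),
    [/\ v = tens f (lambda + pt k delta), LS delta & Fs k f]].

Lemma Usp_mem lambda k delta f : LS delta -> Fs k f ->
  Usp lambda (tens f (lambda + pt k delta)).
Proof. by move=> Ld Ff; apply: mem_lspan; exists k, delta, f. Qed.

(** Both k and the component in L(S) add under products, exactly as the lattice points do. *)
Lemma Usp_vmode lambda u w m : dual_lattice G lambda ->
  Usp 0 u -> Usp lambda w -> Usp lambda (vmode G eps u m w).
Proof.
move=> dl; have sU : subspace (Usp lambda) := subspace_lspan _.
move=> Uu Uw; apply: (lspan_lin (linear_vmode G eps m w) sU _ Uu) => {u Uu}.
move=> _ [k [delta [f [-> Ld Ff]]]].
apply: (lspan_lin (linear_vmoder G eps _ m) sU _ Uw) => {w Uw}.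
move=> _ [k' [delta' [f' [-> Ld' Ff']]]].
have [N abN] : exists N : int, gform G (0 + pt k delta) (lambda + pt k' delta') = N%:~R.
  apply: gform_int => //; first by rewrite add0r; apply: lattice_pt.
  by apply: dual_latticeD => //; apply/lattice_dual/lattice_pt.
have [K [L ->]] := vmode_tens eps f f' m abN.
rewrite (linZ (linear_tens _)) add0r (addrCA (pt k delta) lambda) -ptD; apply: subspaceZ => //.
apply: Usp_mem; first exact: sublatticeD.
apply: subspace_sum (subspace_lspan _) _ => l _.
have dP := @derivation_der F n; have dX := @derX F n.
apply: (@theta_closed F n _ X der dP dX (@gen_X F n) G _ _ N K (Fs k) (Fs k')) => //;
  try exact: subspace_lspan.
- by move=> x g; apply: (@pder_Fsp F n _ X der dP dX).
- by move=> z g; rewrite cplx_pt; apply: (@cz_Fsp F n _ X der dP dX); apply: Salg_delta.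
- by move=> h a p g; apply: (@annz_Fsp F n _ X der dP dX).
- by move=> g g'; apply: Fsp_mul.
Qed.

End UpperBound.

(** * Triangularity *)

Section LexOrder.
Context {r : nat}.
Implicit Types (x y : 'I_r * nat) (l : seq ('I_r * nat)).

(** A sorted list has its largest entry in front, that is, the mode that is applied last. *)
Definition lexge x y : bool := (y.1 < x.1)%N || (y.1 == x.1) && (y.2 <= x.2)%N.

Lemma lexge_total : total lexge.
Proof. by move=> x y; rewrite /lexge -!val_eqE /=; lia. Qed.

Lemma lexge_trans : transitive lexge.
Proof. by move=> x y z; rewrite /lexge -!val_eqE /=; lia. Qed.

Lemma lexge_anti : antisymmetric lexge.
Proof.
move=> [i d] [j e]; rewrite /lexge -!val_eqE /= => ije.
have [ij de] : val i = val j /\ d = e by rewrite /=; lia.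
by congr pair => //; apply: val_inj.
Qed.

(* B > size l and W >= tot l make [rk B W] additive and compatible with [lexge]:
   a list whose largest part is larger has a larger rank. *)
Definition key (W : nat) x : nat := (x.1 * W.+1 + x.2)%N.
Definition rk (B W : nat) l : nat := \sum_(x <- l) B ^ key W x.

Lemma key_lexge W x y : (y.2 <= W)%N -> lexge x y -> (key W y <= key W x)%N.
Proof.
rewrite /lexge /key -val_eqE /= => yW /orP[xy|/andP[/eqP -> yx]]; last by rewrite leq_add2l.
by apply: leq_trans (_ : x.1 * W.+1 <= _)%N; [nia | apply: leq_addr].
Qed.

Lemma rk_cons B W x l : rk B W (x :: l) = (B ^ key W x + rk B W l)%N.
Proof. exact: big_cons. Qed.

Lemma perm_rk B W l l' : perm_eq l l' -> rk B W l = rk B W l'.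
Proof. exact: perm_big. Qed.

Lemma rk_le B W l k : (0 < B)%N -> all (fun x => key W x <= k)%N l ->
  (rk B W l <= size l * B ^ k)%N.
Proof.
move=> B0; elim: l => [|x l IH] /=; first by rewrite /rk big_nil.
move=> /andP[xk lk]; rewrite rk_cons mulSn leq_add ?IH //.
by rewrite leq_pexp2l.
Qed.

Lemma mem_tot l x : x \in l -> (x.2 <= tot l)%N.
Proof. by move=> xl; rewrite /tot (big_rem x) //= leq_addr. Qed.

Lemma tot_cons x l : tot (x :: l) = (x.2 + tot l)%N.
Proof. exact: big_cons. Qed.

Lemma size_cnt l : size l = (\sum_i cnt l i)%N.
Proof.
elim: l => [|x l IH] /=; first by rewrite big1.
rewrite /cnt /= big_split /= -IH (bigD1 x.1) //= eqxx big1 ?addn0 ?add1n //.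
by move=> i /negPf; rewrite eq_sym => ->.
Qed.

Lemma perm_cnt l l' : perm_eq l l' -> cnt l =1 cnt l'.
Proof. by move=> ll i; apply/permP. Qed.

Lemma perm_tot l l' : perm_eq l l' -> tot l = tot l'.
Proof. exact: perm_big. Qed.

End LexOrder.

Section Triangular.
Context {F : numFieldType} {n : nat} {A : comAlgType F}.
Context (X : 'I_n * nat -> A) (der : ('I_n * nat -> A) -> A -> A).
Hypothesis derP : forall g, derivation (der g).
Hypothesis derX : forall g x, der g (X x) = g x.
Hypothesis genA : forall u, lspan [set v | exists y, v = \prod_(x <- y) X x] u.
Context (G : 'M[int]_n) {r : nat} (rho : 'I_r -> 'I_n).
Context (e : 'I_r -> seq ('I_r * nat) -> F).
Hypothesis e_neq0 : forall i l, e i l != 0.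
Implicit Types (x : 'I_r * nat) (l : seq ('I_r * nat)) (k : 'I_r -> nat).
Local Notation Hp := (Hp X rho).
Local Notation Gsp := (Gsp X rho).
Local Notation hcr i := (hcz X (bvec (rho i))).
Local Notation epr i := (ep der G (bvec (rho i))).

(* The polynomial part of a product of modes of the e^rho_i applied to e^mu; an
   entry (i, d) of l stands for the mode with leading term h_d(rho_i), and the head
   of l is the mode applied last. *)
Fixpoint qp l : A :=
  if l is x :: l' then
    e x.1 l' *: \sum_(j < (tot l').+1)
      hcr x.1 (x.2%:Z + (nat_of_ord j)%:Z) * epr x.1 j (qp l')
  else 1.

Lemma qp_cons x l : qp (x :: l) = e x.1 l *: (hr X rho x * qp l +
  \sum_(j < tot l) hcr x.1 (x.2%:Z + j.+1%:Z) * epr x.1 j.+1 (qp l)).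
Proof.
have -> : qp (x :: l) = e x.1 l *: \sum_(j < (tot l).+1)
    hcr x.1 (x.2%:Z + (nat_of_ord j)%:Z) * epr x.1 j (qp l) by [].
rewrite big_ord_recl (_ : (nat_of_ord ord0)%:Z = 0) // addr0; congr (_ *: (_ * _ + _)).
exact: ep0.
Qed.

Lemma qp_Gsp l : Gsp (cnt l) (tot l)%:Z (qp l).
Proof.
elim: l => [|x l IH].
  by apply: mem_lspan; exists [::]; rewrite /Hp big_nil /tot big_nil.
apply: subspaceZ (subspace_lspan _) _; apply: subspace_sum (subspace_lspan _) _ => j _.
apply: Gsp_mulh _ (ep_Gsp derP derX G genA _ _ IH) _ => //.
by rewrite tot_cons; lia.
Qed.

(** The mode number is chosen so that h_{x.2} is the lowest first-exponential coefficient that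
    occurs. Beyond [tot l] the second exponential gives 0 for reasons of degree. *)
Lemma qp_psi K x l (N : int) : (tot l < K)%N ->
  e x.1 l *: psi X der G (bvec (rho x.1)) N K 1 (qp l) (- x.2%:Z - 1 - N) = qp (x :: l).
Proof.
move=> lK; rewrite (psi1 derP derX) [RHS]/=; congr (_ *: _).
rewrite (@sum_ord_trunc _ (fun j => hcr x.1 (j%:Z - N - (- x.2%:Z - 1 - N) - 1) *
  epr x.1 j (qp l)) (tot l).+1) // => [|j lj _].
  apply: eq_bigr => j _.
  by rewrite (_ : j%:Z - N - (- x.2%:Z - 1 - N) - 1 = x.2%:Z + j%:Z) //; lia.
rewrite (_ : epr x.1 j (qp l) = 0) ?mulr0 //.
by apply: Gsp_neg (ep_Gsp derP derX G genA _ j (qp_Gsp l)); lia.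
Qed.

Definition Hgt B W k (z N : nat) : set A := lspan [set v | exists l,
  [/\ v = Hp l, cnt l =1 k, tot l = z & (N < rk B W l)%N]].

(** Corrections are of two kinds. Those inherited from the tail rank higher because the rank is
    additive; in the others the head has a larger degree, and this one entry outranks the whole
    list. *)
Lemma qp_leading B W l : sorted lexge l -> (size l < B)%N -> (tot l <= W)%N ->
  exists2 c : F, c != 0 & Hgt B W (cnt l) (tot l) (rk B W l) (qp l - c *: Hp l).
Proof.
elim: l => [|x l IH] sl lB lW.
  exists 1; first exact: oner_neq0.
  rewrite scale1r /Hp big_nil subrr; exact: subspace0 (subspace_lspan _).
have lx : all (lexge x) l by apply: order_path_min sl; apply: lexge_trans.
have sl' : sorted lexge l := path_sorted sl.
have lB' : (size l < B)%N by move: lB => /=; lia.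
have lW' : (tot l <= W)%N by move: lW; rewrite tot_cons; lia.
have [c c0 qc] := IH sl' lB' lW'.
exists (e x.1 l * c); first by rewrite mulf_neq0.
have keyl : all (fun y => key W y <= key W x)%N l.
  apply/allP => y yl; apply: key_lexge (allP lx _ yl).
  by move: (mem_tot yl) lW; rewrite tot_cons; lia.
(* All keys in x :: l are at most that of x, and there are fewer than B of them. *)
have rkx : (rk B W (x :: l) < B ^ (key W x).+1)%N.
  have B0 : (0 < B)%N by lia.
  have keyx : all (fun y => key W y <= key W x)%N (x :: l) by rewrite /= leqnn.
  have := rk_le B0 keyx; rewrite expnS; move: lB => /= lB le.
  apply: leq_ltn_trans le _; rewrite ltn_pmul2r // expn_gt0 B0 //.
rewrite qp_cons Hp_cons -scalerA -scalerBr scalerAr addrAC -mulrBr.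
apply: subspaceZ (subspace_lspan _) _; apply: subspaceD (subspace_lspan _) _ _.
  apply: (lspan_lin (linear_mulA _) (subspace_lspan _) _ qc) => _ [l' [-> lk lz lr]].
  apply: mem_lspan; exists (x :: l'); split; first by rewrite Hp_cons.
  - by move=> i; rewrite /cnt /= -/(cnt l' i) lk.
  - by rewrite !tot_cons lz.
  - by rewrite !rk_cons ltn_add2l.
apply: subspace_sum (subspace_lspan _) _ => j _; have jl := ltn_ord j.
have := ep_Gsp derP derX G genA (bvec (rho x.1)) j.+1 (qp_Gsp l).
apply: (lspan_lin (linear_mulA _) (subspace_lspan _)) => _ [l' [-> lk lz]].
apply: mem_lspan; exists ((x.1, x.2 + j.+1)%N :: l'); split.
- by rewrite Hp_cons.
- by move=> i; rewrite /cnt /= -/(cnt l' i) lk.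
- by rewrite !tot_cons /=; lia.
- apply: leq_trans rkx _; rewrite rk_cons; apply: leq_trans (leq_addr _ _).
  by rewrite leq_pexp2l //; [lia | rewrite /key /=; lia].
Qed.

Lemma perm_Hp l l' : perm_eq l l' -> Hp l = Hp l'.
Proof. exact: perm_big. Qed.

(** Each product is a multiple of some [qp] plus products of higher rank, and ranks are bounded once
    the counts and the total are fixed. *)
Lemma Hp_span l :
  lspan [set v | exists l', [/\ v = qp l', sorted lexge l' & cnt l' =1 cnt l]] (Hp l).
Proof.
(* Every key is at most r (W + 1), since x.1 < r and x.2 <= W; this gives the bound M on the
   rank. *)
pose B := (size l).+1; pose W := tot l; pose M := (size l * B ^ (r * W.+1))%N.
suff key N l' : (M - rk B W l' <= N)%N -> cnt l' =1 cnt l -> tot l' = tot l ->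
    lspan [set v | exists l', [/\ v = qp l', sorted lexge l' & cnt l' =1 cnt l]] (Hp l').
  exact: key (leqnn _) _ _.
have sz l0 : cnt l0 =1 cnt l -> size l0 = size l.
  by move=> lk; rewrite !size_cnt; apply: eq_bigr => i _; rewrite lk.
have rkM l0 : cnt l0 =1 cnt l -> tot l0 = tot l -> (rk B W l0 <= M)%N.
  move=> lk lz; rewrite /M -(sz _ lk); apply: rk_le => //.
  apply/allP => y yl; rewrite /key; have := mem_tot yl; rewrite lz -/W => yW.
  have : (y.1.+1 * W.+1 <= r * W.+1)%N by rewrite leq_mul2r ltn_ord orbT.
  by rewrite mulSn => h; apply: leq_trans h; rewrite addnC leq_add2r; apply: leqW.
(* Both cases run in parallel. Sorting changes neither [Hp] nor the rank, and in the base case no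
   product of higher rank is left. *)
elim: N l' => [|N IH] l' lN lk lz; pose ls := sort lexge l'.
all: have pls : perm_eq l' ls by rewrite perm_sym perm_sort.
all: have cls : cnt ls =1 cnt l by move=> i; rewrite -lk; apply/esym/perm_cnt.
all: have tls : tot ls = tot l by rewrite -lz; apply/esym/perm_tot.
all: have sls : sorted lexge ls by apply: sort_sorted lexge_total _.
all: have lsB : (size ls < B)%N by rewrite (sz _ cls).
all: have lsW : (tot ls <= W)%N by rewrite tls.
all: have [c c0 gq] := qp_leading sls lsB lsW.
all: have -> : Hp l' = c^-1 *: qp ls - c^-1 *: (qp ls - c *: Hp ls)
  by rewrite scalerBr opprB addrC subrK scalerA mulVf // scale1r; apply: perm_Hp.
all: apply: subspaceB (subspace_lspan _) _ _; apply: subspaceZ (subspace_lspan _) _;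
  first by apply: mem_lspan; exists ls.
all: apply: (lspan_min (subspace_lspan _) _ gq) => _ [l2 [-> l2k l2z l2r]].
all: have cl2 : cnt l2 =1 cnt l by move=> i; rewrite l2k.
all: have tl2 : tot l2 = tot l by rewrite l2z.
all: have := rkM _ cl2 tl2; move: lN; rewrite (perm_rk _ _ pls) => lN l2M.
  by exfalso; lia.
by apply: IH => //; lia.
Qed.

End Triangular.

(** * The lower bound *)

Section LowerBound.
Context {F : numFieldType} {n : nat} (G : 'M[int]_n).
Context (eps : 'rV[rat]_n -> 'rV[rat]_n -> F).
Context {r s : nat} (rho : 'I_r -> 'I_n) (sigma : 'I_s -> 'I_n).
Local Notation M1 := {malg F[{cmonom fockvar n}]}.
Local Notation monom := ({cmonom fockvar n} * 'rV[rat]_n)%type.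
Local Notation V := {malg F[monom]}.
Local Notation X := (@X F n).
Local Notation der := (@der F n).
Local Notation cplx := (@cplx F n).
Local Notation LS := (sublattice (mem (codom sigma))).
Local Notation Fs := (Fsp X rho sigma : ('I_r -> nat) -> set M1).
Implicit Types (k : 'I_r -> nat) (alpha beta delta lambda mu : 'rV[rat]_n) (u f : M1).
Implicit Types (l : seq ('I_r * nat)).
Hypothesis symG : symmetric_gram G.
Hypothesis coc : standard_cocycle G eps.

Lemma creator_bvec i p : creator (bvec i) (Negz p) = X (i, p) :> M1.
Proof. exact: Xc_bvec. Qed.

Lemma subspace_supported (D : set 'rV[rat]_n) : subspace (supported D : set V).
Proof.
split=> [b|u v Du Dv b|c v Dv b]; first by rewrite msupp0 inE.
  by move=> /(fsubsetP (msuppD_le _ _)); rewrite inE => /orP[/Du|/Dv].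
by move=> /(fsubsetP (msuppZ_le _ _)) /Dv.
Qed.

Lemma tens_supported (D : set 'rV[rat]_n) u beta : D beta -> supported D (tens u beta : V).
Proof.
move=> Db; apply: (lspan_lin (linear_tens beta) (subspace_supported D) _ (lspan_Xprod u)).
move=> _ [t ->]; rewrite XprodU tensU => b.
by rewrite msuppU oner_eq0 inE => /eqP ->.
Qed.

Lemma Usp_supported lambda : dual_lattice G lambda -> Usp rho sigma lambda `<=` VLdual (F := F) G.
Proof.
move=> dl; apply: (lspan_min (subspace_supported (dual_lattice G))).
move=> _ [k [delta [f [-> Ld _]]]].
apply: tens_supported.
by apply: dual_latticeD => //; apply/lattice_dual/lattice_pt/Ld.
Qed.

Lemma Fsp1 : Fs (fun=> 0%N) 1.
Proof. by apply: Salg_Fsp0; apply: Salg1. Qed.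

Lemma Usp_expv lambda delta : LS delta -> Usp rho sigma lambda (expv (lambda + delta) : V).
Proof. by move=> Ld; rewrite -[delta](pt0 rho); apply: Usp_mem Ld Fsp1. Qed.

Lemma sigma_LS j : LS (bvec (sigma j)).
Proof. by apply: sublattice_bvec; apply: codom_f. Qed.

Lemma generators_Usp : generators rho sigma `<=` (Usp rho sigma 0 : set V).
Proof.
move=> _ [[i ->]|[j [->|->|->]]].
- have -> : bvec (rho i) = 0 + pt rho (fun j => (i == j)%N : nat) 0.
    rewrite /pt !add0r (bigD1 i) //= eqxx scale1r big1 ?addr0 // => j /negPf.
    by rewrite eq_sym => ->; rewrite scale0r.
  apply: Usp_mem; first exact: sublattice0.
  (* The polynomial part 1 of e^rho_i is read as h_0(rho_i), which supplies the required count. *)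
  apply: mem_lspan; exists [::], [:: (i, 0%N)].
  by rewrite /Sx /Hp big_nil big_seq1 mul1r /hr hc0; split=> // j; rewrite /cnt /= addn0.
- by rewrite -[bvec _]add0r; apply/Usp_expv/sigma_LS.
- by rewrite -[- _]add0r; apply/Usp_expv/sublatticeN/sigma_LS.
- have FX : Fs (fun=> 0%N) (X (sigma j, 0%N)) by apply/Salg_Fsp0/Salg_X.
  have := Usp_mem 0 (sublattice0 (mem (codom sigma))) FX.
  by rewrite pt0 addr0 creator_bvec.
Qed.

Lemma WRS_Usp : WRS G eps rho sigma `<=` Usp rho sigma 0.
Proof.
apply: smallest_sub generators_Usp; split.
- exact: subspace_lspan.
- apply: (lspan_min (subspace_supported lattice)) => _ [k [delta [f [-> Ld _]]]].
  by apply: tens_supported; rewrite add0r; apply: lattice_pt Ld.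
- by have := Usp_expv 0 (sublattice0 (mem (codom sigma))); rewrite addr0.
- move=> u v m Uu Uv; apply: (@Usp_vmode F n G eps r s rho sigma symG) => //.
  exact: (lattice_dual G (sublattice0 predT)).
Qed.

Lemma WRSmod_Usp lambda : dual_lattice G lambda ->
  WRSmod G eps rho sigma lambda `<=` Usp rho sigma lambda.
Proof.
move=> dl; apply: smallest_sub.
  split; [exact: subspace_lspan | exact: Usp_supported |].
  by move=> u v m /WRS_Usp; apply: (@Usp_vmode F n G eps r s rho sigma symG).
by move=> _ ->; have := Usp_expv lambda (sublattice0 (mem (codom sigma))); rewrite addr0.
Qed.

Lemma WRS_gen v : generators rho sigma v -> WRS G eps rho sigma v.
Proof. exact: sub_gen_smallest. Qed.

Section Module.
Context (lambda : 'rV[rat]_n).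
Local Notation W := (WRSmod G eps rho sigma lambda).

Lemma WRSmod_ind v : (forall M, submodule G eps (WRS G eps rho sigma) M ->
  M (expv lambda) -> M v) -> W v.
Proof. by move=> Mv M [/= sM lM]; apply: Mv => //; apply: lM. Qed.

Lemma WRSmod_elim v M : submodule G eps (WRS G eps rho sigma) M ->
  M (expv lambda) -> W v -> M v.
Proof. by move=> sM lM; apply; split=> // _ ->. Qed.

Lemma subspace_WRSmod : subspace W.
Proof.
split=> [|u v Wu Wv|c v Wv]; apply: WRSmod_ind => M sM lM.
- by apply: subspace0; case: sM.
- by apply: subspaceD; [case: sM | apply: WRSmod_elim Wu | apply: WRSmod_elim Wv].
- by apply: subspaceZ; [case: sM | apply: WRSmod_elim Wv].
Qed.

Lemma WRSmod_lambda : W (expv lambda).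
Proof. exact: WRSmod_ind. Qed.

Lemma WRSmod_vmode v w m : generators rho sigma v -> W w -> W (vmode G eps v m w).
Proof.
move=> /WRS_gen gv Wv; apply: WRSmod_ind => M sM lM; case: (sM) => _ _; apply=> //.
exact: WRSmod_elim Wv.
Qed.

Lemma vmode_expv alpha m w : vmode G eps (expv alpha) m w = emode G eps alpha m w.
Proof.
have -> : expv alpha = tens << mone >> alpha :> V by [].
rewrite tensU [LHS]linextU /= (_ : factors mone = [::]) //.
by rewrite /factors mdom1 (size0nil (cardfs0 _)).
Qed.

(** The mode of index -1 - <alpha, beta> sends e^beta to eps alpha beta times e^(alpha + beta), and
    the cocycle is invertible there. *)
Lemma WRSmod_shift alpha beta : generators rho sigma (expv alpha : V) -> lattice alpha ->
  dual_lattice G beta -> W (expv beta) -> W (expv (alpha + beta)).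
Proof.
move=> ga La db Wb; have [N abN] := gform_int symG La db.
(* The vector 1 has weight 0, so the cutoff 1 suffices. *)
have uK : Wt X (1%N%:Z - 1) (1 : M1) by have := Wt_Xp X [::]; rewrite big_nil /wts big_nil.
have := emode_tens eps abN (- 1 - N) uK; rewrite (psi1 (@derivation_der F n) (@derX F n)).
rewrite big_ord1 (ep0 (@derivation_der F n)).
rewrite (_ : _ - 1 = 0) /= ?hc0 ?mulr1; last lia.
rewrite (linZ (linear_tens _)) -vmode_expv => e.
have e0 : eps alpha beta != 0 by case: coc => + _ _ _ _; apply.
rewrite -[expv _]scale1r -(mulVf e0) -scalerA -[eps _ _ *: _]e.
by apply: subspaceZ subspace_WRSmod _; apply: WRSmod_vmode.
Qed.

Hypothesis dl : dual_lattice G lambda.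

Lemma WRSmod_expv delta : LS delta -> W (expv (lambda + delta)).
Proof.
(* Quantifying over the starting point beta makes this property additive in delta, so only the
   vectors sigma_j and -sigma_j have to be checked. *)
pose Q delta := LS delta /\ forall beta, dual_lattice G beta -> W (expv beta) ->
   W (expv (delta + beta)).
suff QLS : LS delta -> Q delta.
  by move=> /QLS[_ Qd]; rewrite addrC; apply: Qd => //; apply: WRSmod_lambda.
have Q0 : Q 0 by split=> [|b _]; [apply: sublattice0 | rewrite add0r].
have QD d d' : Q d -> Q d' -> Q (d + d').
  move=> [Ld Qd] [Ld' Qd']; split=> [|b db Wb]; first exact: sublatticeD.
  rewrite -addrA; apply: Qd (Qd' _ db Wb).
  by apply: dual_latticeD => //; apply/lattice_dual/sublatticeS/Ld'.
have Qs j : Q (bvec (sigma j)).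
  split=> [|b db]; first exact: sigma_LS.
  apply: WRSmod_shift => //; last exact/sublatticeS/sigma_LS.
  by right; exists j; constructor 1.
have QNs j : Q (- bvec (sigma j)).
  have LN := sublatticeN (sigma_LS j).
  split=> [//|b db]; apply: WRSmod_shift => //; last exact: sublatticeS LN.
  by right; exists j; constructor 2.
clearbody Q.
have Qn d m : Q d -> Q (m%:R *: d).
  move=> Qd; elim: m => [|m IH]; first by rewrite scale0r.
  by rewrite -natr1 scalerDl scale1r; apply: QD.
move=> [c ->]; elim/big_ind: _ => // i /codomP[j ->].
case: (c _) => m; first exact: Qn.
by rewrite NegzE mulrNz scaleNr -scalerN; apply: Qn.
Qed.

Lemma emode0 m u beta : dual_lattice G beta ->
  emode G eps 0 m (tens u beta) = if m == -1 then tens u beta else 0.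
Proof.
move=> db; have eb : eps 0 beta = 1 by case: coc => _ + _ _ _; apply.
have b0 : gform G 0 beta = 0%:~R by rewrite gform0l.
have dP := @derivation_der F n; have dX := @derX F n.
have [B uB] := ex_Wt (@gen_X F n) u.
have uK : Wt X (B.+1%:Z - 1) u by apply: Wt_mono uB; lia.
have c0 : cplx 0 = 0 by apply/rowP => i; rewrite !mxE rmorph0.
have psi0 : psi X der G (cplx 0) 0 B.+1 1 u m = (m == -1)%:R *: u.
  rewrite c0; exact: (@psi_zero F n _ X der dP dX (@gen_X F n)).
rewrite (emode_tens eps b0 m uK) eb scale1r add0r psi0 (linZ (linear_tens _)).
by case: eqP; rewrite ?scale1r ?scale0r.
Qed.

Lemma factors_ucm (x : fockvar n) : factors (ucm x) = [:: x].
Proof.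
rewrite /factors mdomU (_ : enum_fset [fset x]%fset = [:: x]) /= ?cmUU //.
by apply/perm_small_eq/uniq_perm; rewrite ?fset_uniq // => y; rewrite !inE.
Qed.

(** As Y(e^0, x) = 1, a negative mode of b_i (x) t^(-1) keeps just one term of the normally ordered
    product, the one that creates b_i (x) t^(-p-1). *)
Lemma vmode_creator i p u beta : dual_lattice G beta ->
  vmode G eps (tens (creator (bvec i) (-1)) 0) (Negz p) (tens u beta) =
  tens (X (i, p) * u) beta.
Proof.
move=> db; have lt := linear_tens beta.
rewrite creator_bvec [X (i, 0%N)]/(X _) tensU [LHS]linextU.
rewrite [(_, _).1]/= [(_, _).2]/= factors_ucm mode_seq_cons.
have nilE m w : mode_seq G eps [::] 0 m w = emode G eps 0 m w by [].
rewrite [X in _ + X]fsbig1 ?addr0 => [|q _]; last first.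
  rewrite heis_nneg nilE emode0 // ifF ?scaler0 //.
  by apply/negbTE/eqP; lia.
have m0 q : q != p -> emode G eps 0 (Negz p + q%:Z - 0%:Z) (tens u beta) = 0.
  by move=> qp; rewrite emode0 // ifF //; apply/negbTE/eqP; move/eqP: qp; lia.
rewrite (@fsum_nat _ _ _ p.+1) => [|q pq]; last first.
  by rewrite nilE m0 ?(lin0 (linear_heis _ _ _)) ?scaler0 // neq_ltn pq orbT.
rewrite big_ord_recr big1 ?add0r => [|q _]; last first.
  by rewrite nilE m0 ?(lin0 (linear_heis _ _ _)) ?scaler0 //; apply/eqP; have /= := ltn_ord q; lia.
rewrite bin0 scale1r nilE emode0 // ifT; last by apply/eqP; rewrite /=; lia.
by rewrite heis_neg Xc_bvec; apply: add0r.
Qed.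

Lemma WRSmod_X j p u beta : dual_lattice G beta -> W (tens u beta) ->
  W (tens (X (sigma j, p) * u) beta).
Proof.
move=> db Wu; rewrite -vmode_creator //; apply: WRSmod_vmode Wu.
by right; exists j; constructor 3.
Qed.

Lemma WRSmod_Sx t u beta : dual_lattice G beta -> W (tens u beta) ->
  W (tens (Sx X sigma t * u) beta).
Proof.
move=> db Wu; elim: t => [|x t IH]; first by rewrite /Sx big_nil mul1r.
by rewrite /Sx big_cons -mulrA; apply: WRSmod_X.
Qed.

End Module.
End LowerBound.

(** * The vectors of [Rbasis] indexed by sorted lists *)

Section Bases.
Context {F : numFieldType} {n : nat} (G : 'M[int]_n).
Context (eps : 'rV[rat]_n -> 'rV[rat]_n -> F).
Context {r : nat} (rho : 'I_r -> 'I_n).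
Local Notation M1 := {malg F[{cmonom fockvar n}]}.
Local Notation monom := ({cmonom fockvar n} * 'rV[rat]_n)%type.
Local Notation V := {malg F[monom]}.
Local Notation X := (@X F n).
Local Notation der := (@der F n).
Local Notation cplx := (@cplx F n).
Implicit Types (k : 'I_r -> nat) (i : 'I_r) (l : seq ('I_r * nat)) (d : seq nat).
Hypothesis symG : symmetric_gram G.
Hypothesis coc : standard_cocycle G eps.
Context (mu : 'rV[rat]_n).
Hypothesis dmu : dual_lattice G mu.

Definition wl l : 'rV[rat]_n := \sum_(x <- l) bvec (rho x.1).

Lemma wl_cons x l : wl (x :: l) = bvec (rho x.1) + wl l.
Proof. exact: big_cons. Qed.

Lemma lattice_bvec (i : 'I_n) : lattice (bvec i).
Proof. exact: sublattice_bvec. Qed.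

Lemma dual_wl l : dual_lattice G (wl l + mu).
Proof.
apply: dual_latticeD => //; apply: lattice_dual.
by apply: sublattice_sum => x; apply: lattice_bvec.
Qed.

(** The cocycle value picked up when e^rho_i acts after the modes recorded in l. *)
Definition ev i l : F := eps (bvec (rho i)) (wl l + mu).

Lemma ev_neq0 i l : ev i l != 0.
Proof. by case: coc => + _ _ _ _; apply; [apply: lattice_bvec | apply: dual_wl]. Qed.

Definition Rv l : V := tens (qp X der G rho ev l) (wl l + mu).

(* [numq] extracts the integer <rho_i, wt l + mu> from its rational value. *)
Definition Nz i l : int := numq (gform G (bvec (rho i)) (wl l + mu)).

Lemma NzE i l : gform G (bvec (rho i)) (wl l + mu) = (Nz i l)%:~R.
Proof.
have [N NE] := gform_int symG (lattice_bvec (rho i)) (dual_wl l).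
by rewrite /Nz NE numq_int.
Qed.

Lemma cplx_bvec (i : 'I_n) : cplx (bvec i) = bvec i.
Proof. by apply/rowP => j; rewrite !mxE rmorph_nat. Qed.

Lemma emode_Rv i x l :
  emode G eps (bvec (rho i)) (- x%:Z - 1 - Nz i l) (Rv l) = Rv ((i, x) :: l).
Proof.
have [B uB] := ex_Wt (@gen_X F n) (qp X der G rho ev l).
pose K := (maxn B (tot l)).+1.
have uK : Wt X (K%:Z - 1) (qp X der G rho ev l) by apply: Wt_mono uB; rewrite /K; lia.
have lK : (tot l < K)%N by rewrite /K; lia.
rewrite /Rv (emode_tens eps (NzE i l) _ uK) cplx_bvec wl_cons -(addrA (bvec (rho i))).
exact: (congr1 (fun z : M1 => tens z (bvec (rho i) + (wl l + mu)))
  (@qp_psi F n _ X der (@derivation_der F n) (@derX F n) (@gen_X F n) G r rho ev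
     K (i, x) l (Nz i l) lK)).
Qed.

Lemma Rv_nil : Rv [::] = expv mu.
Proof. by rewrite /Rv /wl big_nil add0r. Qed.

Definition grp i d : seq ('I_r * nat) := [seq (i, x) | x <- d].

(** Passage from degrees of leading factors to mode numbers; each entry depends on the modes already
    applied, through the lattice point they lead to. *)
Fixpoint modes i l d : seq int :=
  if d is x :: d' then (- x%:Z - 1 - Nz i (grp i d' ++ l)) :: modes i l d' else [::].

Lemma epsmon_Rv i l d : epsmon G eps (bvec (rho i)) (modes i l d) (Rv l) = Rv (grp i d ++ l).
Proof.
elim: d => [|x d IH]; first by [].
exact: etrans (congr1 (emode G eps _ _) IH) (emode_Rv i x (grp i d ++ l)).
Qed.

Lemma size_modes i l d : size (modes i l d) = size d.
Proof. by elim: d => //= x d ->. Qed.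

Lemma Nz_grp i l d : Nz i (grp i d ++ l) = Nz i l + (size d)%:Z * G (rho i) (rho i).
Proof.
elim: d => [|x d IH] /=; first by rewrite mul0r addr0.
have h : gform G (bvec (rho i)) (bvec (rho i) + (wl (grp i d ++ l) + mu)) =
    (G (rho i) (rho i) + Nz i (grp i d ++ l))%:~R.
  by rewrite gformDr gform_bvec NzE intrD.
rewrite {1}/Nz wl_cons -addrA h numq_int IH; lia.
Qed.

Lemma nth_modes i l d j : (j < size d)%N ->
  nth 0 (rev (modes i l d)) j =
  - (nth 0%N (rev d) j)%:Z - 1 - Nz i l - j%:Z * G (rho i) (rho i).
Proof.
elim: d => //= x d IH jd; rewrite !rev_cons !nth_rcons !size_rev size_modes.
have [jd'|dj] := ltnP j (size d); first exact: IH.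
have -> : j = size d by lia.
by rewrite eqxx Nz_grp; lia.
Qed.

Lemma modes_of i l (nu : seq int) :
  (forall j, (j < size nu)%N ->
    0 <= - nth 0 (rev nu) j - 1 - Nz i l - j%:Z * G (rho i) (rho i)) ->
  exists2 d, nu = modes i l d & forall j, (j < size nu)%N -> (nth 0%N (rev d) j)%:Z =
    - nth 0 (rev nu) j - 1 - Nz i l - j%:Z * G (rho i) (rho i).
Proof.
move=> nu0; pose f j := - nth 0 (rev nu) j - 1 - Nz i l - j%:Z * G (rho i) (rho i).
have fE j : (j < size nu)%N -> (absz (f j))%:Z = f j by move=> /nu0 fj; rewrite gez0_abs.
exists (rev (mkseq (fun j => absz (f j)) (size nu))).
  apply: (can_inj revK); apply: (@eq_from_nth _ 0).
    by rewrite !size_rev size_modes size_rev size_mkseq.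
  move=> j; rewrite size_rev => jn.
  by rewrite nth_modes ?size_rev ?size_mkseq // revK nth_mkseq // fE // /f; lia.
by move=> j jn; rewrite revK nth_mkseq // fE.
Qed.

Lemma wl_cnt l : wl l = \sum_i (cnt l i)%:R *: bvec (rho i).
Proof.
under eq_bigr => i _ do rewrite /cnt -sum1_count natr_sum scaler_suml big_mkcond.
rewrite exchange_big /=; apply: eq_bigr => x _.
rewrite (bigD1 x.1) //= eqxx scale1r big1 ?addr0 // => i /negPf.
by rewrite eq_sym => ->.
Qed.

(** Multiplicities at the stage where only the first p groups of modes have been applied. *)
Definition below k (p : nat) i : nat := if (i < p)%N then k i else 0%N.

Lemma Nz_below k i l : cnt l =1 below k i ->
  \sum_(j < r | (j < i)%N) (k j)%:R * gform G (bvec (rho i)) (bvec (rho j))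
    + gform G (bvec (rho i)) mu = (Nz i l)%:~R :> rat.
Proof.
move=> lk; rewrite -NzE gformDr; congr (_ + _); rewrite wl_cnt gform_sumr big_mkcond.
apply: eq_bigr => j _; rewrite lk /below gformZr; case: ifP => // _.
by rewrite mul0r.
Qed.

(** The gap <rho_i, rho_i> between successive modes cancels the change of lattice point, so only
    monotonicity of the degrees remains. As d starts with the mode applied last, it is
    nonincreasing. *)
Lemma MsetE k i l (nu : seq int) : cnt l =1 below k i ->
  Mset G rho mu k i nu <-> exists d, [/\ nu = modes i l d, sorted geq d & size d = k i].
Proof.
move=> lk; have g1 : gform G (bvec (rho i)) (bvec (rho i)) = (G (rho i) (rho i))%:~R :> rat.
  exact: gform_bvec.
rewrite /Mset /= g1 -[X in _ -> _ <= X](_ : (- 1 - Nz i l)%:~R = _); last first.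
  by rewrite intrD mulrNz -(Nz_below lk) opprD addrA.
pose a j := nth 0 (rev nu) j.
split=> [[snu h1 hS]|[d [-> sd dk]]].
  have a0 : (0 < k i)%N -> a 0%N <= - 1 - Nz i l.
    by move=> /h1; rewrite /entry ler_int.
  have aS j : (j.+1 < k i)%N -> a j.+1 <= a j - G (rho i) (rho i).
    move=> jk; have jk' : (1 <= j.+1 <= k i - 1)%N by lia.
    by have := hS _ jk'; rewrite /entry /= -intrB ler_int.
  have [|d nuE dE] := @modes_of i l nu.
    elim=> [|j IH]; rewrite snu => jk.
      by have := a0 jk; rewrite /a; lia.
    have := IH; rewrite snu => /(_ (ltnW jk)); have := aS _ jk; rewrite /a; lia.
  have sd : size d = k i by rewrite -snu nuE size_modes.
  exists d; split=> //; rewrite -[d]revK rev_sorted.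
  apply/(sortedP 0%N) => j; rewrite size_rev sd => jk.
  rewrite /geq /= -lez_nat !dE ?snu // ?(ltnW jk) //.
  by have := aS _ jk; rewrite /a; lia.
have sdr j : (j.+1 < k i)%N -> (nth 0%N (rev d) j <= nth 0%N (rev d) j.+1)%N.
  move=> jk; move: sd; rewrite -{1}[d]revK rev_sorted => /(sortedP 0%N); apply.
  by rewrite size_rev dk.
split; first by rewrite size_modes.
- move=> k0; rewrite /entry ler_int nth_modes ?dk //=; lia.
- move=> [|j] // jk; rewrite /entry /= -intrB ler_int.
  by rewrite !nth_modes ?dk; [have := sdr j; lia | lia | lia].
Qed.

Lemma sorted_grp i d l : sorted geq d -> sorted lexge l -> (forall x, x \in l -> (x.1 < i)%N) ->
  sorted lexge (grp i d ++ l).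
Proof.
move=> sd sl li; elim: d sd => //= x d IH sd.
have := IH (path_sorted sd); rewrite (path_sortedE (@lexge_trans r)) => ->; rewrite andbT.
apply/allP => y; rewrite mem_cat => /orP[/mapP[z zd ->]|/li yi]; last by rewrite /lexge yi.
rewrite /lexge /= eqxx /=; apply/orP; right.
by have /allP := order_path_min (rev_trans leq_trans) sd; apply.
Qed.

Lemma split_grp i l : sorted lexge l -> (forall x, x \in l -> (x.1 <= i)%N) ->
  exists d l', [/\ l = grp i d ++ l', sorted geq d, sorted lexge l' &
    forall x, x \in l' -> (x.1 < i)%N].
Proof.
elim: l => [|x l IH] sl li; first by exists [::], [::].
have li' y : y \in l -> (y.1 <= i)%N by move=> yl; apply: li; rewrite inE yl orbT.
have lx := order_path_min (@lexge_trans r) sl.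
have [xi|xi] := eqVneq x.1 i; last first.
  exists [::], (x :: l); split=> // y; rewrite inE => /orP[/eqP ->|yl].
    by have := li x; rewrite inE eqxx => /(_ isT); move: xi; rewrite -val_eqE /=; lia.
  have := allP lx _ yl; have := li x; rewrite inE eqxx => /(_ isT).
  by move: xi; rewrite /lexge -!val_eqE /=; lia.
have [d [l' [lE sd sl' l'i]]] := IH (path_sorted sl) li'.
exists (x.2 :: d), l'; split=> //; first by rewrite lE /= -xi -surjective_pairing.
rewrite /= (path_sortedE (rev_trans leq_trans)) sd andbT; apply/allP => y yd.
have := allP lx (i, y); rewrite lE mem_cat map_f // => /(_ isT).
by rewrite /lexge xi /= ltnn eqxx.
Qed.

Lemma cnt_cat l l' i : cnt (l ++ l') i = (cnt l i + cnt l' i)%N.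
Proof. exact: count_cat. Qed.

Lemma cnt_grp i d j : cnt (grp i d) j = ((i == j) * size d)%N.
Proof. by rewrite /cnt count_map; elim: d => [|x d IH] /=; rewrite ?muln0 // IH; lia. Qed.

Lemma cnt_eq0 l i : cnt l i = 0%N -> forall x, x \in l -> x.1 != i.
Proof. by move=> /eqP; rewrite /cnt -leqn0 leqNgt -has_count => /hasPn. Qed.

Local Notation fold nu p := (foldl (fun w i => epsmon G eps (bvec (rho i)) (nu i) w)
  (expv mu : V) (take p (enum 'I_r))).

Lemma take_enumS p (pr : (p < r)%N) :
  take p.+1 (enum 'I_r) = rcons (take p (enum 'I_r)) (Ordinal pr).
Proof.
rewrite (take_nth (Ordinal pr)) ?size_enum_ord //; congr rcons.
by apply: val_inj; rewrite /= nth_enum_ord.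
Qed.

Lemma fold_Rv k (nu : 'I_r -> seq int) p : (p <= r)%N ->
  (forall i, (i < p)%N -> Mset G rho mu k i (nu i)) ->
  exists l, [/\ sorted lexge l, cnt l =1 below k p & fold nu p = Rv l].
Proof.
elim: p => [_ _|p IH pr Mnu].
  by exists [::]; split=> //; rewrite take0 /= Rv_nil.
have [|l [sl lk lE]] := IH (ltnW pr); first by move=> i ip; apply: Mnu; lia.
have lk' : cnt l =1 below k (Ordinal pr) := lk.
have /(MsetE _ lk')[d [nuE sd dk]] := Mnu (Ordinal pr) (ltnSn p).
exists (grp (Ordinal pr) d ++ l); split.
- apply: sorted_grp => // x xl; rewrite /= ltnNge; apply/negP => px.
  have := lk x.1; rewrite /below ltnNge px /= => /cnt_eq0 /(_ _ xl).
  by rewrite eqxx.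
- move=> i; rewrite cnt_cat cnt_grp lk /below dk -val_eqE /=.
  rewrite eq_sym ltnS (leq_eqVlt i p); case: eqP => [ip|_] /=; last by rewrite mul0n add0n.
  have -> : Ordinal pr = i by apply: val_inj.
  by rewrite mul1n ip ltnn addn0.
- rewrite (take_enumS pr) foldl_rcons lE nuE; exact: epsmon_Rv.
Qed.

Lemma eq_fold (nu nu' : 'I_r -> seq int) (e : seq 'I_r) (w : V) : {in e, nu =1 nu'} ->
  foldl (fun w i => epsmon G eps (bvec (rho i)) (nu i) w) w e =
  foldl (fun w i => epsmon G eps (bvec (rho i)) (nu' i) w) w e.
Proof.
elim: e w => //= i e IH w nue; rewrite nue ?inE ?eqxx // IH // => j je.
by apply: nue; rewrite inE je orbT.
Qed.

Lemma mem_take_enum p i : (p <= r)%N -> i \in take p (enum 'I_r) -> (i < p)%N.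
Proof.
move=> pr /(map_f val); rewrite map_take val_enum_ord take_iota (minn_idPl pr).
by rewrite mem_iota.
Qed.

(** In a sorted list the entries with the largest group index form a prefix; they are split off as
    the modes applied last. *)
Lemma Rv_fold k l p : (p <= r)%N -> sorted lexge l -> cnt l =1 below k p ->
  exists2 nu, forall i, (i < p)%N -> Mset G rho mu k i (nu i) & fold nu p = Rv l.
Proof.
elim: p l => [|p IH] l pr sl lk.
  exists (fun=> [::]) => //; rewrite take0 /= -Rv_nil.
  by congr Rv; apply/esym/size0nil; rewrite size_cnt big1.
pose i := Ordinal pr.
have li x : x \in l -> (x.1 <= i)%N.
  move=> xl; rewrite leqNgt; apply/negP => ix.
  have := lk x.1; rewrite /below ltnNge ix /= => /cnt_eq0 /(_ _ xl).
  by rewrite eqxx.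
have [d [l' [lE sd sl' l'i]]] := split_grp sl li.
have l'0 (j : 'I_r) : (i <= j)%N -> cnt l' j = 0%N.
  move=> ij; apply/eqP; rewrite /cnt -leqn0 leqNgt -has_count; apply/hasPn => x /l'i xi.
  by rewrite -val_eqE /=; move: xi ij => /=; lia.
have lk2 j : ((i == j) * size d + cnt l' j)%N = below k p.+1 j.
  by rewrite -lk lE cnt_cat cnt_grp.
have dk : size d = k i.
  by have := lk2 i; rewrite eqxx mul1n l'0 // addn0 /below /= ltnSn.
have l'k : cnt l' =1 below k p.
  move=> j; have [<-|ij] := eqVneq i j; first by rewrite l'0 // /below /= ltnn.
  have := lk2 j; rewrite (negPf ij) mul0n add0n => ->; rewrite /below ltnS (leq_eqVlt j p).
  by rewrite (_ : (nat_of_ord j == p) = false) //; apply/negbTE; rewrite eq_sym.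
have [nu Mnu nuE] := IH l' (ltnW pr) sl' l'k.
exists (fun j => if j == i then modes i l' d else nu j).
  move=> j; rewrite ltnS leq_eqVlt => /orP[jp|jp].
    have -> : j = i by apply: val_inj; apply/eqP.
    by rewrite eqxx; apply/(@MsetE k i l') => //; exists d.
  by rewrite ifF; [apply: Mnu | apply/negbTE; rewrite -val_eqE /=; lia].
rewrite (take_enumS pr) foldl_rcons -/i eqxx (@eq_fold _ nu) => [|j /mem_take_enum ji].
  by rewrite nuE lE; apply: epsmon_Rv.
by rewrite ifF //; apply/negbTE; rewrite -val_eqE /=; have := ji (ltnW pr); lia.
Qed.

Lemma RbasisE k : Rbasis G eps rho mu k =
  [set v | exists l, [/\ v = Rv l, sorted lexge l & cnt l =1 k]].
Proof.
have tr : take r (enum 'I_r) = enum 'I_r by rewrite take_oversize // size_enum_ord.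
have br : below k r =1 k by move=> i; rewrite /below ltn_ord.
apply/seteqP; split=> [_ [nu [Mnu ->]]|_ [l [-> sl lk]]].
  have [l [sl lk lE]] := @fold_Rv k nu r (leqnn r) (fun i _ => Mnu i).
  by exists l; split=> [||i]; rewrite -?lE ?tr // lk br.
have lk' : cnt l =1 below k r by move=> i; rewrite br.
have [nu Mnu nuE] := Rv_fold (leqnn r) sl lk'.
by exists nu; split=> [i|]; [apply: Mnu | rewrite -nuE tr].
Qed.

End Bases.

Section SBasis.
Context {F : numFieldType} {n s : nat} (sigma : 'I_s -> 'I_n).
Local Notation M1 := {malg F[{cmonom fockvar n}]}.
Local Notation X := (@X F n).
Local Notation Sx := (Sx X sigma).

Lemma Sx_partition (t : seq ('I_s * nat)) :
  Sx t = \prod_(j < s) \prod_(x <- t | x.1 == j) X (sigma j, x.2).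
Proof.
rewrite (exchange_big_dep xpredT) //=; apply: eq_bigr => x _.
by rewrite (big_pred1 x.1).
Qed.

Lemma prod_creator (j : 'I_s) (I : seq int) : (forall z, z \in I -> z <= -1) ->
  \prod_(z <- I) creator (bvec (sigma j)) z = \prod_(z <- I) X (sigma j, (absz z).-1) :> M1.
Proof.
move=> I0; rewrite big_seq [RHS]big_seq; apply: eq_bigr => z /I0.
by case: z => // p _; rewrite creator_bvec.
Qed.

(** Ordering the exponents only selects a representative of each monomial, since the variables
    commute. *)
Lemma SbasisE : Sbasis sigma = [set v : M1 | exists t, v = Sx t].
Proof.
apply/seteqP; split=> [_ [I [I0 ->]]|_ [t ->]].
  exists (flatten [seq [seq (j, (absz z).-1) | z <- I j] | j <- enum 'I_s]).
  rewrite /Sx big_flatten big_map big_enum; apply: eq_bigr => j _.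
  by rewrite big_map prod_creator //; case: (I0 j).
exists (fun j => sort <=%R [seq Negz x.2 | x <- t & x.1 == j]); split=> [j|].
  split; first exact: sort_sorted le_total _.
  by move=> z; rewrite mem_sort => /mapP[x _ ->].
rewrite Sx_partition; apply: eq_bigr => j _.
rewrite prod_creator; last by move=> z; rewrite mem_sort => /mapP[x _ ->].
by rewrite (perm_big _ (permEl (perm_sort _ _))) big_map big_filter.
Qed.

End SBasis.

Lemma coef_linear {F : fieldType} {I : choiceType} (b : I) :
  linear (fun v : {malg F[I]} => v@_b : F^o).
Proof. by move=> a u v; rewrite mcoeffD mcoeffZ. Qed.

(** * Independence *)

Section DegreeFiltration.
Context {F : numFieldType} {n : nat} {A : comAlgType F}.
Context (X : 'I_n * nat -> A) {r : nat} (rho : 'I_r -> 'I_n).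
Implicit Types (u v : A) (y : seq ('I_n * nat)) (l : seq ('I_r * nat)).
Local Notation Xp y := (\prod_(x <- y) X x).

(** This is polynomial degree, not weight: all terms of h_d have weight d, and it is the degree that
    singles out the linear one. *)
Definition Dge (N : nat) : set A :=
  lspan [set v | exists y, v = Xp y /\ (N <= size y)%N].

Lemma Dge_mem N y : (N <= size y)%N -> Dge N (Xp y).
Proof. by move=> Ny; apply: mem_lspan; exists y. Qed.

Lemma Dge_mono N N' : (N <= N')%N -> Dge N' `<=` Dge N.
Proof.
by move=> NN; apply: lspanS => _ [y [-> yN]]; exists y; split=> //; apply: leq_trans yN.
Qed.

Lemma Dge_mul N N' u v : Dge N u -> Dge N' v -> Dge (N + N') (u * v).
Proof.
apply: lspan_mul (subspace_lspan _) _ => _ _ [y [-> yN]] [y' [-> yN']].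
apply: mem_lspan; exists (y ++ y'); rewrite big_cat size_cat; split=> //.
exact: leq_add.
Qed.

Lemma Dge_X x : Dge 1 (X x).
Proof. by have := @Dge_mem 1 [:: x]; rewrite big_seq1; apply. Qed.

Lemma hc_Dge1 (i : 'I_n) d : Dge 1 (hc X (bvec i) d.+1).
Proof.
have -> : hc X (bvec i) d.+1 = d.+1%:R^-1 *: (d.+1%:R *: hc X (bvec i) d.+1).
  by rewrite scalerA mulVf ?scale1r // pnatr_eq0.
rewrite hc_rec; apply: subspaceZ (subspace_lspan _) _.
apply: subspace_sum (subspace_lspan _) _ => j _; rewrite Xc_bvecA.
apply: (@Dge_mono 1 (1 + 0)) => //; apply: Dge_mul; first exact: Dge_X.
elim/ltn_ind: (d.+1 - j.+1)%N => -[|e] IH.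
  by rewrite hc0; have := @Dge_mem 0 [::]; rewrite big_nil; apply.
have -> : hc X (bvec i) e.+1 = e.+1%:R^-1 *: (e.+1%:R *: hc X (bvec i) e.+1).
  by rewrite scalerA mulVf ?scale1r // pnatr_eq0.
rewrite hc_rec; apply: subspaceZ (subspace_lspan _) _.
apply: subspace_sum (subspace_lspan _) _ => j' _; rewrite Xc_bvecA.
apply: (@Dge_mono 0 (1 + 0)) => //; apply: Dge_mul; first exact: Dge_X.
by apply: IH; have := ltn_ord j'; lia.
Qed.

Lemma hc_leading (i : 'I_n) d :
  Dge 2 (hc X (bvec i) d.+1 - d.+1%:R^-1 *: X (i, d)).
Proof.
have -> : hc X (bvec i) d.+1 = d.+1%:R^-1 *: (d.+1%:R *: hc X (bvec i) d.+1).
  by rewrite scalerA mulVf ?scale1r // pnatr_eq0.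
rewrite -scalerBr hc_rec; apply: subspaceZ (subspace_lspan _) _.
rewrite big_ord_recr /= subnn hc0 mulr1 Xc_bvecA addrK.
apply: subspace_sum (subspace_lspan _) _ => j _; rewrite Xc_bvecA.
apply: (@Dge_mul 1 1); first exact: Dge_X.
have jd := ltn_ord j; rewrite (_ : (d.+1 - j.+1)%N = (d - j.+1).+1); last lia.
exact: hc_Dge1.
Qed.

(** Entries of degree 0 disappear because h_0 = 1. The shift by one comes from X (i, d) standing for
    t^(-d-1). *)
Definition lead l : seq ('I_n * nat) := [seq (rho x.1, x.2.-1) | x <- l & (0 < x.2)%N].

Lemma Hp_lead l : exists2 c : F, c != 0 &
  Dge (size (lead l)).+1 (Hp X rho l - c *: Xp (lead l)).
Proof.
elim: l => [|[i [|d]] l [c c0 IH]].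
- exists 1; first exact: oner_neq0.
  rewrite scale1r /lead /Hp !big_nil subrr; exact: subspace0 (subspace_lspan _).
- by exists c; rewrite // Hp_cons /hr hc0 mul1r.
exists (d.+1%:R^-1 * c); first by rewrite mulf_neq0 // invr_eq0 pnatr_eq0.
have -> : lead ((i, d.+1) :: l) = (rho i, d) :: lead l by [].
rewrite Hp_cons big_cons /hr /=.
(* The pattern is ab - a'b' = (a - a') b' + a (b - b'). *)
have -> : hc X (bvec (rho i)) d.+1 * Hp X rho l - (d.+1%:R^-1 * c) *: (X (rho i, d) * Xp (lead l))
  = (hc X (bvec (rho i)) d.+1 - d.+1%:R^-1 *: X (rho i, d)) * (c *: Xp (lead l))
    + hc X (bvec (rho i)) d.+1 * (Hp X rho l - c *: Xp (lead l)).
  by rewrite mulrBl mulrBr [RHS]addrC subrKA -(scalerAl d.+1%:R^-1) -(scalerAr c (X _)) scalerA.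
apply: subspaceD (subspace_lspan _) _ _.
  rewrite -add2n; apply: Dge_mul; first exact: hc_leading.
  by apply: subspaceZ (subspace_lspan _) _; apply: Dge_mem.
rewrite -add1n; apply: Dge_mul IH; exact: hc_Dge1.
Qed.

Context {s : nat} (sigma : 'I_s -> 'I_n).

Definition ylead (j : seq ('I_s * nat) * seq ('I_r * nat)) : seq ('I_n * nat) :=
  [seq (sigma x.1, x.2) | x <- j.1] ++ lead j.2.

Lemma Sx_Hp_lead j : exists2 c : F, c != 0 &
  Dge (size (ylead j)).+1 (Sx X sigma j.1 * Hp X rho j.2 - c *: Xp (ylead j)).
Proof.
have [c c0 lc] := Hp_lead j.2; exists c => //.
have -> : Xp (ylead j) = Sx X sigma j.1 * Xp (lead j.2).
  by rewrite big_cat /= big_map.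
rewrite scalerAr -mulrBr /ylead size_cat -addnS; apply: Dge_mul lc.
rewrite size_map /Sx -(big_map (fun x => (sigma x.1, x.2)) xpredT X).
by apply: Dge_mem; rewrite size_map.
Qed.

End DegreeFiltration.

Section Independence.
Context {F : numFieldType} {n : nat} {r s : nat}.
Context (rho : 'I_r -> 'I_n) (sigma : 'I_s -> 'I_n).
Hypothesis inj_rho : injective rho.
Hypothesis inj_sigma : injective sigma.
Hypothesis rho_sigma : forall i j, rho i != sigma j.
Local Notation M1 := {malg F[{cmonom fockvar n}]}.
Local Notation X := (@X F n).
Local Notation Hp := (Hp X rho).
Local Notation Sx := (Sx X sigma).
Local Notation ylead := (ylead rho sigma).
Local Notation idx := (seq ('I_s * nat) * seq ('I_r * nat))%type.
Implicit Types (t : seq ('I_s * nat)) (l : seq ('I_r * nat)) (j : idx).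
Implicit Types (k : 'I_r -> nat).

Definition cmon (y : seq (fockvar n)) : {cmonom fockvar n} :=
  \big[mmul/mone]_(x <- y) ucm x.

Lemma perm_cmon (y y' : seq (fockvar n)) : cmon y = cmon y' -> perm_eq y y'.
Proof. by move=> yy; apply/allP => x _; rewrite /= -!big_ucm -!/(cmon _) yy. Qed.

Lemma coef_Xprod (y y' : seq (fockvar n)) :
  (Xprod y' : M1)@_(cmon y) = (cmon y' == cmon y)%:R.
Proof. by rewrite XprodU; exact: (@mcoeffU1 {cmonom fockvar n} F (cmon y') (cmon y)). Qed.

Lemma coef_Dge (y : seq (fockvar n)) N (v : M1) : (size y < N)%N -> Dge X N v ->
  v@_(cmon y) = 0.
Proof.
move=> yN; pose f := fun v : M1 => v@_(cmon y) : F^o.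
have lf : linear f := coef_linear (cmon y).
have sW : subspace [set w : M1 | f w = 0].
  split=> [|u w /= u0 w0|c w /= w0]; first exact: lin0 lf.
    by rewrite (linD lf) u0 w0 addr0.
  by rewrite (linZ lf) w0 scaler0.
apply: (lspan_min sW) => _ [y' [-> yN']].
apply: etrans (coef_Xprod _ _) _.
case: eqP => // /perm_cmon /perm_size yy.
by have := leq_trans yN yN'; rewrite -[X in (_ < X)%N]/(size y') [X in (_ < X)%N]yy ltnn.
Qed.

Definition sorted_idx k j : Prop :=
  [/\ sorted lexge j.1, sorted lexge j.2 & cnt j.2 =1 k].

Lemma count_S t l (x : 'I_s * nat) :
  count_mem (sigma x.1, x.2) (ylead (t, l)) = count_mem x t.
Proof.
rewrite /ylead /lead count_cat !count_map count_filter.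
have -> : count (preim (fun x0 => (sigma x0.1, x0.2)) (pred1 (sigma x.1, x.2))) t =
    count_mem x t.
  by apply: eq_count => y /=; rewrite xpair_eqE (inj_eq inj_sigma) -pair_eqE.
rewrite -[RHS]addn0; congr (_ + _)%N; rewrite (@eq_count _ _ pred0) ?count_pred0 // => y /=.
by rewrite xpair_eqE (negPf (rho_sigma _ _)).
Qed.

Lemma count_R t l (i : 'I_r) d :
  count_mem (rho i, d) (ylead (t, l)) = count_mem (i, d.+1) l.
Proof.
rewrite /ylead /lead count_cat !count_map count_filter.
have -> : count (preim (fun x0 => (sigma x0.1, x0.2)) (pred1 (rho i, d))) t = 0%N.
  rewrite (@eq_count _ _ pred0) ?count_pred0 // => y /=.
  by rewrite xpair_eqE eq_sym (negPf (rho_sigma _ _)).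
apply: eq_count => -[i' [|d']] /=; first by rewrite andbF xpair_eqE andbF.
by rewrite !xpair_eqE (inj_eq inj_rho) andbT eqSS.
Qed.

(** Entries of degree 0 are invisible in the leading monomial; fixing the counts recovers their
    number. *)
Lemma perm_cnt_pos l l' :
  (forall i d, count_mem (i, d.+1) l = count_mem (i, d.+1) l') -> cnt l =1 cnt l' ->
  perm_eq l l'.
Proof.
move=> cl lk; apply/allP => -[i [|d]] _ /=; last by rewrite cl.
pose pos := [pred x : 'I_r * nat | (0 < x.2)%N].
have split0 (m : seq ('I_r * nat)) : cnt m i = (cnt (filter pos m) i + count_mem (i, 0%N) m)%N.
  elim: m => //= -[i' d'] m IH; rewrite /cnt /= in IH *; rewrite IH.
  by case: d' => [|d'] /=; rewrite !xpair_eqE ?andbT ?andbF; lia.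
have pf : perm_eq (filter pos l) (filter pos l').
  apply/allP => -[i' [|d']] _ /=; rewrite !count_filter.
    by rewrite !(eq_count (a2 := pred0)) ?count_pred0 // => -[i'' [|d'']];
      rewrite /= ?andbF // xpair_eqE andbF.
  rewrite !(eq_count (a2 := pred1 (i', d'.+1))) ?cl // => -[i'' [|d'']];
    by rewrite /= ?andbT // ?xpair_eqE ?andbF.
have := split0 l; rewrite lk (perm_cnt pf) split0 => e.
by apply/eqP; apply/esym/(addnI e).
Qed.

Lemma ylead_inj k j j' : sorted_idx k j -> sorted_idx k j' -> perm_eq (ylead j) (ylead j') ->
  j = j'.
Proof.
case: j j' => [t l] [t' l'] [/= st sl lk] [/= st' sl' lk'] /permP pyy.
have eq_sorted q := @sorted_eq _ (@lexge q) (@lexge_trans q) (@lexge_anti q).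
congr pair; apply: eq_sorted => //.
  by apply/allP => x _ /=; rewrite -(count_S t l) -(count_S t' l') pyy.
apply: perm_cnt_pos => [i d|i]; last by rewrite lk lk'.
by rewrite -(count_R t l) -(count_R t' l') pyy.
Qed.

(** Working in the free module on the indices allows arguments on coefficients before the vectors
    are known to be distinct. *)
Definition evJ : {malg F[idx]} -> M1 := mext (fun j => Sx j.1 * Hp j.2).

(** Take an index of the support whose leading monomial has least degree. No other index contributes
    to the coefficient of that monomial, because [ylead] is injective for fixed k. *)
Lemma evJ_inj k (x : {malg F[idx]}) : (forall j, j \in msupp x -> sorted_idx k j) ->
  evJ x = 0 -> x = 0.
Proof.
move=> xk ev0; suff x0 : msupp x = fset0 by rewrite (malg_sum x) x0 big_seq_fset0.
apply/eqP/negPn/negP => /fset0Pn[j0 j0x].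
have exN : exists N, has (fun j => size (ylead j) == N) (msupp x).
  by exists (size (ylead j0)); apply/hasP; exists j0.
have [N /hasP[j jx /eqP jN] minN] := ex_minnP exN.
pose f := fun v : M1 => v@_(cmon (ylead j)) : F^o.
have lf : linear f := coef_linear (cmon (ylead j)).
have fE j' : (size (ylead j) <= size (ylead j'))%N -> exists2 c, c != 0 &
    f (Sx j'.1 * Hp j'.2) = c * (cmon (ylead j') == cmon (ylead j))%:R.
  move=> jj'; have [c c0 lc] := Sx_Hp_lead X rho sigma j'; exists c => //.
  have f0 : f (Sx j'.1 * Hp j'.2 - c *: Xprod (ylead j')) = 0 by apply: coef_Dge lc.
  move: f0; rewrite (linD lf) (linN lf) (linZ lf) => /eqP; rewrite subr_eq0 => /eqP ->.
  by congr (_ * _); apply: coef_Xprod.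
have := congr1 f ev0; rewrite (lin0 lf) /evJ /mext (lin_sum _ _ _ lf) (bigD1_seq j) ?fset_uniq //=.
rewrite big1_seq => [|j' /andP[j'j j'x]].
  have [//|c c0 fj] := fE j; rewrite (linZ lf) fj eqxx mulr1 addr0 => /eqP.
  by rewrite mulf_eq0 (negPf c0) orbF mcoeff_eq0 jx.
rewrite (linZ lf); have [|c _ ->] := fE j'.
  by rewrite jN; apply: minN; apply/hasP; exists j'.
case: eqP => [/perm_cmon p|_]; last by rewrite mulr0 scaler0.
by case/eqP: j'j; apply: ylead_inj (xk _ j'x) (xk _ jx) p.
Qed.

End Independence.

Section ModeIndependence.
Context {F : numFieldType} {n : nat} (G : 'M[int]_n) {r s : nat}.
Context (rho : 'I_r -> 'I_n) (sigma : 'I_s -> 'I_n).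
Hypothesis inj_rho : injective rho.
Hypothesis inj_sigma : injective sigma.
Hypothesis rho_sigma : forall i j, rho i != sigma j.
Context (e : 'I_r -> seq ('I_r * nat) -> F).
Hypothesis e_neq0 : forall i l, e i l != 0.
Local Notation M1 := {malg F[{cmonom fockvar n}]}.
Local Notation X := (@X F n).
Local Notation Hp := (Hp X rho).
Local Notation Sx := (Sx X sigma).
Local Notation qp := (qp X (@der F n) G rho e).
Local Notation idx := (seq ('I_s * nat) * seq ('I_r * nat))%type.
Local Notation evJ := (evJ rho sigma : {malg F[idx]} -> M1).
Implicit Types (t : seq ('I_s * nat)) (l : seq ('I_r * nat)) (j : idx).
Implicit Types (k : 'I_r -> nat).

Lemma linear_evJ : linear evJ.
Proof. exact: linear_mext. Qed.

Lemma evJU j : evJ << j >> = Sx j.1 * Hp j.2.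
Proof. exact: mextU. Qed.

Lemma coefU j j' : (<< j >> : {malg F[idx]})@_j' = (j == j')%:R.
Proof. by rewrite mcoeffU. Qed.

(** The triangularity of [qp_leading] moved to the free module: m has a nonzero coefficient at j,
    and every other index it involves has larger rank. *)
Lemma qp_lift k W j : sorted_idx k j -> (tot j.2 <= W)%N ->
  exists m : {malg F[idx]}, [/\ evJ m = Sx j.1 * qp j.2,
    forall j', ~ sorted_idx k j' -> m@_j' = 0, m@_j != 0 &
    forall j', j' != j -> (rk (\sum_i k i).+1 W j'.2 <= rk (\sum_i k i).+1 W j.2)%N ->
      m@_j' = 0].
Proof.
case: j => t l [/= st sl lk] lW; pose B := (\sum_i k i).+1.
have lB : (size l < B)%N.
  by rewrite ltnS size_cnt; apply/eq_leq/eq_bigr => i _; rewrite lk.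
have [c c0] := @qp_leading F n _ X (@der F n) (@derivation_der F n) (@derX F n)
  (@gen_X F n) G r rho e e_neq0 B W l sl lB lW.
set g := qp l - _ => gH.
(* The set of possible corrections: after multiplication by [Sx t] they lift to combinations of
   indices of rank above that of l. *)
pose Q := [set g : M1 | exists m : {malg F[idx]}, [/\ evJ m = Sx t * g,
  forall j', ~ sorted_idx k j' -> m@_j' = 0 &
  forall j', (rk B W j'.2 <= rk B W l)%N -> m@_j' = 0]].
have sQ : subspace Q.
  split.
  - exists 0; rewrite (lin0 linear_evJ); split=> [|j' _|j' _]; first exact/esym/mulr0.
    + exact: (lin0 (coef_linear j')).
    + exact: (lin0 (coef_linear j')).
  - move=> u v [m [mu m1 m2]] [m' [mv m1' m2']]; exists (m + m'); split=> [|j' kj|j' kj].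
    + rewrite (linD linear_evJ) mu mv; exact/esym/mulrDr.
    + by apply: etrans (linD (coef_linear j') _ _) _; rewrite m1 // m1' // addr0.
    + by apply: etrans (linD (coef_linear j') _ _) _; rewrite m2 // m2' // addr0.
  - move=> a u [m [mu m1 m2]]; exists (a *: m); split=> [|j' kj|j' kj].
    + rewrite (linZ linear_evJ) mu; exact: scalerAr.
    + by apply: etrans (linZ (coef_linear j') _ _) _; rewrite m1 // scaler0.
    + by apply: etrans (linZ (coef_linear j') _ _) _; rewrite m2 // scaler0.
have [m [mg m1 m2]] : Q g.
  apply: (lspan_min sQ) gH => _ [l' [-> lk' _ lr]].
  have pl : perm_eq (sort lexge l') l' by rewrite perm_sort.
  have can : sorted_idx k (t, sort lexge l').
    split=> //=; first exact: sort_sorted (@lexge_total r) _.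
    by move=> i; rewrite (perm_cnt pl) lk'.
  exists << (t, sort lexge l') >>; split.
  - by rewrite evJU (perm_Hp _ _ pl).
  - by move=> j' kj; rewrite coefU; case: eqP => // jj; case: kj; rewrite -jj.
  - move=> j' jr; rewrite coefU; case: eqP => // jj; move: jr.
    by rewrite -jj /= (perm_rk _ _ pl) leqNgt lr.
have coefE j' : (c *: << (t, l) >> + m)@_j' = c * ((t, l) == j')%:R + m@_j'.
  apply: etrans (coef_linear j' c _ _) _; congr (_ + _); congr (_ * _); exact: coefU.
exists (c *: << (t, l) >> + m); split.
- rewrite linear_evJ evJU mg /g -[RHS]/(Sx t * qp l) scalerAr -mulrDr.
  exact: (congr1 (fun z => Sx t * z) (subrKC _ _)).
- move=> j' kj; rewrite coefE m1 // addr0.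
  by case: eqP => [jj|]; rewrite ?mulr0 //; case: kj; rewrite -jj.
- by rewrite coefE m2 // addr0 eqxx mulr1.
- by move=> j' jj jr; rewrite coefE m2 // addr0 eq_sym (negPf jj) mulr0.
Qed.

(** At an index of least rank among those with nonzero coefficient, the lifts of all the others
    vanish. *)
Lemma qp_indep k (T : seq idx) (a : idx -> F) : uniq T ->
  (forall j, j \in T -> sorted_idx k j) ->
  \sum_(j <- T) a j *: (Sx j.1 * qp j.2) = 0 -> forall j, j \in T -> a j = 0.
Proof.
move=> uT Tk sum0 j0 j0T; apply/eqP/negPn/negP => aj0.
(* A common bound on the totals, so that a single rank function serves all of T. *)
pose W := \max_(j <- T) tot j.2; pose B := (\sum_i k i).+1.
have exN : exists N, has (fun j => (a j != 0) && (rk B W j.2 == N)) T.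
  by exists (rk B W j0.2); apply/hasP; exists j0; rewrite // aj0 eqxx.
have [_ /hasP[j jT /andP[aj /eqP <-]] minj] := ex_minnP exN.
pose lift_of j (m : {malg F[idx]}) := j \in T ->
  [/\ evJ m = Sx j.1 * qp j.2, forall j', ~ sorted_idx k j' -> m@_j' = 0,
    m@_j != 0 & forall j', j' != j -> (rk B W j'.2 <= rk B W j.2)%N -> m@_j' = 0].
have ex_lift i : exists m, lift_of i m.
  rewrite /lift_of.
  have [iT|_] := boolP (i \in T); last by exists 0.
  have iW : (tot i.2 <= W)%N by apply: (@leq_bigmax_seq _ T xpredT (fun j => tot j.2)).
  by have [m mP] := qp_lift (Tk _ iT) iW; exists m.
have [m mP] := boolp.choice ex_lift.
pose x := \sum_(j <- T) a j *: m j.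
have x0 : x = 0.
  apply: (evJ_inj inj_rho inj_sigma rho_sigma (k := k)) => [j'|]; last first.
    rewrite /x (lin_sum _ _ _ linear_evJ) -[RHS]sum0.
    rewrite big_seq [RHS]big_seq; apply: eq_bigr => j' j'T.
    by rewrite (linZ linear_evJ); have [-> _ _ _] := mP _ j'T.
  apply: contraTP => kj; rewrite -mcoeff_eq0; apply/eqP.
  apply: etrans (lin_sum _ _ _ (coef_linear j')) _; rewrite big_seq big1 // => i iT.
  apply: etrans (linZ (coef_linear j') _ _) _.
  by have [_ mk _ _] := mP _ iT; rewrite (mk _ kj) scaler0.
have := congr1 (fun y : {malg F[idx]} => y@_j : F^o) x0.
rewrite /x (lin_sum _ _ _ (coef_linear j)) (lin0 (coef_linear j)) (bigD1_seq j) //=.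
rewrite big1_seq => [|i /andP[ij iT]].
  have [_ _ mj _] := mP _ jT; rewrite (linZ (coef_linear j)) addr0 => /eqP.
  by rewrite mulf_eq0 (negPf aj) (negPf mj).
rewrite (linZ (coef_linear j)); have [_ _ _ mi] := mP _ iT.
have [->|ai] := eqVneq (a i) 0; first by rewrite scale0r.
rewrite mi ?scaler0 // 1?eq_sym //; apply: minj; apply/hasP; exists i => //.
by rewrite ai eqxx.
Qed.

End ModeIndependence.

(** * Assembling the bases over all lattice points *)

Section PrincipalBasis.
Context {F : numFieldType} {n : nat} (G : 'M[int]_n).
Context (eps : 'rV[rat]_n -> 'rV[rat]_n -> F).
Context {r s : nat} (rho : 'I_r -> 'I_n) (sigma : 'I_s -> 'I_n).
Local Notation M1 := {malg F[{cmonom fockvar n}]}.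
Local Notation monom := ({cmonom fockvar n} * 'rV[rat]_n)%type.
Local Notation V := {malg F[monom]}.
Local Notation X := (@X F n).
Local Notation der := (@der F n).
Local Notation LS := (sublattice (mem (codom sigma))).
Local Notation Fs := (Fsp X rho sigma : ('I_r -> nat) -> set M1).
Local Notation idx := (seq ('I_s * nat) * seq ('I_r * nat))%type.
Implicit Types (k : 'I_r -> nat) (beta delta : 'rV[rat]_n) (u f : M1).
Implicit Types (l : seq ('I_r * nat)) (t : seq ('I_s * nat)) (j : idx).
Hypothesis symG : symmetric_gram G.
Hypothesis coc : standard_cocycle G eps.
Hypothesis inj_rho : injective rho.
Hypothesis inj_sigma : injective sigma.
Hypothesis rho_sigma : forall i i', rho i != sigma i'.
Context (lambda : 'rV[rat]_n).
Hypothesis dl : dual_lattice G lambda.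

Definition proj beta : V -> M1 := mext (fun b : monom => if b.2 == beta then << b.1 >> else 0).

Lemma linear_proj beta : linear (proj beta).
Proof. exact: linear_mext. Qed.

Lemma proj_tens beta beta' u : proj beta (tens u beta') = if beta' == beta then u else 0.
Proof.
have projU (m : {cmonom fockvar n}) b : proj beta << (m, b) >> = if b == beta then << m >> else 0.
  exact: mextU.
case: eqP => bb.
  move: u; apply: (eq_linear (linear_comp (linear_tens beta') (linear_proj beta))) => // m.
  by rewrite tensU projU bb eqxx.
move: u; apply: (eq_linear (linear_comp (linear_tens beta') (linear_proj beta))) => [|m].
  by move=> a u v; rewrite scaler0 addr0.
by rewrite tensU projU; case: eqP.
Qed.

(** The coordinate at rho_i reads off k_i, as elements of L(S) have none there. *)
Lemma pt_inj k k' delta delta' : LS delta -> LS delta' ->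
  pt rho k delta = pt rho k' delta' -> k =1 k' /\ delta = delta'.
Proof.
have S0 d (i : 'I_r) : LS d -> d ord0 (rho i) = 0.
  move=> [c ->]; rewrite summxE big1 // => m /codomP[j ->].
  by rewrite !mxE eqxx (negPf (rho_sigma _ _)) mulr0.
have R0 (q : 'I_r -> nat) (i : 'I_r) :
    (\sum_i (q i)%:R *: bvec (rho i) : 'rV[rat]_n) ord0 (rho i) = (q i)%:R.
  rewrite summxE (bigD1 i) //= !mxE !eqxx mulr1 big1 ?addr0 // => i' ii'.
  by rewrite !mxE eqxx (inj_eq inj_rho) eq_sym (negPf ii') mulr0.
move=> Ld Ld' pp; have kk : k =1 k'.
  move=> i; have := congr1 (fun x : 'rV[rat]_n => x ord0 (rho i)) pp.
  rewrite /pt !mxE (S0 _ _ Ld) (S0 _ _ Ld') !R0 !add0r => /eqP.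
  by rewrite eqr_nat => /eqP.
split=> //; move: pp; rewrite /pt -(eq_bigr _ (fun i _ => congr1 (fun q => q%:R *: bvec (rho i)) (kk i))).
exact: addIr.
Qed.

Lemma dual_shift delta : LS delta -> dual_lattice G (lambda + delta).
Proof. by move=> Ld; apply: dual_latticeD => //; apply/lattice_dual/sublatticeS/Ld. Qed.

Lemma pt_wl l delta : wl rho l + (lambda + delta) = lambda + pt rho (cnt l) delta.
Proof. by rewrite wl_cnt addrC /pt addrA. Qed.

Local Notation q delta := (qp X der G rho (ev eps rho (lambda + delta))).

Definition bv delta j : V :=
  tens (Sx X sigma j.1 * q delta j.2) (lambda + pt rho (cnt j.2) delta).

Lemma actM_Sx t delta l : actM (Sx X sigma t) (Rv G eps rho (lambda + delta) l) = bv delta (t, l).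
Proof. by rewrite actM_tens pt_wl. Qed.

Lemma Sx_sort t : Sx X sigma (sort lexge t) = Sx X sigma t :> M1.
Proof. by apply: perm_big; rewrite perm_sort. Qed.

Lemma tensor_setE k delta : LS delta ->
  tensor_set (Sbasis sigma) (Rbasis G eps rho (lambda + delta) k) =
  [set v | exists2 j, v = bv delta j & sorted_idx k j].
Proof.
move=> Ld; have dd := dual_shift Ld.
rewrite (RbasisE eps rho symG dd) SbasisE; apply/seteqP; split=> v.
  move=> [_ [t ->] [_ [l [-> sl lk]] <-]].
  rewrite -Sx_sort actM_Sx; exists (sort lexge t, l) => //.
  by split=> //=; apply: sort_sorted (@lexge_total s) _.
move=> [[t l] -> [/= st sl lk]].
exists (Sx X sigma t); first by exists t.
exists (Rv G eps rho (lambda + delta) l); first by exists l.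
exact: actM_Sx.
Qed.

Definition all_bv : set V := [set v | exists delta k j,
  [/\ v = bv delta j, LS delta & sorted_idx k j]].

Lemma tensor_set_all :
  tensor_set (Sbasis sigma) (\bigcup_(dk in [set dk : 'rV[rat]_n * ('I_r -> nat) | LS dk.1])
    Rbasis G eps rho (lambda + dk.1) dk.2) = all_bv.
Proof.
apply/seteqP; split=> [_ [x Sx [y [[delta k] /= Ld Ry] <-]]|_ [delta [k [j [-> Ld kj]]]]].
  have : tensor_set (Sbasis sigma) (Rbasis G eps rho (lambda + delta) k) (actM x y).
    by exists x => //; exists y.
  by rewrite tensor_setE // => -[j -> kj]; exists delta, k, j.
have : [set v | exists2 j, v = bv delta j & sorted_idx k j] (bv delta j) by exists j.
rewrite -tensor_setE // => -[x Sx [y Ry <-]].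
by exists x => //; exists y => //; exists (delta, k).
Qed.

(** Projecting to one lattice point leaves vectors with the same delta and k, by [pt_inj], and
    [qp_indep] applies to these. *)
Lemma lin_indep_bv : lin_indep all_bv.
Proof.
move=> es c ue es_all sum0 w0 w0s.
(* Independence concerns a set of vectors, so an index is chosen for each vector of the list;
   vectors outside it get a default index. *)
pose is_bv w (p : 'rV[rat]_n * idx) := w \in es ->
  [/\ w = bv p.1 p.2, LS p.1 & sorted_idx (cnt p.2.2) p.2].
have ex_bv w : exists p, is_bv w p.
  rewrite /is_bv; have [/es_all[delta [k [j [-> Ld [sj1 sj2 _]]]]]|_] := boolP (w \in es).
    by exists (delta, j).
  by exists (0, ([::], [::])).
have [phi phiP] := boolp.choice ex_bv.
pose point w := lambda + pt rho (cnt (phi w).2.2) (phi w).1.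
pose d0 := (phi w0).1; pose k0 := cnt (phi w0).2.2; pose b0 := point w0.
pose es0 := [seq w <- es | point w == b0].
have es0P w : w \in es0 -> [/\ w = bv d0 (phi w).2 & sorted_idx k0 (phi w).2].
  rewrite mem_filter => /andP[/eqP pw ws]; have [wE Ld sj] := phiP w ws.
  have [_ Ld0 _] := phiP w0 w0s.
  have [kk dd] := pt_inj Ld Ld0 (addrI lambda pw).
  split; first by rewrite /d0 -dd.
  by case: sj => s1 s2 _; split.
pose T := [seq (phi w).2 | w <- es0].
have phiK : {in es0, cancel (fun w => (phi w).2) (bv d0)} by move=> w /es0P[].
have uT : uniq T by rewrite map_inj_in_uniq ?filter_uniq //; apply: can_in_inj phiK.
have Tk j : j \in T -> sorted_idx k0 j by move=> /mapP[w /es0P[_ ?] ->].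
have [_ Ld0 _] := phiP w0 w0s.
have e0 := ev_neq0 rho coc (dual_shift Ld0).
have w0T : (phi w0).2 \in T by apply: map_f; rewrite mem_filter eqxx.
suff T0 : \sum_(j <- T) c (bv d0 j) *: (Sx X sigma j.1 * q d0 j.2) = 0.
  have := qp_indep inj_rho inj_sigma rho_sigma e0 uT Tk T0 w0T.
  by have [<- _ _] := phiP w0 w0s.
have := congr1 (proj b0) sum0; rewrite (lin0 (linear_proj b0)); apply: etrans.
rewrite (lin_sum _ _ _ (linear_proj b0)) big_map big_filter [LHS]big_mkcond.
apply: eq_big_seq => w ws.
have [wE _ _] := phiP w ws.
have projw : proj b0 w = if point w == b0 then Sx X sigma (phi w).2.1 * q (phi w).1 (phi w).2.2 else 0.
  by rewrite {1}wE /bv proj_tens.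
rewrite (linZ (linear_proj b0)) projw.
case: ifP => [pw|_]; last by rewrite scaler0.
have w0' : w \in es0 by rewrite mem_filter pw.
have [wE' _] := es0P w w0'.
have [_ Ld _] := phiP w ws.
have [_ dd] := pt_inj Ld Ld0 (addrI lambda (eqP pw)).
by rewrite -wE' /d0 -dd.
Qed.

Lemma WRSmod_Rv delta l : LS delta ->
  WRSmod G eps rho sigma lambda (Rv G eps rho (lambda + delta) l).
Proof.
move=> Ld; elim: l => [|[i x] l IH].
  by rewrite Rv_nil; apply: (WRSmod_expv symG coc dl Ld).
rewrite -(emode_Rv eps rho symG (dual_shift Ld)) -vmode_expv.
by apply: WRSmod_vmode IH; left; exists i.
Qed.

Lemma WRSmod_bv delta j : LS delta -> WRSmod G eps rho sigma lambda (bv delta j).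
Proof.
move=> Ld; rewrite /bv -pt_wl; apply: (WRSmod_Sx coc).
  exact: dual_wl (dual_shift Ld) _.
exact: WRSmod_Rv.
Qed.

Lemma tens_span delta k f : LS delta -> Fs k f ->
  lspan [set v | exists2 j, v = bv delta j & sorted_idx k j] (tens f (lambda + pt rho k delta)).
Proof.
move=> Ld; set B := [set v | _]; set b := _ + _.
apply: (lspan_lin (linear_tens b) (subspace_lspan B)) => _ [t [l [-> lk]]].
have e0 := ev_neq0 rho coc (dual_shift Ld).
have lt : linear (fun v : M1 => tens (Sx X sigma t * v) b).
  exact: linear_comp (linear_mulA _) (linear_tens b).
apply: (lspan_lin lt (subspace_lspan B) _ (@Hp_span F n _ X der (@derivation_der F n)
  (@derX F n) (@gen_X F n) G r rho _ e0 l)) => _ [l' [-> sl' lk']].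
have lk'k : cnt l' =1 k by move=> i; rewrite lk' lk.
apply: mem_lspan; exists (sort lexge t, l').
  rewrite /bv Sx_sort /b /pt.
  by rewrite (eq_bigr _ (fun i _ => congr1 (fun q => q%:R *: bvec (rho i)) (lk'k i))).
by split=> //=; apply: sort_sorted (@lexge_total s) _.
Qed.

Lemma lspan_all_bv : lspan all_bv = WRSmod G eps rho sigma lambda.
Proof.
apply/seteqP; split.
  apply: (lspan_min (subspace_WRSmod _ _ _ _ _)) => _ [delta [k [j [-> Ld _]]]].
  exact: WRSmod_bv.
move=> v /(WRSmod_Usp symG dl); apply: (lspan_min (subspace_lspan _)).
move=> _ [k [delta [f [-> Ld Ff]]]]; apply: lspanS (tens_span Ld Ff) => _ [j -> kj].
by exists delta, k, j.
Qed.

Lemma lspan_graded delta k : LS delta ->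
  lspan [set v | exists2 j, v = bv delta j & sorted_idx k j] =
  WRSgr G eps rho sigma lambda (\sum_(i < r) (k i)%:R *: bvec (rho i) + delta).
Proof.
move=> Ld; have tauE : \sum_(i < r) (k i)%:R *: bvec (rho i) + delta + lambda =
    lambda + pt rho k delta by rewrite addrC /pt (addrC delta).
apply/seteqP; split=> [|v [Wv [u]]]; rewrite ?tauE.
  apply: lspan_min => [|_ [j -> [_ _ jk]]].
    have sW := subspace_WRSmod G eps rho sigma lambda.
    split=> [|v w [Wv [u vE]] [Ww [u' wE]]|c v [Wv [u vE]]]; split.
    - exact: (subspace0 sW).
    - by exists 0; rewrite (lin0 (linear_tens _)).
    - exact: (subspaceD sW Wv Ww).
    - by exists (u + u'); rewrite vE wE (linD (linear_tens _)).
    - exact: (subspaceZ c sW Wv).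
    - by exists (c *: u); rewrite vE (linZ (linear_tens _)).
  split; first exact: WRSmod_bv.
  exists (Sx X sigma j.1 * q delta j.2); rewrite /bv tauE /pt.
  by rewrite (eq_bigr _ (fun i _ => congr1 (fun q => q%:R *: bvec (rho i)) (jk i))).
move=> vE; move: Wv; rewrite vE => Wv; apply: tens_span => //; move: Wv.
(* The polynomial u is the projection of v, and projecting the spanning vectors of [Usp] to this
   lattice point leaves only those of F_k, by [pt_inj]. *)
have uE := proj_tens (lambda + pt rho k delta) (lambda + pt rho k delta) u.
rewrite eqxx in uE; rewrite -{2}uE => /(WRSmod_Usp symG dl).
apply: (lspan_lin (linear_proj _) (subspace_lspan _)) => _ [k' [delta' [f [-> Ld' Ff]]]].
rewrite proj_tens; case: eqP => [/addrI pp|_]; last exact: subspace0 (subspace_lspan _).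
by apply: Fsp_eq Ff; case: (pt_inj Ld' Ld pp).
Qed.

Lemma lin_indepS (A B : set V) : A `<=` B -> lin_indep B -> lin_indep A.
Proof. by move=> AB iB es c ue esA; apply: iB => // w /esA /AB. Qed.

Lemma all_bv_neq0 v : all_bv v -> v <> 0.
Proof.
move=> Av v0.
have Aw w : w \in [:: v] -> all_bv w by rewrite inE => /eqP ->.
have sum0 : \sum_(w <- [:: v]) (1 : F) *: w = 0 by rewrite big_seq1 scale1r.
have /eqP := @lin_indep_bv [:: v] (fun=> 1) isT Aw sum0 v (mem_head _ _).
by rewrite oner_eq0.
Qed.

(** A common vector would be nonzero, so it has a well-defined lattice point, which determines delta
    and k. *)
Lemma trivIset_Rbasis :
  trivIset [set dk : 'rV[rat]_n * ('I_r -> nat) | LS dk.1]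
    (fun dk => Rbasis G eps rho (lambda + dk.1) dk.2).
Proof.
move=> [delta k] [delta' k'] /= Ld Ld' [v []].
rewrite (RbasisE eps rho symG (dual_shift Ld)) (RbasisE eps rho symG (dual_shift Ld')).
move=> [l [vE sl lk]] [l' [vE' sl' lk']].
have Av : all_bv v.
  have SE : Sx X sigma [::] * q delta l = q delta l by rewrite /Sx big_nil mul1r.
  exists delta, k, ([::], l); split; [|exact: Ld | by split].
  rewrite -[bv _ _]/(tens (Sx X sigma [::] * q delta l) (lambda + pt rho (cnt l) delta)).
  by rewrite SE -pt_wl; exact: vE.
have pp : wl rho l' + (lambda + delta') = wl rho l + (lambda + delta).
  apply/eqP; apply: contra_notT (all_bv_neq0 Av) => /negPf pp.
  have := proj_tens (wl rho l + (lambda + delta)) (wl rho l + (lambda + delta)) (q delta l).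
  rewrite eqxx -[tens _ _]vE vE' proj_tens pp => q0.
  by rewrite -vE' vE /Rv -q0 (lin0 (linear_tens _)).
move: pp; rewrite !pt_wl => /addrI /(pt_inj Ld' Ld)[kk ->].
by congr pair; apply: funext => i; rewrite -lk -lk' kk.
Qed.

End PrincipalBasis.

(** The coproduct in (ii) is expressed as a union over the pairs (delta, k) together with the
    pairwise disjointness of its members. *)
Theorem corollary2p2 (K : realType) (n r s : nat) (G : 'M[int]_n)
    (eps : 'rV[rat]_n -> 'rV[rat]_n -> complex K)
    (rho : 'I_r -> 'I_n) (sigma : 'I_s -> 'I_n) (lambda : 'rV[rat]_n) :
  symmetric_gram G -> nondegenerate_gram G ->
  standard_cocycle G eps ->
  injective rho -> injective sigma -> (forall i j, rho i != sigma j) ->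
  dual_lattice G lambda ->
  (forall (delta : 'rV[rat]_n) (k : 'I_r -> nat),
     sublattice (mem (codom sigma)) delta ->
     let tau := \sum_(i < r) (k i)%:R *: bvec (rho i) + delta in
     is_basis (tensor_set (Sbasis sigma) (Rbasis G eps rho (lambda + delta) k))
              (WRSgr G eps rho sigma lambda tau))
  /\
  (let D : set ('rV[rat]_n * ('I_r -> nat)) :=
     [set dk | sublattice (mem (codom sigma)) dk.1] in
   let Bdk (dk : 'rV[rat]_n * ('I_r -> nat)) :=
     Rbasis G eps rho (lambda + dk.1) dk.2 in
   trivIset D Bdk /\
   is_basis (tensor_set (Sbasis sigma) (\bigcup_(dk in D) Bdk dk))
            (WRSmod G eps rho sigma lambda)).
Proof.
move=> symG _ coc inj_rho inj_sigma rho_sigma dl.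
have indep := lin_indep_bv coc inj_rho inj_sigma rho_sigma dl.
split=> [delta k Ld tau|D Bdk].
  rewrite (tensor_setE eps rho symG dl k Ld); split; last first.
    exact: (lspan_graded symG coc inj_rho rho_sigma dl k Ld).
  by apply: lin_indepS indep => _ [j -> kj]; exists delta, k, j.
split; first exact: (trivIset_Rbasis symG coc inj_rho inj_sigma rho_sigma dl).
rewrite (tensor_set_all eps rho sigma symG dl); split; first exact: indep.
exact: (lspan_all_bv rho sigma symG coc dl).
Qed.
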